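(* Assume that $\sigma$ is an action selector for $(\mathbb R^{2n},\omega_0)$. Then for all $r>0$, $$c_\sigma\left(B^{2n}(r)\right)=c_\sigma\left(Z^{2n}(r)\right)=\pi r^2\quad\text{and}\quad c^\sigma\left(B^{2n}(r)\right)=c^\sigma\left(Z^{2n}(r)\right)=\pi r^2 .$$
   Context: Notation. $\omega_0=\sum_{i=1}^n dq_i\wedge dp_i$ is the standard symplectic form on $M=\mathbb R^{2n}$; $B^{2n}(r)$ is the open ball of radius $r$ in $\mathbb R^{2n}$ and $Z^{2n}(r)=B^2(r)\times\mathbb R^{2n-2}\subset\mathbb R^{2n}$ is the standard symplectic cylinder ($B^2(r)$ in the $(q_1,p_1)$-plane). Below $(M,\omega)=(\mathbb R^{2n},\omega_0)$. Hamiltonians. Let $I=[0,1]$. For $A\subset M$, $\mathcal H(I\times A)$ is the set of smooth functions $H\colon I\times M\to\mathbb R$ whose support is compact and contained in $I\times\operatorname{Int}A$. Put $\mathcal H=\mathcal H(I\times M)$, and let $\mathcal H(A)$ be the set of those functions in $\mathcal H(I\times A)$ which do not depend on $t\in I$. The Hamiltonian vector field of $H\in\mathcal H$, defined by $\omega(X_{H_t},\cdot)=-dH_t(\cdot)$, generates a flow $\varphi_H^t$ with time-1-map $\varphi_H$. $\mathcal P^\circ(H)$ is the set of contractible $1$-periodic orbits of $\varphi_H^t$ (constant orbits included). For $x\in\mathcal P^\circ(H)$ let $\mathcal D(x)$ be the set of smooth discs $\bar x\colon D^2=\{z\in\mathbb C: |z|\le1\}\to M$ with $\bar x(e^{2\pi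 it})=x(t)$, and write $\int_{\bar x}\omega=\int_{D^2}\bar x^*\omega$. The action is $\mathcal A_H(\bar x)=-\int_{\bar x}\omega+\int_0^1H(t,x(t))\,dt$, and the action spectrum is $\Sigma^\circ(H)=\{\mathcal A_H(\bar x): x\in\mathcal P^\circ(H),\ \bar x\in\mathcal D(x)\}$. Set $E^+(H)=\int_0^1\max_{x\in M}H(t,x)\,dt$ and $(H\#K)(t,x)=H(t,x)+K(t,(\varphi_H^t)^{-1}(x))$ for $H,K\in\mathcal H$; $H\#K$ generates $\varphi_H\circ\varphi_K$. Simple and admissible Hamiltonians. $H\in\mathcal H(M)$ is simple, $H\in\mathcal S(M)$, if (P1) $H\ge0$; (P2) $H|_U=\max H$ for some open non-empty $U\subset M$; (P3) the only critical values of $H$ are $0$ and $\max H$ (in particular $\min H=0$). For $A\subset M$, $\mathcal S(A)$ is the set of simple functions in $\mathcal H(A)$. $\mathcal S^\circ_{\mathrm{HZ}}(M)$ is the set of $H\in\mathcal S(M)$ such that $\varphi_H^t$ has no non-constant, contractible in $M$, $T$-periodic orbit with period $T\le1$. Action selectors. An action selector for $(M,\omega)$ is a map $\sigma\colon\mathcal H\to\mathbb R$ such that (AS1) $\sigma(H)\in\Sigma^\circ(H)$ for all $H\in\mathcal H$; (AS2) $\sigma(H)>0$ for all $H\in\mathcal S(M)$ with $H\not\equiv0$; (AS2$^+$) $\sigma(H)=\max H$ for all $H\in\mathcal S^\circ_{\mathrm{HZ}}(M)$; (AS3) $\sigma(H)\le E^+(H)$ for all $H\in\mathcal H$; (AS4)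 $\sigma$ is continuous with respect to the $C^0$-topology on $\mathcal H$; (AS5) $\sigma(H\#K)\le\sigma(H)+E^+(K)$ for all $H,K\in\mathcal H$. Spectral capacities. For $A\subset M=\mathbb R^{2n}$, $c_\sigma(A)=c_\sigma(A,M)=\sup\{\sigma(H): H\in\mathcal S(A)\}$ and $c^\sigma(A)=c^\sigma(A,M)=\sup\{\sigma(H): H\in\mathcal H(I\times A)\}$. *)

(* Defs.v *)
From HB Require Import structures.
From mathcomp Require Import all_boot all_order all_algebra.
From mathcomp Require Import all_classical all_reals all_analysis.

Set Implicit Arguments.
Unset Strict Implicit.
Unset Printing Implicit Defensive.

Import Order.TTheory GRing.Theory Num.Theory.
Import numFieldNormedType.Exports.

Local Open Scope classical_set_scope.
Local Open Scope ring_scope.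

(* M = R^{2m} with m = n + 1 >= 1; a point is a pair (q, p) of row vectors.  The
   library norm on this type is a sup norm: it is used only up to equivalence
   (topology, derivatives, Lipschitz maps), and the Euclidean balls are defined
   explicitly. *)
Definition phase (R : realType) (n : nat) : normedModType R :=
  ('rV[R]_n.+1 * 'rV[R]_n.+1)%type.

Definition I01 {R : realType} : set R := [set t | 0 <= t <= 1].

(* Smoothness: on an open set U, f is C^oo iff all its iterated directional
   derivatives exist and are continuous on U.  On an arbitrary set E, smooth
   means extendable to a smooth function on an open neighbourhood of E; the
   values of f outside E are irrelevant. *)
Fixpoint iter_derive {R : realType} {V W : normedModType R}
    (s : seq V) (f : V -> W) : V -> W :=
  if s is v :: s' then fun x => 'D_v (iter_derive s' f) x else f.

Definition smooth_open {R : realType} {V W : normedModType R}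
    (U : set V) (f : V -> W) : Prop :=
  forall (s : seq V) (x : V), U x ->
    {for x, continuous (iter_derive s f)} /\
    forall v : V, derivable (iter_derive s f) x v.

Definition smooth_on {R : realType} {V W : normedModType R}
    (E : set V) (f : V -> W) : Prop :=
  exists (U : set V) (g : V -> W),
    [/\ open U, E `<=` U, smooth_open U g & {in E, g =1 f}].

Definition omega0 {R : realType} {n : nat} (X Y : phase R n) : R :=
  \sum_(i < n.+1) (X.1 ord0 i * Y.2 ord0 i - X.2 ord0 i * Y.1 ord0 i).

Definition euclidean_ball {R : realType} {n : nat} (r : R) : set (phase R n) :=
  [set x : phase R n |
    \sum_(i < n.+1) (x.1 ord0 i ^+ 2 + x.2 ord0 i ^+ 2) < r ^+ 2].

Definition cylinder {R : realType} {n : nat} (r : R) : set (phase R n) :=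
  [set x : phase R n | x.1 ord0 ord0 ^+ 2 + x.2 ord0 ord0 ^+ 2 < r ^+ 2].

(* A function on I x M is represented by a total function on R x M of which
   only the restriction to I x M matters. *)
Definition tham (R : realType) (n : nat) : Type := R * phase R n -> R.

Definition support_in_I {R : realType} {n : nat} (H : tham R n) :
    set (R * phase R n) :=
  closure [set z : R * phase R n | I01 z.1 /\ H z != 0].

Definition ham {R : realType} {n : nat} (A : set (phase R n)) (H : tham R n) :
    Prop :=
  [/\ smooth_on [set z : R * phase R n | I01 z.1] (H : R * phase R n -> R^o),
      compact (support_in_I H) &
      support_in_I H `<=` [set z : R * phase R n | I01 z.1 /\ (A°) z.2]].

Definition const_in_time {R : realType} {n : nat} (h : phase R n -> R) :
    tham R n :=
  fun z => h z.2.

Definition ham_aut {R : realType} {n : nat} (A : set (phase R n))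
    (h : phase R n -> R) : Prop :=
  ham A (const_in_time h).

(* The supremum is attained for the continuous compactly supported functions
   to which this is applied. *)
Definition maxM {R : realType} {n : nat} (h : phase R n -> R) : R :=
  sup (range h).

(* x' = X_{H_t}(x) on [0, T], where omega0(X_{H_t}, .) = - dH_t.  The equation
   is imposed on ]0, T[ together with continuity on [0, T]; it then also holds
   at the endpoints with one-sided derivatives. *)
Definition trajectory {R : realType} {n : nat} (H : tham R n) (T : R)
    (x : R -> phase R n) : Prop :=
  {within [set t | 0 <= t <= T], continuous x} /\
  forall t : R, 0 < t < T ->
    derivable x t 1 /\
    forall v : phase R n,
      omega0 ('D_1 x t) v =
      - 'D_v (fun y : phase R n => H (t, y) : R^o) (x t).

Definition is_flow {R : realType} {n : nat} (H : tham R n)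
    (phi : R -> phase R n -> phase R n) : Prop :=
  forall x, phi 0 x = x /\ trajectory H 1 (phi ^~ x).

Definition contractible_loop {R : realType} {n : nat} (T : R)
    (x : R -> phase R n) : Prop :=
  exists (h : R * R -> phase R n) (c : phase R n),
    [/\ {within [set z : R * R | 0 <= z.1 <= 1 /\ 0 <= z.2 <= T], continuous h},
        forall t, 0 <= t <= T -> h (0, t) = x t,
        forall t, 0 <= t <= T -> h (1, t) = c &
        forall s, 0 <= s <= 1 -> h (s, 0) = h (s, T)].

Definition contractible_orbit {R : realType} {n : nat} (H : tham R n) (T : R)
    (x : R -> phase R n) : Prop :=
  [/\ trajectory H T x, x 0 = x T & contractible_loop T x].

Definition disc {R : realType} : set (R * R) :=
  [set z : R * R | z.1 ^+ 2 + z.2 ^+ 2 <= 1].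

(* As H need not be 1-periodic in t, an orbit x with x(0) = x(1) may
   have x'(0) <> x'(1), i.e. a corner at the boundary point 1 of the disc, and
   then bounds no disc that is smooth at that point.  Capping discs are
   therefore required to be smooth on D^2 minus the point 1 and Lipschitz on
   D^2.  All smooth discs are of this kind, and by Stokes' theorem (applied off
   a small neighbourhood of 1) the value of the integral of omega0 is the
   integral of sum_i q_i dp_i over x in every case.  Discs are represented by
   total functions of which only the restriction to D^2 matters. *)
Definition capping_disc {R : realType} {n : nat} (x : R -> phase R n)
    (xb : R * R -> phase R n) : Prop :=
  [/\ smooth_on (disc `\ ((1, 0) : R * R)) xb,
      exists k : R, forall z w : R * R, disc z -> disc w ->
        `|xb z - xb w| <= k * `|z - w| &
      forall t : R, I01 t ->
        xb (cos (2 * pi * t), sin (2 * pi * t)) = x t].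

(* The integral over D^2 of xb^* omega0; the boundary circle, where the total
   function xb need not be differentiable, is a null set and is left out. *)
Definition symplectic_area {R : realType} {n : nat}
    (xb : R * R -> phase R n) : R :=
  Rintegral (lebesgue_measure \x lebesgue_measure)%E
    [set z : R * R | z.1 ^+ 2 + z.2 ^+ 2 < 1]
    (fun z : R * R => omega0 ('D_(1, 0) xb z) ('D_(0, 1) xb z)).

Definition action {R : realType} {n : nat} (H : tham R n) (x : R -> phase R n)
    (xb : R * R -> phase R n) : R :=
  - symplectic_area xb + Rintegral lebesgue_measure I01 (fun t => H (t, x t)).

Definition spectrum {R : realType} {n : nat} (H : tham R n) : set R :=
  [set a | exists (x : R -> phase R n) (xb : R * R -> phase R n),
     [/\ contractible_orbit H 1 x, capping_disc x xb & a = action H x xb]].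

Definition Eplus {R : realType} {n : nat} (H : tham R n) : R :=
  Rintegral lebesgue_measure I01 (fun t => maxM (fun x => H (t, x))).

(* H # K, where psi t is the inverse of the time-t-map of the flow of H *)
Definition hash {R : realType} {n : nat} (H : tham R n)
    (psi : R -> phase R n -> phase R n) (K : tham R n) : tham R n :=
  fun z => H z + K (z.1, psi z.1 z.2).

Definition is_inverse_flow {R : realType} {n : nat} (H : tham R n)
    (psi : R -> phase R n -> phase R n) : Prop :=
  exists2 phi, is_flow H phi &
    forall t, I01 t -> cancel (phi t) (psi t) /\ cancel (psi t) (phi t).

Definition critical_values {R : realType} {n : nat} (h : phase R n -> R) :
    set R :=
  [set h x | x in [set x | forall v, 'D_v (h : phase R n -> R^o) x = 0]].

Definition simple {R : realType} {n : nat} (A : set (phase R n))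
    (h : phase R n -> R) : Prop :=
  [/\ ham_aut A h,
      forall x, 0 <= h x,
      exists U : set (phase R n),
        [/\ open U, U !=set0 & forall x, U x -> h x = maxM h] &
      critical_values h = [set 0; maxM h]].

(* Since h does not depend on t and T <= 1, its T-periodic orbits are the
   trajectories on [0, T] that close up. *)
Definition HZ_admissible {R : realType} {n : nat} (h : phase R n -> R) : Prop :=
  simple setT h /\
  forall (T : R) (x : R -> phase R n), 0 < T <= 1 ->
    contractible_orbit (const_in_time h) T x ->
    forall t, 0 <= t <= T -> x t = x 0.

(* sel_ext says that sigma H depends only on the restriction of H to I x M; the
   values of sigma at functions H that do not satisfy ham setT are irrelevant. *)
Record action_selector {R : realType} {n : nat} (sigma : tham R n -> R) :
    Prop := ActionSelector {
  sel_ext : forall H K : tham R n, ham setT H -> ham setT K ->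
    (forall t x, I01 t -> H (t, x) = K (t, x)) -> sigma H = sigma K;
  sel_AS1 : forall H : tham R n, ham setT H -> spectrum H (sigma H);
  sel_AS2 : forall h : phase R n -> R, simple setT h ->
    (exists x, h x != 0) -> 0 < sigma (const_in_time h);
  sel_AS2plus : forall h : phase R n -> R, HZ_admissible h ->
    sigma (const_in_time h) = maxM h;
  sel_AS3 : forall H : tham R n, ham setT H -> sigma H <= Eplus H;
  sel_AS4 : forall H : tham R n, ham setT H ->
    forall e : R, 0 < e -> exists2 d : R, 0 < d &
      forall K : tham R n, ham setT K ->
        (forall t x, I01 t -> `|H (t, x) - K (t, x)| <= d) ->
        `|sigma H - sigma K| < e;
  sel_AS5 : forall (H K : tham R n) (psi : R -> phase R n -> phase R n),
    ham setT H -> ham setT K -> is_inverse_flow H psi ->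
    sigma (hash H psi K) <= sigma H + Eplus K
}.

Definition lower_capacity {R : realType} {n : nat} (sigma : tham R n -> R)
    (A : set (phase R n)) : \bar R :=
  ereal_sup [set (sigma (const_in_time h))%:E | h in simple A].

Definition upper_capacity {R : realType} {n : nat} (sigma : tham R n -> R)
    (A : set (phase R n)) : \bar R :=
  ereal_sup [set (sigma H)%:E | H in ham A].

(* Main.v *)
(* Lower bound: a radial Hamiltonian on the ball whose slope stays below pi has no
   non-constant orbit of period at most 1, so (AS2+) gives its maximum, which can be
   taken close to pi r^2.

   Upper bound: let H be supported in the cylinder, put z_0 = (q_0, p_0), and let F be the
   product of a cut-off function of |z_0|^2 and one of the squared norm of the remaining
   coordinates, chosen equal to a large constant on the support of H.  The flow of F is the
   identity there, so H = F # (H - F) and (AS5) gives sigma(H) <= sigma(F).  The flow of F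
   rotates the coordinate planes, and its spectrum does not meet ]pi r^2, 19/10 pi r^2[.
   The functions c(t) F with c of integral 1 all have the same spectrum, so by (AS4) and
   the intermediate value theorem it suffices that sigma(c F) < 19/10 pi r^2 for one c.
   Take c supported in ]2/3, 5/6[, and let K be a Hamiltonian of maximum at most
   182/100 pi r^2 which, run with a weight d supported in ]1/6, 1/3[, moves the support of F
   off itself by turning it about (- 3r/2, 0).  Then the closed orbits of c F + d K are
   constant and their actions are values of K, so that by (AS5) and (AS1)
   sigma(c F) <= sigma(c F + d K) <= max K.

   The area of a capping disc, which may have a corner at 1, is computed by Green's formula
   on the discs of radius rho < 1 and a passage to the limit. *)
From HB Require Import structures.
Require Import Defs.
From mathcomp Require Import all_boot all_order all_algebra.
From mathcomp Require Import all_classical all_reals all_analysis.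
From mathcomp Require Import measurable_realfun.
From mathcomp Require Import ring lra.

Set Implicit Arguments.
Unset Strict Implicit.
Unset Printing Implicit Defensive.

Import Order.TTheory GRing.Theory Num.Theory.
Import numFieldNormedType.Exports.

Local Open Scope classical_set_scope.
Local Open Scope ring_scope.

(** Displacing a disc of radius r costs at least pi r^2, and an explicit rotation costs more, so the
    displacement only has to land inside a gap of the spectrum and the gap does the rest. The upper
    end of the gap comes from the orbits that wind at least twice in the first plane: when the slope
    of F is confined to |z_0|^2 >= 95/100 r^2, their action is at least 2 pi * 95/100 r^2 = 19/10 pi
    r^2. This leaves room for a crude rotation of cost 13/2 r^2 * 28/100 pi = 182/100 pi r^2. Here
    13/2 r^2 exceeds, with a margin, the squared distance 25/4 r^2 from (- 3r/2, 0) to the far side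
    of the disc, and a slope of 28/100 pi in the squared distance turns by 56/100 pi, a little more
    than pi/2. Squeezing c F into a short time interval makes room for K: the two flows act one
    after the other, and each is an explicit rotation. All Hamiltonians are built from functions of
    squared distances, because their angular speeds are then constant along trajectories and flows,
    closed orbits, areas and actions have closed formulas. *)

Lemma for_pair (T U V : topologicalType) (f : T -> U) (g : T -> V) (x : T) :
  {for x, continuous f} -> {for x, continuous g} ->
  {for x, continuous (fun y => (f y, g y))}.
Proof. by move=> cf cg; exact: (cvg_pair cf cg). Qed.

(** * Functions that are smooth on the whole space *)

Section smooth_scalar.
Context {R : realType} {V : normedModType R}.
Implicit Types (f g : V -> R^o).

(** Induction on the order replaces the lists of directions in [smooth_open]: the Leibniz rule then
    closes on itself, whereas an iterated derivative of a product expands into a sum over all ways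
    to split the list. *)
Fixpoint Ck (k : nat) f : Prop :=
  continuous f /\
  if k is k'.+1 then forall v, (forall x, derivable f x v) /\ Ck k' ('D_v f)
  else True.

Definition smoothT f := forall k, Ck k f.

Lemma smoothT_continuous f : smoothT f -> continuous f.
Proof. by move=> /(_ 0%N) []. Qed.

Lemma smoothT_derivable f x v : smoothT f -> derivable f x v.
Proof. by move=> /(_ 1%N) [_ /(_ v) []]. Qed.

Lemma smoothT_derive f v : smoothT f -> smoothT ('D_v f).
Proof. by move=> sf k; have [_ /(_ v) []] := sf k.+1. Qed.

Lemma smoothT_open f : smoothT f -> smooth_open setT f.
Proof.
move=> sf s x _; have : smoothT (iter_derive s f).
  by elim: s => //= v s IH; apply: smoothT_derive.
by move=> h; split; [exact: smoothT_continuous|move=> v; exact: smoothT_derivable].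
Qed.

Lemma CkS k f : Ck k.+1 f -> Ck k f.
Proof.
elim: k f => [|k IH] f [cf df]; split => // v.
by have [d1 d2] := df v; split => //; apply: IH.
Qed.

Lemma CkD k f g : Ck k f -> Ck k g -> Ck k (f + g).
Proof.
elim: k f g => [|k IH] f g [cf df] [cg dg].
  by split=> // x; apply: cvgD; [exact: cf|exact: cg].
split=> [x|v]; first by apply: cvgD; [exact: cf|exact: cg].
have [f1 f2] := df v; have [g1 g2] := dg v.
split=> [x|]; first exact: derivableD.
rewrite [X in Ck k X](_ : _ = 'D_v f + 'D_v g); first exact: IH.
by apply/funext => x; rewrite deriveD.
Qed.

Lemma CkM k f g : Ck k f -> Ck k g -> Ck k (fun x => f x * g x).
Proof.
elim: k f g => [|k IH] f g Hf Hg; have [cf df] := Hf; have [cg dg] := Hg.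
  by split=> // x; apply: (@cvgM R V (nbhs x) _ f g); [exact: cf|exact: cg].
split=> [x|v].
  by apply: (@cvgM R V (nbhs x) _ f g); [exact: cf|exact: cg].
have [f1 f2] := df v; have [g1 g2] := dg v.
split=> [x|]; first exact: (@derivableM _ _ f g).
rewrite [X in Ck k X](_ : _ = (fun x => f x * 'D_v g x)
   + (fun x => g x * 'D_v f x)).
  by apply: CkD; apply: IH => //; apply: CkS.
by apply/funext => x; rewrite (@deriveM _ _ f g).
Qed.

Lemma Ck_cst k (a : R) : Ck k (fun=> a).
Proof.
elim: k a => [|k IH] a; split=> //; try by move=> x; exact: cvg_cst.
move=> v; split=> [x|]; first exact: derivable_cst.
rewrite [X in Ck k X](_ : _ = fun=> 0) //.
by apply/funext => x; rewrite derive_cst.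
Qed.

Lemma smoothD f g : smoothT f -> smoothT g -> smoothT (fun x => f x + g x).
Proof. by move=> sf sg k; exact: (CkD (sf k) (sg k)). Qed.

Lemma smoothM f g : smoothT f -> smoothT g -> smoothT (fun x => f x * g x).
Proof. by move=> sf sg k; exact: CkM. Qed.

Lemma smooth_cst (a : R) : smoothT (fun=> a).
Proof. by move=> k; exact: Ck_cst. Qed.

Lemma smoothN f : smoothT f -> smoothT (fun x => - f x).
Proof.
move=> sf; rewrite (_ : (fun x => - f x) = (fun x => -1 * f x)).
  by apply: smoothM => //; exact: smooth_cst.
by apply/funext => x; rewrite mulN1r.
Qed.

Lemma smoothB f g : smoothT f -> smoothT g -> smoothT (fun x => f x - g x).
Proof. by move=> sf sg; apply: smoothD => //; exact: smoothN. Qed.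

Lemma smooth_sum (I : Type) (r : seq I) (P : pred I) (F : I -> V -> R^o) :
  (forall i, smoothT (F i)) -> smoothT (fun x => \sum_(i <- r | P i) F i x).
Proof.
move=> sF; elim: r => [|i r IH].
  rewrite (_ : (fun _ => _) = fun=> 0); first exact: smooth_cst.
  by apply/funext => x; rewrite big_nil.
rewrite (_ : (fun _ => _) = fun x => (if P i then F i x else 0)
   + \sum_(i <- r | P i) F i x).
  by apply: smoothD => //; case: (P i) => //; exact: smooth_cst.
by apply/funext => x; rewrite big_cons; case: (P i) => //; rewrite add0r.
Qed.

Lemma smooth_exp f m : smoothT f -> smoothT (fun x => f x ^+ m).
Proof.
move=> sf; elim: m => [|m IH]; first exact: smooth_cst.
rewrite (_ : (fun _ => _) = fun x => f x * f x ^+ m); first exact: smoothM.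
by apply/funext => x; rewrite exprS.
Qed.

Lemma is_derive_linear (W : normedModType R) (l : {linear V -> W}) x v :
  is_derive x v l (l v).
Proof.
have E : forall h : R, h != 0 -> h^-1 *: ((l \o shift x) (h *: v) - l x) = l v.
  by move=> h h0; rewrite /= (linearP l h v x) addrK scalerA mulVf // scale1r.
have H : h^-1 *: ((l \o shift x) (h *: v) - l x) @[h --> 0^'] --> l v.
  apply: cvg_near_cst; near=> h; apply: E.
  by near: h; exact: nbhs_dnbhs_neq.
by apply: DeriveDef; [exact: cvgP H|exact: (cvg_lim (@norm_hausdorff _ _) H)].
Unshelve. all: by end_near.
Qed.

Lemma smooth_linear (l : {linear V -> R^o}) : continuous l -> smoothT l.
Proof.
move=> cl [|k]; split=> // v; have H x := is_derive_linear l x v.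
split=> [x|]; first exact: ex_derive.
rewrite [X in Ck k X](_ : _ = fun=> l v); first exact: Ck_cst.
by apply/funext => x; rewrite derive_val.
Qed.

End smooth_scalar.

(** * Composition with functions of one variable *)

Section chain_rule.
Context {R : realType} {V : normedModType R}.

Lemma derivable_line (W : normedModType R) (f : V -> W) x v df :
  is_derive x v f df <-> is_derive (0 : R) 1 (fun h : R => f (h *: v + x)) df.
Proof.
have E : (fun h : R => h^-1 *: ((f \o shift x) (h *: v) - f x)) =
  (fun h : R => h^-1 *: (((fun h : R => f (h *: v + x)) \o shift 0) (h *: 1)
     - f (0 *: v + x))).
  by apply/funext => h /=; rewrite scale0r add0r addr0 [h *: 1]mulr1.
by split=> -[H1 H2]; apply: DeriveDef; rewrite /derivable /derive ?E // -?E.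
Qed.

Lemma is_derive_comp1 (phi : R -> R) (dphi : R) (f : V -> R^o) x v df :
  is_derive x v f df -> is_derive (f x) 1 phi dphi ->
  is_derive x v ((fun y => phi (f y)) : V -> R^o) (dphi * df).
Proof.
move=> /derivable_line fH gH; apply/derivable_line.
have gH' : is_derive (f (0 *: v + x)) 1 phi dphi by rewrite scale0r add0r.
have := @is_derive1_comp R phi (fun h : R => f (h *: v + x)) 0 _ _ gH' fH.
by rewrite mulrC.
Qed.

(** The derivatives are carried as an explicit sequence: for the flat function below such a sequence
    is known in closed form, and the induction for composites moves along it. *)
Definition smooth1 (phi : R -> R) := exists2 d : nat -> R -> R,
  d 0%N =1 phi & forall n (x : R), is_derive x (1 : R) (d n) (d n.+1 x).

Lemma smooth_comp (phi : R -> R) (f : V -> R^o) :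
  smooth1 phi -> smoothT f -> smoothT (fun x => phi (f x)).
Proof.
move=> [d d0 dS] sf k.
rewrite (_ : (fun x => phi (f x)) = (fun x => d 0%N (f x))); last first.
  by apply/funext => x; rewrite d0.
(* The claim is proved for all [d m] at once, since the derivative of [d m (f x)] contains
   [d m.+1 (f x)]. *)
elim: k 0%N => [|k IH] m.
  split=> // x; apply: (@continuous_comp _ _ _ f (d m)).
    exact: smoothT_continuous.
  by apply/differentiable_continuous/derivable1_diffP; have [] := dS m (f x).
have H x v : is_derive x v (fun y : V => d m (f y) : R^o) (d m.+1 (f x) * 'D_v f x).
  by apply: is_derive_comp1 => //; apply/derivableP/smoothT_derivable.
split=> [|v]; first by case: k IH => [|k] IH; have [] := IH m.
split=> [x|]; first by have [] := H x v.
rewrite [X in Ck k X](_ : _ = (fun x => d m.+1 (f x) * 'D_v f x)).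
  by apply: CkM => //; exact: smoothT_derive.
by apply/funext => x; have [] := H x v.
Qed.

End chain_rule.

(** * The flat function exp(-1/x) *)

Section one_variable.
Context {R : realType}.
Implicit Types (f F : R -> R).

Lemma smooth1_smoothT f : smoothT (f : R^o -> R^o) -> smooth1 f.
Proof.
move=> sf; exists (fun n => iter n (fun g : R^o -> R^o => 'D_1 g) f) => // n x /=.
apply/derivableP/smoothT_derivable.
by elim: n => //= n IH; exact: smoothT_derive.
Qed.

Lemma smooth1_antiderivative F f :
  (forall x : R, is_derive x (1 : R) F (f x)) -> smooth1 f -> smooth1 F.
Proof.
move=> dF [d d0 dS]; exists (fun n => if n is m.+1 then d m else F) => //.
case=> [|n] x; last exact: dS.
by rewrite d0; exact: dF.
Qed.

Lemma smooth1_comp (phi psi : R -> R) :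
  smooth1 phi -> smoothT (psi : R^o -> R^o) -> smooth1 (phi \o psi).
Proof. by move=> sphi spsi; apply/smooth1_smoothT/smooth_comp. Qed.

Lemma smooth_id : smoothT (id : R^o -> R^o).
Proof.
exact: (@smooth_linear R R^o (idfun : {linear R^o -> R^o}) (fun x => cvg_id)).
Qed.

(** The family P(1/x) exp(-1/x), extended by 0, contains the flat function and is stable under
    differentiation, which sends P to X^2 (P - P'). Smoothness at 0 thus reduces to one difference
    quotient for a general P. *)
Definition polyexp (P : {poly R}) (x : R) : R :=
  if 0 < x then P.[x^-1] * expR (- x^-1) else 0.

(** With y = 1/x, each monomial satisfies y^n exp(-y) <= n!, by comparison with one term of the
    exponential series. *)
Lemma polyexp_bound (P : {poly R}) :
  exists2 C : R, 0 < C & forall x, `|polyexp P x| <= C.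
Proof.
have mono n (y : R) : 0 < y -> y ^+ n * expR (- y) <= n`!%:R.
  move=> y0; rewrite expRN ler_pdivrMr ?expR_gt0 //; case: n => [|n].
    by rewrite expr0 fact0 mul1r ltW // expR_gt1.
  rewrite mulrC -ler_pdivrMr ?ltr0n ?fact_gt0 //.
  by apply: le_trans (expR_ge1Dxn n (ltW y0)); rewrite lerDr.
exists (1 + \sum_(i < size P) `|P`_i| * i`!%:R).
  by apply: ltr_wpDr => //; apply: sumr_ge0 => i _; rewrite mulr_ge0.
move=> x; rewrite /polyexp; case: ifP => [x0|_]; last first.
  rewrite normr0 addr_ge0 //; apply: sumr_ge0 => i _; rewrite mulr_ge0 //.
rewrite horner_coef mulr_suml; apply: le_trans (ler_norm_sum _ _ _) _.
apply: ler_wpDl => //; apply: ler_sum => i _.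
rewrite -mulrA normrM ler_wpM2l // ger0_norm ?mono ?invr_gt0 //.
by rewrite mulr_ge0 ?expR_ge0 // exprn_ge0 // invr_ge0 ltW.
Qed.

Lemma is_derive_polyexp (P : {poly R}) (x : R) :
  is_derive x (1 : R) (polyexp P) (polyexp ('X^2 * (P - P^`())) x).
Proof.
have [x0|x0|<-] := ltgtP 0 x.
- pose g y : R := P.[y^-1] * expR (- y^-1).
  have gH : is_derive x (1 : R) g (polyexp ('X^2 * (P - P^`())) x).
    have iH : is_derive x (1 : R) (fun y : R => y^-1) (- x ^- 2).
      apply: DeriveDef; first by apply: derivableV; [rewrite gt_eqF|].
      by rewrite deriveV ?gt_eqF // derive_id /GRing.scale /= mulr1.
    have pH : is_derive x (1 : R) (fun y : R => P.[y^-1]) (P^`().[x^-1] * (- x ^- 2)).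
      by apply: is_derive_comp1.
    have nH : is_derive x (1 : R) (fun y : R => - y^-1) (x ^- 2).
      by rewrite -[x ^- 2]opprK; exact: is_deriveN.
    have eH : is_derive x (1 : R) (fun y : R => expR (- y^-1)) (expR (- x^-1) * (x ^- 2)).
      by apply: is_derive_comp1.
    have := @is_deriveM _ _ _ _ x 1 _ _ pH eH.
    rewrite /polyexp x0 hornerM hornerXn hornerD hornerN => H.
    apply: (is_derive_eq H); rewrite /GRing.scale /= exprVn.
    by ring.
  apply: near_eq_is_derive gH; near=> y.
  have y0 : 0 < y by near: y; exact: lt_nbhsr.
  by rewrite /polyexp y0.
- have -> : polyexp ('X^2 * (P - P^`())) x = 0 by rewrite /polyexp ltNge ltW.
  apply: (@near_eq_is_derive _ _ _ (cst 0)); near=> y.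
  have y0 : y < 0 by near: y; exact: lt_nbhsl.
  by rewrite /polyexp ltNge ltW.
- have -> : polyexp ('X^2 * (P - P^`())) 0 = 0 by rewrite /polyexp ltxx.
  (* The bound for X^2 P says that [polyexp P h] is at most C h^2, so the difference quotient at 0
     is at most C |h|. *)
  have [C C0 HC] := polyexp_bound ('X^2 * P).
  have B (h : R) : `|h^-1 *: (polyexp P (h *: 1 + 0) - polyexp P 0)| <= C * `|h|.
    rewrite addr0 [h *: 1]mulr1 {2}/polyexp ltxx subr0 normrZ normfV.
    have := HC h; rewrite /polyexp; case: ifP => [h0|_ _]; last first.
      by rewrite normr0 mulr0 mulr_ge0 // ltW.
    rewrite hornerM hornerXn -mulrA normrM (gtr0_norm h0) => H.
    have : h^-1 ^+ 2 * `|P.[h^-1] * expR (- h^-1)| <= C.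
      by rewrite ger0_norm in H => //; rewrite exprn_ge0 // invr_ge0 ltW.
    rewrite exprVn mulrC ler_pdivrMr ?exprn_gt0 // => H2.
    by rewrite mulrC ler_pdivrMr // -mulrA -expr2.
  have H : h^-1 *: (polyexp P (h *: 1 + 0) - polyexp P 0) @[h --> (0:R)^'] --> (0 : R).
    apply/cvgrPdist_le => e e0; near=> h; rewrite sub0r normrN.
    apply: le_trans (B h) _; rewrite mulrC -ler_pdivlMr //.
    near: h; apply: dnbhs0_le; exact: divr_gt0.
  by apply: DeriveDef; [exact: cvgP H|exact: (cvg_lim (@norm_hausdorff _ _) H)].
Unshelve. all: by end_near.
Qed.

Definition theta (x : R) : R := polyexp 1 x.

Lemma smooth1_theta : smooth1 theta.
Proof.
exists (fun n => polyexp (iter n (fun P => 'X^2 * (P - P^`())) 1)) => // n x.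
exact: is_derive_polyexp.
Qed.

Lemma thetaE x : theta x = if 0 < x then expR (- x^-1) else 0.
Proof. by rewrite /theta /polyexp hornerC mul1r. Qed.

Lemma theta_ge0 x : 0 <= theta x.
Proof. by rewrite thetaE; case: ifP => // _; exact: expR_ge0. Qed.

Lemma theta_le1 x : theta x <= 1.
Proof.
by rewrite thetaE; case: ifP => // x0; rewrite expR_le1 oppr_le0 invr_ge0 ltW.
Qed.

Lemma theta_gt0 x : (0 < theta x) = (0 < x).
Proof. by rewrite thetaE; case: ifP => // x0; rewrite ?expR_gt0 ?ltxx. Qed.

Lemma theta_homo x y : x <= y -> theta x <= theta y.
Proof.
move=> xy; rewrite [theta x]thetaE; case: ifP => [x0|_]; last exact: theta_ge0.
rewrite thetaE (lt_le_trans x0 xy) ler_expR lerN2 lef_pV2 ?posrE //.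
exact: lt_le_trans xy.
Qed.

End one_variable.

(** * Primitives and smooth steps *)

Section antiderivative.
Context {R : realType}.
Implicit Types (f F : R -> R).

Lemma derive_continuous f df : (forall x : R, is_derive x (1 : R) f (df x)) ->
  continuous f.
Proof.
by move=> H x; apply/differentiable_continuous/derivable1_diffP; have [] := H x.
Qed.

Lemma antiderivative_from f (a : R) : continuous f ->
  exists F, forall x : R, a < x -> is_derive x (1 : R) F (f x).
Proof.
move=> cf; exists (fun x => \int[lebesgue_measure]_(t in `[a, x]) f t) => x ax.
have [] := @continuous_FTC1_closed R f a x (x + 1) _ _ ax (cf x).
- by rewrite ltrDl.
- apply: continuous_compact_integrable; first exact: segment_compact.
  exact: continuous_subspaceT.
- by move=> H1 H2; apply: DeriveDef; [exact: H1|rewrite -derive1E; exact: H2].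
Qed.

Lemma antiderivative_supp f (a : R) : continuous f ->
  (forall x, x <= a -> f x = 0) ->
  exists F, (forall x : R, is_derive x (1 : R) F (f x)) /\
    (forall x, x <= a -> F x = 0).
Proof.
(* Starting one unit to the left of [a] leaves an overlap: the fundamental theorem applies beyond
   [a - 1], and F vanishes near every point up to [a - 1]. *)
move=> cf f0; pose F x := \int[lebesgue_measure]_(t in `[a - 1, x]) f t.
have F0 x : x <= a -> F x = 0.
  move=> xa; rewrite /F /Rintegral integral0_eq // => t /=.
  by rewrite in_itv /= => /andP[_ tx]; rewrite f0 // (le_trans tx).
exists F; split=> // x.
have [ax|xa] := ltP (a - 1) x.
  have [] := @continuous_FTC1_closed R f (a - 1) x (x + 1) _ _ ax (cf x).
  - by rewrite ltrDl.
  - apply: continuous_compact_integrable; first exact: segment_compact.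
    exact: continuous_subspaceT.
  - by move=> H1 H2; apply: DeriveDef; [exact: H1|rewrite -derive1E; exact: H2].
have xa' : x < a by lra.
rewrite f0 ?ltW //; apply: (@near_eq_is_derive _ _ _ (cst 0)).
near=> y; have ya : y < a by near: y; exact: lt_nbhsl.
by rewrite /= F0 // ltW.
Unshelve. all: by end_near.
Qed.

Lemma derive_le (F f : R -> R) (a b m : R) :
  (forall x : R, is_derive x (1 : R) F (f x)) -> a <= b ->
  (forall x, a <= x <= b -> m <= f x) -> m * (b - a) <= F b - F a.
Proof.
move=> dF ab mf.
have [|c cab ->] := @MVT_segment R F f a b ab (fun x _ => dF x).
  by apply: continuous_subspaceT; exact: derive_continuous dF.
by apply: ler_wpM2r; rewrite ?subr_ge0 // mf // -in_itv.
Qed.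

Lemma derive_ge (F f : R -> R) (a b m : R) :
  (forall x : R, is_derive x (1 : R) F (f x)) -> a <= b ->
  (forall x, a <= x <= b -> f x <= m) -> F b - F a <= m * (b - a).
Proof.
move=> dF ab mf.
have [|c cab ->] := @MVT_segment R F f a b ab (fun x _ => dF x).
  by apply: continuous_subspaceT; exact: derive_continuous dF.
by apply: ler_wpM2r; rewrite ?subr_ge0 // mf // -in_itv.
Qed.

(** [S] is a smoothed ramp of slope 1 on [a, b], with slope at least 1 - d except within d of the
    ends. The monotonicity of [chi] on the right half later becomes the convexity of the cut-offs
    there. *)
Record step_spec (a b d : R) (S chi : R -> R) : Prop := StepSpec {
  step_smooth : smooth1 S;
  step_chi_smooth : smooth1 chi;
  step_derive : forall x : R, is_derive x (1 : R) S (chi x);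
  step_left : forall x, x <= a -> S x = 0;
  step_right : forall x, b <= x -> S x = S b;
  step_chi_ge0 : forall x, 0 <= chi x;
  step_chi_le1 : forall x, chi x <= 1;
  step_chi_gt0 : forall x, (0 < chi x) = (a < x < b);
  step_chi_mid : forall x, a + d <= x <= b - d -> 1 - d <= chi x;
  step_chi_homo : forall x y, (a + b) / 2 <= x -> x <= y -> chi y <= chi x;
  step_total : (1 - d) * (b - a - 2 * d) <= S b;
  step_lt : forall x y, a < y -> x < b -> x < y -> S x < S y;
  step_homo : forall x y, x <= y -> S x <= S y }.

Lemma step_exists (a b d : R) : 0 < d < 1 -> 2 * d < b - a ->
  exists S chi, step_spec a b d S chi.
Proof.
move=> /andP[d0 d1] dab.
(* [q0] is the minimum of (s - a)(b - s) on [a + d, b - d]. Division by [e = d * q0] makes [q] at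
   least 1/d there, so that [theta (q s)] is at least exp(-d) >= 1 - d. *)
pose q0 := d * (b - a - d); have q0_gt0 : 0 < q0 by rewrite mulr_gt0 //; lra.
pose e := d * q0; have e0 : 0 < e by rewrite mulr_gt0.
pose q s := (s - a) * (b - s) / e; pose chi s : R := theta (q s).
have sq : smoothT (q : R^o -> R^o).
  apply: smoothM; last exact: smooth_cst.
  by apply: smoothM; apply: smoothB; (exact: smooth_id || exact: smooth_cst).
have schi : smooth1 chi by apply: (smooth1_comp smooth1_theta sq).
have cchi : continuous chi.
  have [dd dd0 ddS] := schi; rewrite (_ : chi = dd 0%N).
    by apply: derive_continuous => x; exact: ddS.
  by apply/funext => x; rewrite dd0.
have chi_gt0 x : (0 < chi x) = (a < x < b).
  rewrite theta_gt0 /q pmulr_lgt0 ?invr_gt0 //; apply/idP/andP => [H|[ax xb]].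
    by split; rewrite ltNge; apply/negP => ?; nra.
  by nra.
have chi_ge0 x : 0 <= chi x by exact: theta_ge0.
have chi0 x : x <= a -> chi x = 0.
  move=> xa; apply/eqP; rewrite eq_le chi_ge0 andbT leNgt chi_gt0.
  by rewrite ltNge xa.
have chi0' x : b <= x -> chi x = 0.
  move=> xa; apply/eqP; rewrite eq_le chi_ge0 andbT leNgt chi_gt0.
  by rewrite [x < b]ltNge xa andbF.
have [S [dS S0]] := antiderivative_supp cchi chi0.
have chi_mid x : a + d <= x <= b - d -> 1 - d <= chi x.
  move=> /andP[xa xb]; have qq : q0 <= (x - a) * (b - x) by rewrite /q0; nra.
  have qp : 0 < (x - a) * (b - x) by exact: lt_le_trans qq.
  have iq : (q x)^-1 <= d.
    rewrite /q invf_div ler_pdivrMr // /e ler_pM2l //.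
  rewrite /chi thetaE /q divr_gt0 //.
  by apply: le_trans (expR_ge1Dx _); rewrite lerD2l lerN2.
have homo x y : x <= y -> S x <= S y.
  move=> xy; rewrite -subr_ge0 -(mul0r (y - x)).
  by apply: derive_le dS xy _ => t _; exact: chi_ge0.
exists S, chi; split => //.
- exact: smooth1_antiderivative schi.
- move=> x bx; apply/eqP; rewrite -subr_eq0 eq_le -{1}(mul0r (x - b)).
  rewrite (derive_ge dS bx); last by move=> t /andP[bt _]; rewrite chi0'.
  by rewrite subr_ge0 homo.
- by move=> x; exact: theta_le1.
- move=> x y mx xy; apply: theta_homo; rewrite /q ler_pM2r ?invr_gt0 //.
  by nra.
- have H : (1 - d) * ((b - d) - (a + d)) <= S (b - d) - S (a + d).
    by apply: derive_le dS _ _ => //; lra.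
  have h1 : S (b - d) <= S b by apply: homo; lra.
  have h2 : 0 <= S (a + d) by rewrite -(S0 a) // homo //; lra.
  have E : b - d - (a + d) = b - a - 2 * d by ring.
  by rewrite E in H; lra.
- move=> x y ay xb xy.
  (* The part of [x, y] inside [a, b] has positive length, and [chi] is positive in its interior. *)
  pose l := Num.max a x; pose r := Num.min b y.
  have lr : l < r by rewrite /l /r gt_max !lt_min; apply/andP; split; apply/andP; split => //; lra.
  have S1 : S x <= S l by apply: homo; rewrite le_max lexx orbT.
  have S2 : S r <= S y by apply: homo; rewrite ge_min lexx orbT.
  suff : S l < S r by lra.
  have [|c cab E] := @MVT R S chi l r lr (fun x _ => dS x).
    by apply: continuous_subspaceT; exact: derive_continuous dS.
  rewrite -subr_gt0 E mulr_gt0 ?subr_gt0 // chi_gt0.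
  move: cab; rewrite in_itv /= gt_max lt_min => /andP[/andP[-> _] /andP[-> _]] //.
Qed.

End antiderivative.

(** * Open sets and continuous functions of the plane are measurable *)

Section plane_measurability.
Context {R : realType}.
Local Notation plane := (measurableTypeR R * measurableTypeR R)%type.

Lemma open_plane_measurable (U : set (R * R)) : open U ->
  measurable (U : set plane).
Proof.
move=> oU.
(* An open set is the union of the rational boxes that it contains. Indices that code no such box
   contribute the empty set. *)
pose box (k : rat * rat * (rat * rat)) : set (R * R) :=
  `]ratr k.1.1, ratr k.1.2[%classic `*` `]ratr k.2.1, ratr k.2.2[%classic.
pose B n : set (R * R) := if unpickle n is Some k then
  if `[< box k `<=` U >] then box k else set0 else set0.
have -> : U = \bigcup_n B n.
  apply/seteqP; split=> [[x y] Uxy|z [n _]]; last first.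
    by rewrite /B; case: unpickle => // k; case: ifP => // /asboolP; apply.
  have /nbhs_ballP [e /= e0 He] := open_nbhs_nbhs (conj oU Uxy).
  have [a] : exists q : rat, ratr q \in `]x - e, x[ by apply: rat_in_itvoo; lra.
  have [b] : exists q : rat, ratr q \in `]x, x + e[ by apply: rat_in_itvoo; lra.
  have [c] : exists q : rat, ratr q \in `]y - e, y[ by apply: rat_in_itvoo; lra.
  have [d] : exists q : rat, ratr q \in `]y, y + e[ by apply: rat_in_itvoo; lra.
  rewrite !in_itv /= => /andP[d1 d2] /andP[c1 c2] /andP[b1 b2] /andP[a1 a2].
  exists (pickle (a, b, (c, d))); [exact: I|rewrite /B pickleK].
  case: asboolP => [_|[]]; first by split; rewrite /= in_itv /=; apply/andP.
  move=> [s t] [/=]; rewrite !in_itv /= => /andP[s1 s2] /andP[t1 t2].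
  by apply: He; split; rewrite /ball /= ltr_distlC; apply/andP; split; lra.
apply: bigcupT_measurable => n; rewrite /B; case: unpickle => [k|] //.
by case: ifP => // _; apply: measurableX; exact: measurable_itv.
Qed.

Lemma continuous_plane_measurable (U : set (R * R)) (f : R * R -> R) :
  open U -> (forall z, U z -> {for z, continuous f}) ->
  measurable_fun (U : set plane) f.
Proof.
move=> oU cf; apply: (measurability _ (measurable_realfun.RGenOpens.measurableE R)).
move=> _ [_ [a [b ->] <-]]; have oA := interval_open.
apply: open_plane_measurable; rewrite openE => z [Uz Az].
rewrite /interior; near=> w.
split; first by near: w; exact: open_nbhs_nbhs.
by near: w; apply: (cf z Uz); exact: open_nbhs_nbhs.
Unshelve. all: by end_near.
Qed.

End plane_measurability.

(** * Integration over the unit disc *)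

Section disc_integrals.
Context {R : realType}.
Local Notation plane := (measurableTypeR R * measurableTypeR R)%type.
Local Notation mu := (@lebesgue_measure R).
Local Notation mu2 := (mu \x mu)%E.

Definition odisc : set (R * R) := [set z | z.1 ^+ 2 + z.2 ^+ 2 < 1].

Lemma sqnorm_continuous : continuous (fun z : R * R => z.1 ^+ 2 + z.2 ^+ 2 : R).
Proof.
move=> z; apply: (@cvgD R R^o); rewrite [X in _ --> X]expr2;
  under eq_fun do rewrite expr2; apply: cvgM;
  (exact: cvg_fst || exact: cvg_snd).
Qed.

Lemma open_odisc : open odisc.
Proof.
apply: (@open_comp _ _ (fun z : R * R => z.1 ^+ 2 + z.2 ^+ 2 : R) [set x | x < 1]).
  by move=> z _; exact: sqnorm_continuous.
exact: open_lt.
Qed.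

Lemma odisc_sub : odisc `<=` disc.
Proof. by move=> z /ltW. Qed.

Lemma odisc_bound (x y : R) : x ^+ 2 + y ^+ 2 <= 1 -> `|x| <= 1 /\ `|y| <= 1.
Proof. by move=> H; split; rewrite ler_norml; apply/andP; split; nra. Qed.

Lemma compact_disc : compact (@disc R).
Proof.
have K : compact (`[-1, 1]%classic `*` `[-1, 1]%classic : set (R * R)).
  by apply: compact_setX; exact: segment_compact.
apply: (subclosed_compact _ K).
  apply: (@closed_comp _ _ (fun z : R * R => z.1 ^+ 2 + z.2 ^+ 2 : R) [set x | x <= 1]).
    by move=> z _; exact: sqnorm_continuous.
  exact: closed_le.
move=> [x y] /odisc_bound /= [hx hy].
by split; rewrite /= in_itv /= -ler_norml.
Qed.

Lemma odisc_measurable : measurable (odisc : set plane).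
Proof. by apply: open_plane_measurable; exact: open_odisc. Qed.

Lemma odisc_finite : (mu2 (odisc : set plane) < +oo)%E.
Proof.
have h : odisc `<=` `[-1, 1]%classic `*` `[-1, 1]%classic.
  move=> [x y] /odisc_sub /odisc_bound /= [hx hy].
  by split; rewrite /= in_itv /= -ler_norml.
apply: (@le_lt_trans _ _ (mu2 (`[-1, 1]%classic `*` `[-1, 1]%classic : set plane))).
  apply: le_measure; [rewrite inE; exact: odisc_measurable| |exact: h].
  by rewrite inE; exact: (measurableX (measurable_itv _) (measurable_itv _)).
rewrite product_measure1E; [|exact: measurable_itv|exact: measurable_itv].
have E : mu `[-1, 1]%classic = 2%:E.
  rewrite lebesgue_measure_itv /= lte_fin ifT; last by lra.
  by rewrite -EFinD; congr (_%:E); lra.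
by rewrite [X in (X * X)%E]E -EFinM ltry.
Qed.

Lemma continuous_disc_bounded (f : R * R -> R^o) :
  (forall z, disc z -> {for z, continuous f}) ->
  exists2 B : R, 0 < B & forall z, disc z -> `|f z| <= B.
Proof.
move=> cf; have cK : compact (f @` disc).
  apply: continuous_compact; last exact: compact_disc.
  by apply: continuous_in_subspaceT => z; rewrite inE; exact: cf.
have [M [_ HM]] := compact_bounded cK.
exists (`|M| + 1); first by rewrite ltr_wpDl.
move=> z dz; apply: (HM (`|M| + 1)); last by exists z.
by rewrite (le_lt_trans (ler_norm M)) // ltrDl.
Qed.

Lemma continuous_odisc_integrable (f : R * R -> R) (B : R) :
  (forall z, odisc z -> {for z, continuous f}) ->
  (forall z, odisc z -> `|f z| <= B) ->
  mu2.-integrable (odisc : set plane) (EFin \o f).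
Proof.
move=> cf fB; apply: measurable_bounded_integrable.
- exact: odisc_measurable.
- exact: odisc_finite.
- exact: continuous_plane_measurable open_odisc cf.
- exists B; split; first exact: num_real.
  by move=> b Bb z oz; apply: le_trans (fB z oz) _; exact: ltW.
Qed.

(** The fundamental theorem on the chord at height y. For |y| >= 1 the chord is empty and the square
    root takes its default value 0, so that both sides vanish. *)
Lemma slice_integral (q dq : R -> R) (y : R) :
  (forall x, x ^+ 2 + y ^+ 2 <= 1 -> is_derive x (1 : R) q (dq x) /\ {for x, continuous dq}) ->
  (\int[mu]_x (if (x ^+ 2 + y ^+ 2 < 1)%R then (dq x)%:E else 0) =
  (q (Num.sqrt (1 - y ^+ 2)) - q (- Num.sqrt (1 - y ^+ 2)))%:E)%E.
Proof.
move=> H; set w : R := Num.sqrt _; have w0 : 0 <= w by exact: sqrtr_ge0.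
have [y1|y1] := ltP (y ^+ 2) 1; last first.
  rewrite /w ler0_sqrtr ?subr_le0 // oppr0 subrr integral0_eq // => x _.
  by rewrite ltNge (le_trans y1) // lerDr sqr_ge0.
have w2 : w ^+ 2 = 1 - y ^+ 2 by rewrite sqr_sqrtr // subr_ge0 ltW.
have wp : 0 < w by rewrite sqrtr_gt0 subr_gt0.
have inw x : (x ^+ 2 + y ^+ 2 < 1) = (x \in `]-w, w[).
  rewrite in_itv /= -ltrBrDr -w2 -ltr_norml -real_normK ?num_real //.
  by rewrite ltr_pXn2r // nnegrE // normr_ge0.
have inwc x : x \in `[-w, w] -> x ^+ 2 + y ^+ 2 <= 1.
  rewrite in_itv /= -lerBrDr -w2 -ler_norml -[x ^+ 2]real_normK ?num_real //.
  by rewrite ler_pXn2r // nnegrE // normr_ge0.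
have cdq : {within `[-w, w], continuous dq}.
  by apply: continuous_in_subspaceT => x /set_mem /inwc /H [].
transitivity (\int[mu]_(x in `](- w)%R, w[%classic) (dq x)%:E)%E.
  rewrite [RHS]integral_mkcond; apply: eq_integral => x _.
  by rewrite patchE inw mem_setE.
have cq x : x \in `[-w, w] -> q @ x --> q x.
  move=> /inwc /H [dx _].
  by apply: differentiable_continuous; apply/derivable1_diffP; have [] := dx.
rewrite -(@integral_itv_bndoo R (- w) w _ true false); last first.
  apply/measurable_EFinP; apply: (@measurable_funS _ _ _ _ `[-w, w]%classic) => //.
    by move=> x; apply: subset_itv_oo_cc.
  by apply: subspace_continuous_measurable_fun => //; exact: measurable_itv.
rewrite (@continuous_FTC2 R dq q (-w) w) ?gtrN //.
- split.
  + move=> x /subset_itv_oo_cc /inwc /H [dx _]; by have [] := dx.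
  + by apply: cvg_at_right_filter; apply: cq; rewrite in_itv /= lexx /= ge0_cp.
  + by apply: cvg_at_left_filter; apply: cq; rewrite in_itv /= lexx andbT ge0_cp.
- move=> x /subset_itv_oo_cc /inwc /H [dx _]; rewrite derive1E.
  by have [_] := dx.
Qed.

Lemma is_derive_coord1 (Q : R * R -> R) x y d :
  is_derive ((x, y) : R * R) ((1, 0) : R * R) (Q : R * R -> R^o) d ->
  is_derive x (1 : R) (fun t => Q (t, y)) d.
Proof.
have E : (fun h : R => h^-1 *: ((Q \o shift (x, y)) (h *: ((1, 0) : R * R)) - Q (x, y))) =
  (fun h : R => h^-1 *: (((fun t => Q (t, y)) \o shift x) (h *: 1) - Q (x, y))).
  apply/funext => h /=; congr (_ *: (Q _ - _)).
  by apply: injective_projections => //=; rewrite [h *: 0]mulr0 add0r.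
by move=> [H1 H2]; apply: DeriveDef; rewrite /derivable /derive -?E // -E.
Qed.

Lemma is_derive_coord2 (Q : R * R -> R) x y d :
  is_derive ((x, y) : R * R) ((0, 1) : R * R) (Q : R * R -> R^o) d ->
  is_derive y (1 : R) (fun t => Q (x, t)) d.
Proof.
have E : (fun h : R => h^-1 *: ((Q \o shift (x, y)) (h *: ((0, 1) : R * R)) - Q (x, y))) =
  (fun h : R => h^-1 *: (((fun t => Q (x, t)) \o shift y) (h *: 1) - Q (x, y))).
  apply/funext => h /=; congr (_ *: (Q _ - _)).
  by apply: injective_projections => //=; rewrite [h *: 0]mulr0 add0r.
by move=> [H1 H2]; apply: DeriveDef; rewrite /derivable /derive -?E // -E.
Qed.

End disc_integrals.

(** * Integrals of partial derivatives over the disc *)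

Section green_dx.
Context {R : realType}.
Local Notation plane := (measurableTypeR R * measurableTypeR R)%type.
Local Notation mu := (@lebesgue_measure R).
Local Notation mu2 := (mu \x mu)%E.
Local Notation c2 := (pi / 2 : R).

(** The chord at height y = sin t has the endpoints (cos t, sin t) and (- cos t, sin t), and dy =
    cos t dt. *)
Definition half_circle (Q : R * R -> R) (t : R) : R :=
  (Q (cos t, sin t) - Q (- cos t, sin t)) * cos t.

Lemma disc_circle (t : R) : disc (cos t, sin t).
Proof. by rewrite /disc /= cos2Dsin2. Qed.

Lemma continuous_circle (Q : R * R -> R) : (forall z, disc z -> {for z, continuous Q}) ->
  continuous (fun t => Q (cos t, sin t)).
Proof.
move=> cQ t; apply: (@continuous_comp _ _ _ (fun t : R => (cos t, sin t)) Q).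
  by apply: for_pair; [exact: continuous_cos|exact: continuous_sin].
exact/cQ/disc_circle.
Qed.

(** The substitution y = sin t replaces the square root, which is not differentiable at y = 1 and y
    = -1, by cos t, which is nonnegative on [- pi/2, pi/2]. *)
Lemma half_circle_substitution (Q : R * R -> R) :
  (forall z, disc z -> {for z, continuous Q}) ->
  (\int[mu]_(y in `[(-1)%R, 1%R]) (Q (Num.sqrt (1 - y ^+ 2), y) -
     Q (- Num.sqrt (1 - y ^+ 2), y))%:E =
   \int[mu]_(t in `[(- c2)%R, c2]) (half_circle Q t)%:E)%E.
Proof.
move=> cQ; pose G y := Q (Num.sqrt (1 - y ^+ 2), y) - Q (- Num.sqrt (1 - y ^+ 2), y).
have c2p : 0 < c2 by rewrite divr_gt0 // pi_gt0.
have d1 (y : R) : y \in `[-1, 1] -> disc (Num.sqrt (1 - y ^+ 2), y).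
  rewrite in_itv /= => /andP[y1 y2]; rewrite /disc /= sqr_sqrtr; first by rewrite subrK.
  by nra.
have d2 (y : R) : y \in `[-1, 1] -> disc (- Num.sqrt (1 - y ^+ 2), y).
  by move=> /d1; rewrite /disc /= sqrrN.
have cs : continuous (fun y : R => Num.sqrt (1 - y ^+ 2)).
  move=> y; apply: (@continuous_comp _ _ _ (fun y : R => 1 - y ^+ 2) (@Num.sqrt R)).
    apply: cvgB; [exact: cvg_cst|exact: exprn_continuous].
  exact: sqrt_continuous.
have cG : {within `[-1, 1], continuous G}.
  apply: continuous_in_subspaceT => y /set_mem /= yI.
  apply: cvgB.
    apply: (@continuous_comp _ _ _ (fun y : R => (Num.sqrt (1 - y ^+ 2), y)) Q).
      by apply: for_pair; [exact: cs|exact: cvg_id].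
    exact/cQ/d1.
  apply: (@continuous_comp _ _ _ (fun y : R => (- Num.sqrt (1 - y ^+ 2), y)) Q).
    by apply: for_pair; [apply: cvgN; exact: cs|exact: cvg_id].
  exact/cQ/d2.
have dsin : derive1 (@sin R) = cos by apply/funext => x; rewrite derive1E derive_val.
have := @integration_by_substitution_increasing R sin G (- c2) c2.
rewrite sinN sin_pihalf dsin => -> //.
- apply: eq_integral => t /set_mem /=; rewrite in_itv /= => tI.
  congr (_%:E); transitivity (G (sin t) * cos t) => //.
  by rewrite /G /half_circle -cos2sin2 sqrtr_sqr ger0_norm // cos_ge0_pihalf.
- by lra.
- by move=> x y xI yI xy; rewrite ltr_sin.
- by move=> x _; exact: continuous_cos.
- apply/cvg_ex; exists (cos (- c2)); apply: cvg_at_right_filter; exact: continuous_cos.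
- apply/cvg_ex; exists (cos c2); apply: cvg_at_left_filter; exact: continuous_cos.
- split; first by move=> x _; exact: derivable_sin.
  + by apply: cvg_at_right_filter; exact: continuous_sin.
  + by apply: cvg_at_left_filter; exact: continuous_sin.
Qed.

Lemma disc_integral_dx (Q dQ : R * R -> R) :
  (forall z, disc z -> {for z, continuous Q}) ->
  (forall z, disc z -> {for z, continuous dQ}) ->
  (forall z, disc z -> is_derive z ((1, 0) : R * R) (Q : R * R -> R^o) (dQ z)) ->
  (\int[mu2]_(z in (odisc : set plane)) (dQ z)%:E =
   \int[mu]_(t in `[(- c2)%R, c2]) (half_circle Q t)%:E)%E.
Proof.
move=> cQ cdQ DQ.
have [B B0 HB] := continuous_disc_bounded cdQ.
have iD : mu2.-integrable (odisc : set plane) (EFin \o dQ).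
  apply: (@continuous_odisc_integrable _ _ B).
    by move=> z /odisc_sub; exact: cdQ.
  by move=> z /odisc_sub; exact: HB.
have iD' := (integrable_mkcond _ odisc_measurable).1 iD.
rewrite integral_mkcond -(integral21_prod_meas1 iD') /fubini_G.
rewrite -half_circle_substitution // [RHS]integral_mkcond.
apply: eq_integral => y _.
transitivity (\int[mu]_x (if (x ^+ 2 + y ^+ 2 < 1)%R then (dQ (x, y))%:E else 0))%E.
  apply: eq_integral => x _; rewrite patchE.
  case: ifPn => [/set_mem|/negP]; first by rewrite /odisc /= => ->.
  by rewrite inE /odisc /= => /negP/negbTE ->.
rewrite (@slice_integral R (fun x => Q (x, y)) (fun x => dQ (x, y))); last first.
  move=> x dxy; split; first by apply: is_derive_coord1; exact: DQ.
  apply: (@continuous_comp _ _ _ (fun x : R => (x, y)) dQ); last exact: cdQ.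
  by apply: for_pair; [exact: cvg_id|exact: cvg_cst].
rewrite patchE; case: ifPn => // /negP; rewrite inE /= in_itv /= => h.
rewrite ler0_sqrtr ?oppr0 ?subrr // subr_le0 leNgt; apply/negP => y1; apply: h.
by apply/andP; split; nra.
Qed.

(** The same computation with the order of integration and the two coordinates exchanged, whence the
    swapped arguments of Q in [half_circle]. *)
Lemma disc_integral_dy (Q dQ : R * R -> R) :
  (forall z, disc z -> {for z, continuous Q}) ->
  (forall z, disc z -> {for z, continuous dQ}) ->
  (forall z, disc z -> is_derive z ((0, 1) : R * R) (Q : R * R -> R^o) (dQ z)) ->
  (\int[mu2]_(z in (odisc : set plane)) (dQ z)%:E =
   \int[mu]_(t in `[(- c2)%R, c2]) (half_circle (fun z => Q (z.2, z.1)) t)%:E)%E.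
Proof.
move=> cQ cdQ DQ.
have [B B0 HB] := continuous_disc_bounded cdQ.
have iD : mu2.-integrable (odisc : set plane) (EFin \o dQ).
  apply: (@continuous_odisc_integrable _ _ B).
    by move=> z /odisc_sub; exact: cdQ.
  by move=> z /odisc_sub; exact: HB.
have iD' := (integrable_mkcond _ odisc_measurable).1 iD.
rewrite integral_mkcond -(integral12_prod_meas1 iD') /fubini_F.
have cQ' z : disc z -> {for z, continuous (fun z : R * R => Q (z.2, z.1))}.
  move=> dz; apply: (@continuous_comp _ _ _ (fun z : R * R => (z.2, z.1)) Q).
    by apply: for_pair; [exact: cvg_snd|exact: cvg_fst].
  by apply: cQ; rewrite /disc /= addrC.
rewrite -half_circle_substitution // [RHS]integral_mkcond.
apply: eq_integral => y _.
transitivity (\int[mu]_x (if (x ^+ 2 + y ^+ 2 < 1)%R then (dQ (y, x))%:E else 0))%E.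
  apply: eq_integral => x _; rewrite patchE addrC.
  case: ifPn => [/set_mem|/negP]; first by rewrite /odisc /= => ->.
  by rewrite inE /odisc /= => /negP/negbTE ->.
rewrite (@slice_integral R (fun x => Q (y, x)) (fun x => dQ (y, x))); last first.
  move=> x; rewrite addrC => dxy; split; first by apply: is_derive_coord2; exact: DQ.
  apply: (@continuous_comp _ _ _ (fun x : R => (y, x)) dQ); last exact: cdQ.
  by apply: for_pair; [exact: cvg_cst|exact: cvg_id].
rewrite patchE; case: ifPn => // /negP; rewrite inE /= in_itv /= => h.
rewrite ler0_sqrtr ?oppr0 ?subrr // subr_le0 leNgt; apply/negP => y1; apply: h.
by apply/andP; split; nra.
Qed.

End green_dx.

(** * Mean values, the chain rule and mixed partial derivatives in the plane *)

Section plane_calculus.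
Context {R : realType}.
Local Notation e1 := ((1, 0) : R * R).
Local Notation e2 := ((0, 1) : R * R).

Lemma MVT_unordered (f df : R -> R) (a b : R) :
  (forall s, `|s - a| <= `|b - a| -> is_derive s (1 : R) f (df s)) ->
  exists2 c, `|c - a| <= `|b - a| & f b - f a = df c * (b - a).
Proof.
move=> H; have cont s : `|s - a| <= `|b - a| -> {for s, continuous f}.
  by move=> /H [d _]; apply/differentiable_continuous/derivable1_diffP.
have [ab|/ltW ba] := leP a b.
  have [x| |c] := @MVT_segment R f df a b ab.
  - rewrite in_itv /= => /andP[x1 x2]; apply: H.
    by rewrite !ger0_norm ?subr_ge0 // ?lerB // ltW.
  - apply: continuous_in_subspaceT => x /set_mem /=; rewrite in_itv /= => /andP[x1 x2].
    by apply: cont; rewrite !ger0_norm ?subr_ge0 // ?lerB.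
  - rewrite in_itv /= => /andP[c1 c2] E; exists c => //.
    by rewrite !ger0_norm ?subr_ge0 // ?lerB.
have [x| |c] := @MVT_segment R f df b a ba.
- rewrite in_itv /= => /andP[x1 x2]; apply: H.
  by rewrite !ler0_norm ?subr_le0 // ?lerN2 ?lerB // ltW.
- apply: continuous_in_subspaceT => x /set_mem /=; rewrite in_itv /= => /andP[x1 x2].
  by apply: cont; rewrite !ler0_norm ?subr_le0 // ?lerN2 ?lerB.
- rewrite in_itv /= => /andP[c1 c2] E; exists c => //.
    by rewrite !ler0_norm ?subr_le0 // ?lerN2 ?lerB.
  by rewrite -opprB E -mulrN opprB.
Qed.

Lemma derive_lipschitz (V : normedModType R) (f : V -> R^o) x v d L :
  is_derive x v f d ->
  (\forall h \near (0 : R), `|f (h *: v + x) - f x| <= L * `|h|) -> `|d| <= L.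
Proof.
move=> [df <-] H.
have C : `|h^-1 *: (f (h *: v + x) - f x)| @[h --> (0 : R)^'] --> `|'D_v f x|.
  by apply: cvg_norm; exact: df.
rewrite -(cvg_lim (@norm_hausdorff _ _) C); apply: limr_le.
  by apply/cvg_ex; eexists; exact: C.
near=> h; have h0 : h != 0 by near: h; exact: nbhs_dnbhs_neq.
rewrite normrZ normfV ler_pdivrMl ?normr_gt0 // mulrC.
by near: h; apply: nbhs_dnbhs.
Unshelve. all: by end_near.
Qed.

Lemma is_derive_scaled (V W : normedModType R) (f : V -> W) (rho : R) z v d :
  is_derive (rho *: z) v f d -> is_derive z v (fun y => f (rho *: y)) (rho *: d).
Proof.
have [->|r0] := eqVneq rho 0.
  move=> _; have -> : (fun y : V => f (0 *: y)) = cst (f 0).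
    by apply/funext => y; rewrite scale0r.
  by rewrite scale0r; exact: is_derive_cst.
have C0 : rho * h @[h --> (0 : R)^'] --> (0 : R)^'.
  move=> A; rewrite /= !/(nbhs _) /= /dnbhs /within /= => HA.
  have H0 : rho * h @[h --> (0 : R)] --> (0 : R).
    by rewrite -[X in _ --> X](mulr0 rho); apply: cvgM; [exact: cvg_cst|exact: cvg_id].
  have := H0 _ HA; rewrite /= => HA'.
  by apply: (@filterS _ (nbhs (0 : R)) _ _ _ _ HA') => h + h0; apply; rewrite mulf_neq0.
move=> [D1 D2].
have C : h^-1 *: (f (rho *: (h *: v + z)) - f (rho *: z)) @[h --> (0 : R)^'] --> rho *: d.
  have -> : (fun h : R => h^-1 *: (f (rho *: (h *: v + z)) - f (rho *: z))) =
    (fun h : R => rho *: (h^-1 *: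
      ((f \o shift (rho *: z)) (h *: v) - f (rho *: z)))) \o (fun h : R => rho * h).
    apply/funext => h /=; rewrite (scalerDr rho (h *: v) z) !scalerA invfM mulVKf //.
  have C1 : rho *: (h^-1 *: ((f \o shift (rho *: z)) (h *: v) - f (rho *: z)))
      @[h --> (0 : R)^'] --> rho *: d by apply: cvgZr; rewrite -D2; exact: D1.
  exact: (cvg_comp _ _ C0 C1).
by apply: DeriveDef; [exact: cvgP C|exact: (cvg_lim (@norm_hausdorff _ _) C)].
Unshelve. all: by end_near.
Qed.

Lemma is_derive_lin (V W : normedModType R) (l : {linear W -> R^o}) (f : V -> W) x v d :
  continuous l -> is_derive x v f d -> is_derive x v (fun y => l (f y)) (l d).
Proof.
move=> cl [D1 D2].
have C : l (h^-1 *: ((f \o shift x) (h *: v) - f x)) @[h --> (0 : R)^'] --> l d.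
  by apply: (@cvg_comp _ _ _ _ l _ _ _ _ (cl d)); rewrite -D2; exact: D1.
have C' : h^-1 *: ((l (f (h *: v + x)) : R^o) - l (f x)) @[h --> (0 : R)^'] --> l d.
  have -> : (fun h : R => h^-1 *: ((l (f (h *: v + x)) : R^o) - l (f x))) =
    (fun h : R => l (h^-1 *: ((f \o shift x) (h *: v) - f x))).
    apply/funext => h; have := linearP l h^-1 ((f \o shift x) (h *: v) - f x) 0.
    by rewrite !addr0 (raddf0 l) addr0 => ->; rewrite (raddfB l).
  exact: C.
by apply: DeriveDef; [exact: cvgP C'|exact: (cvg_lim (@norm_hausdorff _ _) C')].
Qed.

Lemma is_derive_chain (f f1 f2 : R * R -> R) (x y : R -> R) (t dx dy : R) :
  (\forall z \near ((x t, y t) : R * R),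
    is_derive z e1 (f : R * R -> R^o) (f1 z) /\ is_derive z e2 (f : R * R -> R^o) (f2 z)) ->
  {for (x t, y t), continuous f1} -> {for (x t, y t), continuous f2} ->
  is_derive t (1 : R) x dx -> is_derive t (1 : R) y dy ->
  is_derive t (1 : R) (fun s => f (x s, y s)) (f1 (x t, y t) * dx + f2 (x t, y t) * dy).
Proof.
move=> /nbhs_ballP [r /= r0 Hr] c1 c2 Dx Dy.
have cx : {for t, continuous x}.
  by have [D _] := Dx; apply/differentiable_continuous/derivable1_diffP.
have cy : {for t, continuous y}.
  by have [D _] := Dy; apply/differentiable_continuous/derivable1_diffP.
(* A and B are the slopes of f along the two coordinates, filled in by the partial
   derivatives at zero increments. *)
pose A s := if x s == x t then f1 (x t, y t)
  else (f (x s, y s) - f (x t, y s)) / (x s - x t).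
pose B s := if y s == y t then f2 (x t, y t)
  else (f (x t, y s) - f (x t, y t)) / (y s - y t).
have AE s : f (x s, y s) - f (x t, y s) = A s * (x s - x t).
  rewrite /A; case: eqP => [->|/eqP h]; first by rewrite !subrr mulr0.
  by rewrite divfK // subr_eq0.
have BE s : f (x t, y s) - f (x t, y t) = B s * (y s - y t).
  rewrite /B; case: eqP => [->|/eqP h]; first by rewrite !subrr mulr0.
  by rewrite divfK // subr_eq0.
have shiftt (u : R -> R) : {for t, continuous u} ->
    u (h *: 1 + t) @[h --> (0 : R)^'] --> u t.
  move=> cu; apply: cvg_within_filter.
  have cuu : {for (0 : R), continuous (fun h : R => u (h *: 1 + t))}.
    apply: (@continuous_comp _ _ _ (fun h : R => h *: 1 + t) u).
      by apply: cvgD; [apply: cvgM; [exact: cvg_id|exact: cvg_cst]|exact: cvg_cst].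
    by rewrite scale0r add0r.
  by have := cuu; rewrite /prop_for /continuous_at scale0r add0r.
have nearx e : 0 < e -> \forall s \near t, `|x s - x t| < e /\ `|y s - y t| < e.
  move=> e0; near=> s; rewrite distrC [`|y s - _|]distrC; split; near: s.
    by move/cvgrPdist_lt : cx; apply.
  by move/cvgrPdist_lt : cy; apply.
have cA : {for t, continuous A}.
  have At : A t = f1 (x t, y t) by rewrite /A eqxx.
  rewrite /prop_for /continuous_at At; apply/cvgrPdist_lt => e e0.
  move/cvgrPdist_lt : c1 => /(_ e e0) /nbhs_ballP [r' /= r'0 Hr'].
  have m0 : 0 < Num.min r r' by rewrite lt_min r0.
  near=> s; have [sx sy] : `|x s - x t| < Num.min r r' /\ `|y s - y t| < Num.min r r'.
    by near: s; exact: nearx.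
  rewrite /A; case: eqP => [_|/eqP h]; first by rewrite subrr normr0.
  have inb c : `|c - x t| <= `|x s - x t| ->
      ball ((x t, y t) : R * R) r (c, y s) /\ ball ((x t, y t) : R * R) r' (c, y s).
    move=> hc; have hc' := le_lt_trans hc sx; move: hc' sy.
    rewrite !lt_min => /andP[h1 h2] /andP[h3 h4].
    by split; split; rewrite /ball /= distrC.
  have [s' hs'|c hc E] := @MVT_unordered (fun a => f (a, y s)) (fun a => f1 (a, y s)) (x t) (x s).
    by apply: is_derive_coord1; have [b1 _] := inb s' hs'; have [] := Hr _ b1.
  by rewrite E mulfK ?subr_eq0 //; have [_ b2] := inb c hc; exact: (Hr' _ b2).
have cB : {for t, continuous B}.
  have Bt : B t = f2 (x t, y t) by rewrite /B eqxx.
  rewrite /prop_for /continuous_at Bt; apply/cvgrPdist_lt => e e0.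
  move/cvgrPdist_lt : c2 => /(_ e e0) /nbhs_ballP [r' /= r'0 Hr'].
  have m0 : 0 < Num.min r r' by rewrite lt_min r0.
  near=> s; have [sx sy] : `|x s - x t| < Num.min r r' /\ `|y s - y t| < Num.min r r'.
    by near: s; exact: nearx.
  rewrite /B; case: eqP => [_|/eqP h]; first by rewrite subrr normr0.
  have inb c : `|c - y t| <= `|y s - y t| ->
      ball ((x t, y t) : R * R) r (x t, c) /\ ball ((x t, y t) : R * R) r' (x t, c).
    move=> hc; have hc' := le_lt_trans hc sy; move: hc'.
    rewrite !lt_min => /andP[h1 h2].
    by split; split; rewrite /ball /= ?subrr ?normr0 // distrC.
  have [s' hs'|c hc E] := @MVT_unordered (fun a => f (x t, a)) (fun a => f2 (x t, a)) (y t) (y s).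
    by apply: is_derive_coord2; have [b1 _] := inb s' hs'; have [] := Hr _ b1.
  by rewrite E mulfK ?subr_eq0 //; have [_ b2] := inb c hc; exact: (Hr' _ b2).
have C : h^-1 *: (f (x (h *: 1 + t), y (h *: 1 + t)) - f (x t, y t)) @[h --> (0 : R)^']
    --> f1 (x t, y t) * dx + f2 (x t, y t) * dy.
  have -> : (fun h : R => h^-1 *: (f (x (h *: 1 + t), y (h *: 1 + t)) - f (x t, y t))) =
    (fun h : R => A (h *: 1 + t) * (h^-1 *: (x (h *: 1 + t) - x t)) +
       B (h *: 1 + t) * (h^-1 *: (y (h *: 1 + t) - y t))).
    apply/funext => h; rewrite -(subrK (f (x t, y (h *: 1 + t))) (f (x _, _))).
    by rewrite -addrA AE BE /GRing.scale /=; ring.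
  have At : A t = f1 (x t, y t) by rewrite /A eqxx.
  have Bt : B t = f2 (x t, y t) by rewrite /B eqxx.
  rewrite -At -Bt; apply: cvgD; apply: cvgM; try exact: shiftt.
    by have [D <-] := Dx; exact: D.
  by have [D <-] := Dy; exact: D.
by apply: DeriveDef; [exact: cvgP C|exact: (cvg_lim (@norm_hausdorff _ _) C)].
Unshelve. all: by end_near.
Qed.

Lemma mixed_increment (F F1 F12 : R -> R -> R) (x y h : R) : 0 < h ->
  (forall s t, `|s - x| <= h -> `|t - y| <= h ->
    is_derive s (1 : R) (fun a => F a t) (F1 s t) /\
    is_derive t (1 : R) (F1 s) (F12 s t)) ->
  exists s t, [/\ `|s - x| <= h, `|t - y| <= h &
    F12 s t = (F (x + h) (y + h) - F (x + h) y - F x (y + h) + F x y) / (h * h)].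
Proof.
move=> h0 H.
have hh (a : R) : `|a + h - a| = h by rewrite addrC addKr gtr0_norm.
have yy : `|y - y| <= h by rewrite subrr normr0 ltW.
have [s hs|s hs E1] := @MVT_unordered (fun s => F s (y + h) - F s y)
    (fun s => F1 s (y + h) - F1 s y) x (x + h).
  rewrite hh in hs.
  have [d1 _] := H s (y + h) hs (eq_ind_r (fun u => u <= h) (lexx h) (hh y)).
  by have [d2 _] := H s y hs yy; exact: is_deriveB.
rewrite hh in hs.
have [t ht|t ht E2] := @MVT_unordered (F1 s) (F12 s) y (y + h).
  by rewrite hh in ht; have [] := H s t hs ht.
rewrite hh in ht; exists s, t; split => //.
have E3 : x + h - x = h by rewrite addrC addKr.
have E4 : y + h - y = h by rewrite addrC addKr.
move: E1 E2; rewrite /= E3 E4 => E1 E2.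
have -> : F (x + h) (y + h) - F (x + h) y - F x (y + h) + F x y = F12 s t * (h * h).
  by rewrite mulrA -E2 -E1; ring.
by rewrite mulfK // mulf_neq0 // gt_eqF.
Qed.

(** Applying the mean value theorem in either order to the second difference over a small square
    shows that the two mixed derivatives take a common value at points near z. Continuity carries
    the equality to z. *)
Lemma mixed_partials (U : set (R * R)) (f : R * R -> R^o) z :
  open U -> smooth_open U f -> U z -> 'D_e1 ('D_e2 f) z = 'D_e2 ('D_e1 f) z.
Proof.
move: z => [x y] oU sf Uz; apply/eqP; rewrite -subr_eq0 -normr_le0.
apply/ler_addgt0Pr => e e0; rewrite add0r.
have [c12 _] := sf [:: e1; e2] _ Uz; have [c21 _] := sf [:: e2; e1] _ Uz.
have e2p : 0 < e / 2 by rewrite divr_gt0.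
move/cvgrPdist_lt : c12 => /(_ _ e2p) /nbhs_ballP [r1 /= r10 H1].
move/cvgrPdist_lt : c21 => /(_ _ e2p) /nbhs_ballP [r2 /= r20 H2].
have /nbhs_ballP [r3 /= r30 H3] := open_nbhs_nbhs (conj oU Uz).
pose h := Num.min (Num.min r1 r2) r3 / 2.
have m0 : 0 < Num.min (Num.min r1 r2) r3 by rewrite !lt_min r10 r20.
have h0 : 0 < h by rewrite divr_gt0.
have hlt : h < Num.min (Num.min r1 r2) r3 by rewrite /h ltr_pdivrMr // ltr_pMr // ltr1n.
have [[h1 h2] h3] : (h < r1 /\ h < r2) /\ h < r3.
  by move: hlt; rewrite !lt_min => /andP[/andP[]].
have inb r s t : h < r -> `|s - x| <= h -> `|t - y| <= h -> ball ((x, y) : R * R) r (s, t).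
  by move=> hr hs ht; split; rewrite /ball /= distrC; exact: le_lt_trans hr.
have [|s [t [hs ht E]]] := @mixed_increment (fun a b => f (a, b))
    (fun a b => 'D_e1 f (a, b)) (fun a b => 'D_e2 ('D_e1 f) (a, b)) x y h h0.
  move=> s t hs ht; have Ust := H3 _ (inb _ _ _ h3 hs ht).
  split; first by have [_ dd] := sf [::] _ Ust;
    exact: (@is_derive_coord1 _ _ _ _ _ (derivableP (dd e1))).
  by have [_ dd] := sf [:: e1] _ Ust;
    exact: (@is_derive_coord2 _ _ _ _ _ (derivableP (dd e2))).
have [|t' [s' [ht' hs' E']]] := @mixed_increment (fun b a => f (a, b))
    (fun b a => 'D_e2 f (a, b)) (fun b a => 'D_e1 ('D_e2 f) (a, b)) y x h h0.
  move=> b a hb ha; have Ust := H3 _ (inb _ _ _ h3 ha hb).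
  split; first by have [_ dd] := sf [::] _ Ust;
    exact: (@is_derive_coord2 _ _ _ _ _ (derivableP (dd e2))).
  by have [_ dd] := sf [:: e2] _ Ust;
    exact: (@is_derive_coord1 _ _ _ _ _ (derivableP (dd e1))).
have EE : 'D_e1 ('D_e2 f) (s', t') = 'D_e2 ('D_e1 f) (s, t).
  apply: (etrans E' (etrans _ (esym E))); cbv beta; congr (_ / _).
  by rewrite -!addrA; congr (_ + _); rewrite addrCA.
have A1 := H1 _ (inb _ _ _ h1 hs' ht'); have A2 := H2 _ (inb _ _ _ h2 hs ht).
rewrite /= EE in A1; rewrite /= in A2; apply: ltW.
have tri (a b w : R) : `|a - w| < e / 2 -> `|b - w| < e / 2 -> `|a - b| < e.
  move=> h1' h2'; have -> : a - b = (a - w) - (b - w) by ring.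
  by apply: le_lt_trans (ler_normB _ _) _; rewrite (splitr e) ltrD.
exact: (tri _ _ _ A1 A2).
Qed.

End plane_calculus.

(** * Green's formula on the unit disc *)

Section green.
Context {R : realType}.
Local Notation plane := (measurableTypeR R * measurableTypeR R)%type.
Local Notation mu := (@lebesgue_measure R).
Local Notation mu2 := (mu \x mu)%E.
Local Notation c2 := (pi / 2 : R).
Local Notation e1 := ((1, 0) : R * R).
Local Notation e2 := ((0, 1) : R * R).

Lemma is_derive_affine (F : R -> R) (k c t d : R) :
  is_derive (k * t + c) (1 : R) F d -> is_derive t (1 : R) (fun s => F (k * s + c)) (d * k).
Proof.
move=> H; apply: (@is_derive_comp1 R R^o F d (fun s : R => k * s + c)) => //.
have H1 := @is_deriveM _ _ (cst k : R -> R) id t 1 _ _ (is_derive_cst k t 1) (is_derive_id t 1).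
have H2 := @is_deriveD _ _ _ _ (cst c : R -> R) t 1 _ _ H1 (is_derive_cst c t 1).
by apply: (is_derive_eq H2); rewrite /GRing.scale /= mulr0 !addr0 mulr1.
Qed.

(** M(t + 2 pi) - M(t) has derivative zero: the integral over a period does not depend on its
    starting point. This moves the integrals over pieced half circles to [0, 2 pi]. *)
Lemma periodic_increment (M m : R -> R) (a x y : R) :
  (forall t, a < t -> is_derive t (1 : R) M (m t)) ->
  (forall t, m (t + pi *+ 2) = m t) -> a < x -> a < y ->
  M (x + pi *+ 2) - M x = M (y + pi *+ 2) - M y.
Proof.
move=> H per; wlog xy : x y / x <= y => [W ax ay|ax ay].
  by have [|/ltW] := leP x y => h; [|apply/esym]; apply: W.
have D t : a < t -> is_derive t (1 : R) (fun t => M (t + pi *+ 2) - M t) 0.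
  move=> at_; have D1 : is_derive t (1 : R) (fun t => M (t + pi *+ 2)) (m t).
    have := @is_derive_affine M 1 (pi *+ 2) t (m t); rewrite mulr1 mul1r.
    under eq_fun do rewrite mul1r; apply; rewrite -per; apply: H.
    by have := @pi_gt0 R; lra.
  by rewrite -(subrr (m t)); apply: is_deriveB; exact: H.
have [t| |c _] := @MVT_segment R (fun t => M (t + pi *+ 2) - M t) (fun=> 0) x y xy.
- by rewrite in_itv /= => /andP[xt _]; apply: D; exact: lt_trans xt.
- apply: continuous_in_subspaceT => t /set_mem /=; rewrite in_itv /= => /andP[xt _].
  have [d _] := D t (lt_le_trans ax xt).
  by apply/differentiable_continuous/derivable1_diffP.
by rewrite mul0r => /eqP; rewrite subr_eq0 => /eqP.
Qed.

Lemma ftc_interval (A a : R -> R) (l r : R) : l < r -> continuous a ->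
  (forall t, l <= t <= r -> is_derive t (1 : R) A (a t)) ->
  (\int[mu]_(t in `[l, r]) (a t)%:E = (A r - A l)%:E)%E.
Proof.
move=> lr ca H; have cA t : l <= t <= r -> A @ t --> A t.
  by move=> /H [d _]; apply: differentiable_continuous; apply/derivable1_diffP.
rewrite (@continuous_FTC2 R a A) //.
- exact: continuous_subspaceT.
- split; first by move=> t /subset_itv_oo_cc; rewrite in_itv /= => /H [].
  + by apply: cvg_at_right_filter; apply: cA; rewrite lexx ltW.
  + by apply: cvg_at_left_filter; apply: cA; rewrite lexx ltW.
- move=> t /subset_itv_oo_cc; rewrite in_itv /= => /H [_].
  by rewrite derive1E.
Qed.

Lemma circle_dx (Q : R * R -> R) : (forall z, disc z -> {for z, continuous Q}) ->
  exists2 M : R -> R,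
    forall t : R, -1 < t -> is_derive t (1 : R) M (Q (cos t, sin t) * cos t) &
    (\int[mu]_(t in `[(- c2)%R, c2]) (half_circle Q t)%:E =
      (M (pi *+ 2) - M 0)%:E)%E.
Proof.
move=> cQ; pose m t := Q (cos t, sin t) * cos t.
have pi0 := @pi_gt0 R.
have cm : continuous m.
  move=> t; apply: cvgM; last exact: continuous_cos.
  exact: (continuous_circle cQ).
have [M HM] := @antiderivative_from R m (- (pi *+ 2) - 1) cm.
exists M; first by move=> t ht; apply: HM; lra.
(* The left half of the circle is parametrised by pi - t, where the cosine changes its sign. The two
   terms together run once through [- pi/2, 3 pi/2]. *)
have hE t : half_circle Q t = m t + m (- 1 * t + pi).
  have -> : - 1 * t + pi = - t + pi by rewrite mulN1r.
  by rewrite /half_circle /m cosDpi sinDpi cosN sinN opprK; ring.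
have cm' : continuous (fun t : R => m (- 1 * t + pi)).
  move=> t; apply: (@continuous_comp _ _ _ (fun t : R => - 1 * t + pi) m); last exact: cm.
  by apply: cvgD; [apply: cvgM; [exact: cvg_cst|exact: cvg_id]|exact: cvg_cst].
under eq_integral do rewrite hE.
have D t : - c2 <= t <= c2 -> is_derive t (1 : R)
    (fun t : R => M t - M (- 1 * t + pi)) (m t + m (- 1 * t + pi)).
  move=> /andP[t1 t2].
  have -> : m t + m (-1 * t + pi) = m t - m (- 1 * t + pi) * (- 1) by ring.
  apply: is_deriveB; first by apply: HM; lra.
  by apply: is_derive_affine; apply: HM; lra.
have cD : continuous (fun t : R => m t + m (- 1 * t + pi)).
  by move=> t; apply: cvgD; [exact: cm|exact: cm'].
have lt : - c2 < c2 by lra.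
rewrite (ftc_interval lt cD D); congr (_%:E).
have -> : -1 * c2 + pi = c2 by field.
have -> : -1 * - c2 + pi = - c2 + pi *+ 2 by rewrite mulr2n; field.
have E := @periodic_increment M m (- (pi *+ 2) - 1) (- c2) 0 HM.
have : M (- c2 + pi *+ 2) - M (- c2) = M (0 + pi *+ 2) - M 0.
  by apply: E; [move=> t; rewrite /m cosD2pi sinD2pi|lra|lra].
by rewrite add0r => <-; ring.
Qed.

Lemma circle_dy (P : R * R -> R) : (forall z, disc z -> {for z, continuous P}) ->
  exists2 N : R -> R,
    forall t : R, -1 < t -> is_derive t (1 : R) N (P (cos t, sin t) * sin t) &
    (\int[mu]_(t in `[(- c2)%R, c2]) (half_circle (fun z => P (z.2, z.1)) t)%:E =
      (N (pi *+ 2) - N 0)%:E)%E.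
Proof.
move=> cQ; pose m t := P (cos t, sin t) * sin t.
have pi0 := @pi_gt0 R.
have cm : continuous m.
  move=> t; apply: cvgM; last exact: continuous_sin.
  exact: (continuous_circle cQ).
have [M HM] := @antiderivative_from R m (- (pi *+ 2) - 1) cm.
exists M; first by move=> t ht; apply: HM; lra.
(* After the swap of coordinates the two halves are the lower and the upper one, parametrised by t -
   pi/2 and pi/2 - t. Together they run through [- pi, pi]. *)
have hE t : half_circle (fun z => P (z.2, z.1)) t = m (1 * t + - c2) + m (- 1 * t + c2).
  have -> : - 1 * t + c2 = - t + c2 by rewrite mulN1r.
  rewrite /half_circle /m mul1r cosBpihalf sinBpihalf cosDpihalf sinDpihalf sinN cosN /=.
  by rewrite opprK; ring.
have caff k c : continuous (fun t : R => m (k * t + c)).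
  move=> t; apply: (@continuous_comp _ _ _ (fun t : R => k * t + c) m); last exact: cm.
  by apply: cvgD; [apply: cvgM; [exact: cvg_cst|exact: cvg_id]|exact: cvg_cst].
under eq_integral do rewrite hE.
have D t : - c2 <= t <= c2 -> is_derive t (1 : R)
    (fun t : R => M (1 * t + - c2) - M (- 1 * t + c2))
    (m (1 * t + - c2) + m (- 1 * t + c2)).
  move=> /andP[t1 t2].
  have -> : m (1 * t + - c2) + m (-1 * t + c2) =
     m (1 * t + - c2) * 1 - m (- 1 * t + c2) * (- 1) by ring.
  by apply: is_deriveB; apply: is_derive_affine; apply: HM; lra.
have cD : continuous (fun t : R => m (1 * t + - c2) + m (- 1 * t + c2)).
  by move=> t; apply: cvgD; exact: caff.
have lt : - c2 < c2 by lra.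
rewrite (ftc_interval lt cD D); congr (_%:E).
have -> : -1 * c2 + c2 = 0 by field.
have -> : 1 * c2 + - c2 = 0 by field.
have -> : -1 * - c2 + c2 = - pi + pi *+ 2 by rewrite mulr2n; field.
have -> : 1 * - c2 + - c2 = - pi by field.
have E := @periodic_increment M m (- (pi *+ 2) - 1) (- pi) 0 HM.
have : M (- pi + pi *+ 2) - M (- pi) = M (0 + pi *+ 2) - M 0.
  by apply: E; [move=> t; rewrite /m cosD2pi sinD2pi|lra|lra].
rewrite add0r => <-; ring.
Qed.

(** Green's formula for the form u dv: the integrand of du dv is the difference of the x-derivative
    of u v_y and the y-derivative of u v_x, in which the terms [u * v12] cancel. The boundary
    integral is given by a primitive [T] that is differentiable beyond 0 on the left, so that it may
    be composed with loops on the closed interval. *)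
Lemma green_disc (u u1 u2 v1 v2 v12 : R * R -> R) :
  (forall z, disc z -> [/\ {for z, continuous u}, {for z, continuous u1} &
    {for z, continuous u2}]) ->
  (forall z, disc z -> [/\ {for z, continuous v1}, {for z, continuous v2} &
    {for z, continuous v12}]) ->
  (forall z, disc z -> is_derive z e1 (u : R * R -> R^o) (u1 z) /\
    is_derive z e2 (u : R * R -> R^o) (u2 z)) ->
  (forall z, disc z -> is_derive z e1 (v2 : R * R -> R^o) (v12 z) /\
    is_derive z e2 (v1 : R * R -> R^o) (v12 z)) ->
  exists2 T : R -> R,
    forall t : R, -1 < t -> is_derive t (1 : R) T
      (u (cos t, sin t) * (v2 (cos t, sin t) * cos t - v1 (cos t, sin t) * sin t)) &
    Rintegral mu2 (odisc : set plane) (fun z => u1 z * v2 z - u2 z * v1 z) =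
      T (pi *+ 2) - T 0.
Proof.
move=> Cu Cv Du Dv.
have cM (f g : R * R -> R) : (forall z, disc z -> {for z, continuous f}) ->
    (forall z, disc z -> {for z, continuous g}) ->
    forall z, disc z -> {for z, continuous (fun z => f z * g z)}.
  by move=> cf cg z dz; apply: cvgM; [exact: cf|exact: cg].
have cD (f g : R * R -> R) : (forall z, disc z -> {for z, continuous f}) ->
    (forall z, disc z -> {for z, continuous g}) ->
    forall z, disc z -> {for z, continuous (fun z => f z + g z)}.
  by move=> cf cg z dz; apply: cvgD; [exact: cf|exact: cg].
have cu z : disc z -> {for z, continuous u} by move=> /Cu [].
have cu1 z : disc z -> {for z, continuous u1} by move=> /Cu [].
have cu2 z : disc z -> {for z, continuous u2} by move=> /Cu [].
have cv1 z : disc z -> {for z, continuous v1} by move=> /Cv [].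
have cv2 z : disc z -> {for z, continuous v2} by move=> /Cv [].
have cv12 z : disc z -> {for z, continuous v12} by move=> /Cv [].
have int (f : R * R -> R) : (forall z, disc z -> {for z, continuous f}) ->
    mu2.-integrable (odisc : set plane) (EFin \o f).
  move=> cf; have [B B0 HB] := continuous_disc_bounded cf.
  apply: (@continuous_odisc_integrable _ _ B).
    by move=> z /odisc_sub; exact: cf.
  by move=> z /odisc_sub; exact: HB.
pose dQ z := u1 z * v2 z + u z * v12 z; pose dP z := u2 z * v1 z + u z * v12 z.
have cdQ z : disc z -> {for z, continuous dQ} by apply: cD; apply: cM.
have cdP z : disc z -> {for z, continuous dP} by apply: cD; apply: cM.
have DQ z : disc z -> is_derive z e1 ((fun z => u z * v2 z) : R * R -> R^o) (dQ z).
  move=> dz; have [D1 _] := Du z dz; have [D2 _] := Dv z dz.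
  have := @is_deriveM _ _ u v2 z e1 _ _ D1 D2.
  by rewrite /dQ /GRing.scale /= addrC [u1 z * _]mulrC.
have DP z : disc z -> is_derive z e2 ((fun z => u z * v1 z) : R * R -> R^o) (dP z).
  move=> dz; have [_ D1] := Du z dz; have [_ D2] := Dv z dz.
  have := @is_deriveM _ _ u v1 z e2 _ _ D1 D2.
  by rewrite /dP /GRing.scale /= addrC [u2 z * _]mulrC.
have [M HM EM] := circle_dx (cM _ _ cu cv2).
have [N HN EN] := circle_dy (cM _ _ cu cv1).
exists (fun t => M t - N t).
  move=> t ht; have D1 := HM t ht; have D2 := HN t ht.
  rewrite (_ : u _ * _ = u (cos t, sin t) * v2 (cos t, sin t) * cos t -
     u (cos t, sin t) * v1 (cos t, sin t) * sin t); last by ring.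
  exact: is_deriveB.
have EQ : Rintegral mu2 (odisc : set plane) dQ = M (pi *+ 2) - M 0.
  by rewrite /Rintegral (disc_integral_dx (cM _ _ cu cv2) cdQ DQ) EM.
have EP : Rintegral mu2 (odisc : set plane) dP = N (pi *+ 2) - N 0.
  by rewrite /Rintegral (disc_integral_dy (cM _ _ cu cv1) cdP DP) EN.
transitivity (Rintegral mu2 (odisc : set plane) (fun z => dQ z - dP z)).
  by apply: eq_Rintegral => z _; rewrite /dQ /dP; ring.
rewrite RintegralB ?EQ ?EP; [ring|exact: odisc_measurable|exact: int|exact: int].
Qed.

End green.

(** * Stokes' formula in one coordinate plane, by exhaustion with smaller discs *)

Section stokes_scalar.
Context {R : realType}.
Local Notation plane := (measurableTypeR R * measurableTypeR R)%type.
Local Notation mu := (@lebesgue_measure R).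
Local Notation mu2 := (mu \x mu)%E.
Local Notation e1 := ((1, 0) : R * R).
Local Notation e2 := ((0, 1) : R * R).

(** Dominated convergence with a constant majorant along rho = n / (n + 1). The integrand is the
    Jacobian of the rescaled map z -> u(rho z), whose two derivatives bring the factor rho^2. *)
Lemma radial_limit (J : R * R -> R) (B : R) :
  (forall z, odisc z -> {for z, continuous J}) ->
  (forall z, odisc z -> `|J z| <= B) ->
  (fun n => Rintegral mu2 (odisc : set plane)
    (fun z => (n%:R / n.+1%:R) ^+ 2 * J ((n%:R / n.+1%:R : R) *: (z : R * R)))) @ \oo -->
  Rintegral mu2 (odisc : set plane) J.
Proof.
move=> cJ JB; pose rho n : R := n%:R / n.+1%:R.
have rho0 n : 0 <= rho n by rewrite divr_ge0.
have rho1 n : rho n <= 1 by rewrite ler_pdivrMr // mul1r ler_nat.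
have sc n (z : R * R) : odisc z -> odisc (rho n *: z).
  move=> oz; rewrite /odisc /= ![_ *: _]/(_ * _) !(exprMn _ (rho n)) -mulrDr.
  apply: le_lt_trans oz; apply: ler_piMl; first by rewrite addr_ge0 ?sqr_ge0.
  exact: exprn_ile1.
have B0 : 0 <= B by apply: le_trans (JB (0, 0) _); rewrite // /odisc /= expr0n addr0.
have crho : rho n @[n --> \oo] --> (1 : R).
  have -> : rho = (fun n => 1 - n.+1%:R^-1).
    apply/funext => n; have h : (n.+1%:R : R) != 0 by rewrite pnatr_eq0.
    by apply: (mulIf h); rewrite mulrBl divfK // mulVf // mul1r -natr1 addrK.
  by rewrite -[X in _ --> X]subr0; apply: cvgB; [exact: cvg_cst|exact: cvg_harmonic].
have crz (z : R * R) : rho n *: z @[n --> \oo] --> z.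
  by rewrite -[X in _ --> X]scale1r; apply: cvgZl.
pose f_ n := EFin \o (fun z : R * R => rho n ^+ 2 * J (rho n *: z)).
have cf n z : odisc z -> {for z, continuous (fun z : R * R => rho n ^+ 2 * J (rho n *: z))}.
  move=> oz; apply: cvgM; first exact: cvg_cst.
  apply: (@continuous_comp _ _ _ (fun z : R * R => rho n *: z) J).
    exact: scaler_continuous.
  exact/cJ/sc.
have fB n z : odisc z -> `|rho n ^+ 2 * J (rho n *: z)| <= B.
  move=> oz; rewrite normrM ger0_norm ?sqr_ge0 // -[leRHS]mul1r.
  by apply: ler_pM => //; [exact: sqr_ge0|exact: exprn_ile1|apply/JB/sc].
have mD := @odisc_measurable R.
have iB : mu2.-integrable (odisc : set plane) (cst B%:E).
  apply: (@continuous_odisc_integrable _ (cst B) B); first by move=> z _; exact: cvg_cst.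
  by move=> z _; rewrite ger0_norm.
have iJ : mu2.-integrable (odisc : set plane) (EFin \o J).
  exact: continuous_odisc_integrable cJ JB.
have mf n : measurable_fun (odisc : set plane) (f_ n).
  apply/measurable_EFinP; apply: continuous_plane_measurable; first exact: open_odisc.
  exact: cf.
have lim := @dominated_cvg _ _ _ mu2 (odisc : set plane) mD f_ (EFin \o J) (cst B%:E) mf.
apply: fine_cvg; rewrite fineK; last exact: integrable_fin_num.
apply: lim => //.
  move=> z oz; apply: cvg_EFin; first exact: nearW.
  rewrite /f_ /=; have -> : J z = 1 ^+ 2 * J z by rewrite expr1n mul1r.
  apply: cvgM; first by rewrite expr2; under eq_fun do rewrite expr2; exact: cvgM.
  by apply: (@cvg_comp _ _ _ (fun n => rho n *: (z : R * R)) J _ _ _ (crz z)); exact: cJ.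
Qed.

Definition circle_at (rho t : R) : R * R :=
  (rho * cos (2 * pi * t), rho * sin (2 * pi * t)).

Lemma lipschitz_derive (f df : R -> R) (L : R) :
  (forall x : R, is_derive x (1 : R) f (df x)) -> (forall x, `|df x| <= L) ->
  forall x y, `|f x - f y| <= L * `|x - y|.
Proof.
move=> H B x y; have [c _ ->] := @MVT_unordered R f df y x (fun s _ => H s).
 by rewrite normrM; apply: ler_wpM2r.
Qed.

Lemma circle_at_lipschitz (rho s t : R) : 0 <= rho <= 1 ->
  `|circle_at rho s - circle_at rho t| <= 2 * pi * `|s - t|.
Proof.
move=> /andP[r0 r1]; have pi0 := @pi_gt0 R.
have H (f df : R -> R) : (forall x : R, is_derive x (1 : R) f (df x)) ->
    (forall x, `|df x| <= 1) ->
    `|rho * f (2 * pi * s) - rho * f (2 * pi * t)| <= 2 * pi * `|s - t|.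
  move=> Df Bf; rewrite -mulrBr normrM ger0_norm // -[leRHS]mul1r.
  apply: ler_pM => //; apply: le_trans (lipschitz_derive Df Bf _ _) _.
  by rewrite mul1r -mulrBr normrM [X in X * _]ger0_norm // mulr_ge0 // ltW.
rewrite prod_normE ge_max; apply/andP; split.
  by apply: (H cos (fun x => - sin x)) => x; rewrite normrN sin_max.
by apply: (H sin cos) => x; rewrite cos_max.
Qed.

Lemma circle_at_dist (rho t : R) : 0 <= rho <= 1 ->
  `|circle_at rho t - circle_at 1 t| <= 1 - rho.
Proof.
move=> /andP[r0 r1].
have H (x : R) : `|x| <= 1 -> `|rho * x - 1 * x| <= 1 - rho.
  rewrite -mulrBl normrM [X in X * _]distrC [X in X * _]ger0_norm ?subr_ge0 //.
  by apply: ler_piMr; rewrite ?subr_ge0.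
by rewrite prod_normE ge_max; apply/andP; split; apply: H; rewrite ?cos_max ?sin_max.
Qed.

Lemma circle_at_odisc (rho t : R) : 0 <= rho < 1 -> odisc (circle_at rho t).
Proof.
move=> /andP[r0 r1]; rewrite /odisc /circle_at /= !exprMn -mulrDr cos2Dsin2 mulr1.
by rewrite expr_lt1.
Qed.

Lemma scaled_disc (rho : R) (z : R * R) : 0 <= rho < 1 -> disc z -> odisc (rho *: z).
Proof.
move=> /andP[r0 r1] dz; rewrite /odisc /= ![_ *: _]/(_ * _) !(exprMn _ rho) -mulrDr.
apply: le_lt_trans (_ : rho ^+ 2 < 1); last by rewrite expr_lt1.
by apply: ler_piMr => //; exact: sqr_ge0.
Qed.

(* The primitive of u dv on the circle of radius rho and the primitive S of q dp
   differ by q (v - p), which takes the same value at both ends of the loop, up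
   to terms of size O(1 - rho). *)
Lemma scalar_boundary (k : R) (u v : R * R -> R^o) (q p S dq dp : R -> R) : 0 <= k ->
  smooth_open odisc u -> smooth_open odisc v ->
  (forall z w, odisc z -> odisc w -> `|v z - v w| <= k * `|z - w|) ->
  (forall rho t, 0 <= rho < 1 -> 0 <= t <= 1 ->
    `|u (circle_at rho t) - q t| <= k * (1 - rho) /\
    `|v (circle_at rho t) - p t| <= k * (1 - rho)) ->
  {within `[0, 1], continuous q} -> {within `[0, 1], continuous p} ->
  {within `[0, 1], continuous S} ->
  (forall t : R, 0 < t < 1 -> [/\ is_derive t (1 : R) q (dq t), is_derive t (1 : R) p (dp t),
     is_derive t (1 : R) S (q t * dp t) & `|dq t| <= 2 * pi * k]) ->
  q 0 = q 1 -> p 0 = p 1 ->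
  forall rho, 0 <= rho < 1 ->
  `|Rintegral mu2 (odisc : set plane) (fun z : R * R => rho ^+ 2 *
     ('D_e1 u (rho *: z) * 'D_e2 v (rho *: z) - 'D_e2 u (rho *: z) * 'D_e1 v (rho *: z)))
   - (S 1 - S 0)| <= 4 * pi * k ^+ 2 * (1 - rho).
Proof.
move=> k0 su sv lv bd cq cp cS D q01 p01 rho rho01.
have pi0 := @pi_gt0 R.
have sc z : disc z -> odisc (rho *: z) by exact: scaled_disc.
have cs (f : R * R -> R^o) : smooth_open odisc f -> forall s z, disc z ->
    {for z, continuous (fun z : R * R => iter_derive s f (rho *: z))}.
  move=> sf s z dz; have [c _] := sf s _ (sc z dz).
  apply: (@continuous_comp _ _ _ (fun z : R * R => rho *: z) (iter_derive s f)) c.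
  exact: scaler_continuous.
have cs1 (f : R * R -> R^o) : smooth_open odisc f -> forall s z, disc z ->
    {for z, continuous (fun z : R * R => rho * iter_derive s f (rho *: z))}.
  by move=> sf s z dz; apply: cvgM; [exact: cvg_cst|exact: cs].
have cs2 (f : R * R -> R^o) : smooth_open odisc f -> forall s z, disc z ->
    {for z, continuous (fun z : R * R => rho * (rho * iter_derive s f (rho *: z)))}.
  by move=> sf s z dz; apply: cvgM; [exact: cvg_cst|exact: cs1].
have ds (f : R * R -> R^o) : smooth_open odisc f -> forall s e z, disc z ->
    is_derive z e ((fun z : R * R => iter_derive s f (rho *: z)) : R * R -> R^o)
      (rho * iter_derive (e :: s) f (rho *: z)).
  move=> sf s e z dz; have [_ /(_ e) d] := sf s _ (sc z dz).
  exact: (is_derive_scaled (derivableP d)).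
have ds1 (f : R * R -> R^o) : smooth_open odisc f -> forall s e z, disc z ->
    is_derive z e ((fun z : R * R => rho * iter_derive s f (rho *: z)) : R * R -> R^o)
      (rho * (rho * iter_derive (e :: s) f (rho *: z))).
  move=> sf s e z dz; exact: (is_deriveZ rho (ds f sf s e z dz)).
have [|T HT ET] := @green_disc R (fun z : R * R => u (rho *: z))
  (fun z : R * R => rho * 'D_e1 u (rho *: z)) (fun z : R * R => rho * 'D_e2 u (rho *: z))
  (fun z : R * R => rho * 'D_e1 v (rho *: z)) (fun z : R * R => rho * 'D_e2 v (rho *: z))
  (fun z : R * R => rho * (rho * 'D_e1 ('D_e2 v) (rho *: z)))
  (fun z dz => And3 (cs u su [::] z dz) (cs1 u su [:: e1] z dz) (cs1 u su [:: e2] z dz))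
  (fun z dz => And3 (cs1 v sv [:: e1] z dz) (cs1 v sv [:: e2] z dz) (cs2 v sv [:: e1; e2] z dz))
  (fun z dz => conj (ds u su [::] e1 z dz) (ds u su [::] e2 z dz)).
  move=> z dz; split; first exact: (ds1 v sv [:: e2] e1 z dz).
  by rewrite (mixed_partials open_odisc sv (sc z dz)); exact: (ds1 v sv [:: e1] e2 z dz).
pose ga t := circle_at rho t.
have ga_o t : odisc (ga t) by exact: circle_at_odisc.
pose V t := v (ga t); pose U t := u (ga t).
pose dV t := 'D_e1 v (ga t) * (rho * (- sin (2 * pi * t) * (2 * pi)))
   + 'D_e2 v (ga t) * (rho * (cos (2 * pi * t) * (2 * pi))).
have Dscale (F : R -> R) (t d : R) : is_derive (2 * pi * t) (1 : R) F d ->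
    is_derive t (1 : R) (fun s => F (2 * pi * s)) (d * (2 * pi)).
  move=> H; have := @is_derive_affine R F (2 * pi) 0 t d; rewrite addr0 => /(_ H).
  by under eq_fun do rewrite addr0.
have DV (t : R) : is_derive t (1 : R) V (dV t).
  apply: (@is_derive_chain R v ('D_e1 v) ('D_e2 v)
    (fun s => rho * cos (2 * pi * s)) (fun s => rho * sin (2 * pi * s))).
  - have : \forall z \near ga t, odisc z by apply: open_nbhs_nbhs; split; [exact: open_odisc|].
    apply: filterS => z oz; have [_ d] := sv [::] z oz.
    by split; apply: derivableP; exact: d.
  - by have [c _] := sv [:: e1] _ (ga_o t).
  - by have [c _] := sv [:: e2] _ (ga_o t).
have rho01' : 0 <= rho <= 1 by case/andP: rho01 => -> /ltW.
have BV t : `|dV t| <= 2 * pi * k.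
  apply: (@derive_lipschitz R R^o V t 1 (dV t) (2 * pi * k) (DV t)).
  apply: filterE => h; apply: le_trans (lv _ _ (ga_o _) (ga_o _)) _.
  have := circle_at_lipschitz (h *: 1 + t) t rho01'; rewrite addrK [h *: 1]mulr1 => H.
  by rewrite [2 * pi * k]mulrC -mulrA; apply: ler_wpM2l.
(* The derivative of the first two terms is U V' - q p', and V' - p' has no reason to be small.
   Subtracting q (V - p) is an integration by parts after which only the small differences U - q and
   V - p occur, multiplied by the bounded derivatives V' and q'. *)
pose E t := T (2 * pi * t) - S t - q t * (V t - p t).
pose dE t := (U t - q t) * dV t - dq t * (V t - p t).
have DE (t : R) : 0 < t < 1 -> is_derive t (1 : R) E (dE t).
  move=> t01; have [Dq Dp DS _] := D t t01.
  have DT : is_derive t (1 : R) (fun s => T (2 * pi * s)) (U t * dV t).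
    have h1 : -1 < 2 * pi * t by case/andP: t01 => t0 _; nra.
    apply: (is_derive_eq (Dscale T t _ (HT _ h1))); rewrite /U /dV.
    rewrite [rho *: (_, _)](_ : _ = ga t) //; ring.
  have DVp : is_derive t (1 : R) (fun s => V s - p s) (dV t - dp t) by exact: is_deriveB.
  have Dqp := @is_deriveM _ _ q (fun s => V s - p s) t 1 _ _ Dq DVp.
  apply: (is_derive_eq (is_deriveB (is_deriveB DT DS) Dqp)).
  by rewrite /dE /GRing.scale /=; ring.
have cV (t : R) : {for t, continuous V}.
  by have [d _] := DV t; apply/differentiable_continuous/derivable1_diffP.
have cE : {within `[0, 1], continuous E}.
  move=> t; apply: cvgB; first (apply: cvgB; last exact: cS).
    apply: continuous_in_subspaceT => {}t /set_mem /=; rewrite in_itv /= => /andP[t0 t1].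
    have h1 : -1 < 2 * pi * t by nra.
    have [d _] := Dscale T t _ (HT _ h1).
    exact/differentiable_continuous/derivable1_diffP.
  apply: cvgM; first exact: cq.
  by apply: cvgB; [apply: continuous_subspaceT => {}t; exact: cV|exact: cp].
have DE' (t : R) : t \in `]0, 1[ -> is_derive t (1 : R) E (dE t).
  by rewrite in_itv /=; exact: DE.
have [c cI EE] := @MVT R E dE 0 1 ltr01 DE' cE.
move: cI; rewrite in_itv /= => c01.
have V01 : V 1 = V 0.
  rewrite /V /ga /circle_at mulr1 mulr0 mulr_natl cos2pi sin2pi cos0 sin0 //.
have -> : Rintegral mu2 (odisc : set plane) (fun z : R * R => rho ^+ 2 *
     ('D_e1 u (rho *: z) * 'D_e2 v (rho *: z) - 'D_e2 u (rho *: z) * 'D_e1 v (rho *: z)))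
    = T (pi *+ 2) - T 0.
  by rewrite -ET; apply: eq_Rintegral => z _; ring.
have -> : T (pi *+ 2) - T 0 - (S 1 - S 0) = dE c.
  rewrite subr0 mulr1 in EE; rewrite -EE /E mulr1 mulr0 mulr_natl V01 q01 p01; ring.
have [_ _ _ Bq] := D c c01; have [|b1 b2] := bd rho c rho01.
  by case/andP: c01 => /ltW -> /ltW.
rewrite /dE; apply: le_trans (ler_normB _ _) _; rewrite !normrM.
have h1 : `|U c - q c| * `|dV c| <= k * (1 - rho) * (2 * pi * k) by apply: ler_pM.
have h2 : `|dq c| * `|V c - p c| <= (2 * pi * k) * (k * (1 - rho)) by apply: ler_pM.
by apply: le_trans (lerD h1 h2) _; rewrite le_eqVlt; apply/orP; left; apply/eqP; ring.
Qed.

End stokes_scalar.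

Section stokes.
Context {R : realType}.
Local Notation plane := (measurableTypeR R * measurableTypeR R)%type.
Local Notation mu := (@lebesgue_measure R).
Local Notation mu2 := (mu \x mu)%E.
Local Notation e1 := ((1, 0) : R * R).
Local Notation e2 := ((0, 1) : R * R).

Lemma lipschitz_partial (k : R) (u : R * R -> R^o) (e z : R * R) :
  smooth_open odisc u -> `|e| = 1 ->
  (forall z w, odisc z -> odisc w -> `|u z - u w| <= k * `|z - w|) ->
  odisc z -> `|'D_e u z| <= k.
Proof.
move=> su e1n lu oz; have [_ d] := su [::] z oz.
apply: (@derive_lipschitz R (R * R)%type u z e ('D_e u z) k (derivableP (d e))).
have c : {for (0 : R), continuous (fun h : R => h *: e + z)}.
  apply: cvgD; last exact: cvg_cst.
  by apply: cvgZl; exact: cvg_id.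
have : \forall h \near (0 : R), odisc (h *: e + z).
  apply: c; rewrite scale0r add0r; apply: open_nbhs_nbhs.
  by split; [exact: open_odisc|].
apply: filterS => h oh; apply: le_trans (lu _ _ oh oz) _.
by rewrite addrK normrZ e1n mulr1.
Qed.

Definition jac (u v : R * R -> R^o) (z : R * R) : R :=
  'D_e1 u z * 'D_e2 v z - 'D_e2 u z * 'D_e1 v z.

Lemma jac_continuous (u v : R * R -> R^o) : smooth_open odisc u -> smooth_open odisc v ->
  forall z, odisc z -> {for z, continuous (jac u v)}.
Proof.
move=> su sv z oz.
have c (f : R * R -> R^o) e : smooth_open odisc f -> {for z, continuous ('D_e f)}.
  by move=> sf; have [cf _] := sf [:: e] z oz.
by apply: cvgB; apply: cvgM; exact: c.
Qed.

Lemma jac_bound (k : R) (u v : R * R -> R^o) : 0 <= k ->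
  smooth_open odisc u -> smooth_open odisc v ->
  (forall z w, odisc z -> odisc w -> `|u z - u w| <= k * `|z - w|) ->
  (forall z w, odisc z -> odisc w -> `|v z - v w| <= k * `|z - w|) ->
  forall z, odisc z -> `|jac u v z| <= k * k + k * k.
Proof.
move=> k0 su sv lu lv z oz.
have n1 : `|e1| = 1 by rewrite prod_normE /= normr1 normr0 max_l.
have n2 : `|e2| = 1 by rewrite prod_normE /= normr1 normr0 max_r.
apply: le_trans (ler_normB _ _) _.
by apply: lerD; rewrite normrM; apply: ler_pM => //; exact: lipschitz_partial.
Qed.

(** The integrals over the discs of radius n / (n + 1) tend to the integral of the Jacobian by
    [radial_limit] and to the boundary term by [scalar_boundary], whose error is a multiple of 1 /
    (n + 1). *)
Lemma scalar_stokes (k : R) (u v : R * R -> R^o) (q p S dq dp : R -> R) : 0 <= k ->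
  smooth_open odisc u -> smooth_open odisc v ->
  (forall z w, odisc z -> odisc w -> `|u z - u w| <= k * `|z - w|) ->
  (forall z w, odisc z -> odisc w -> `|v z - v w| <= k * `|z - w|) ->
  (forall rho t, 0 <= rho < 1 -> 0 <= t <= 1 ->
    `|u (circle_at rho t) - q t| <= k * (1 - rho) /\
    `|v (circle_at rho t) - p t| <= k * (1 - rho)) ->
  {within `[0, 1], continuous q} -> {within `[0, 1], continuous p} ->
  {within `[0, 1], continuous S} ->
  (forall t : R, 0 < t < 1 -> [/\ is_derive t (1 : R) q (dq t), is_derive t (1 : R) p (dp t),
     is_derive t (1 : R) S (q t * dp t) & `|dq t| <= 2 * pi * k]) ->
  q 0 = q 1 -> p 0 = p 1 ->
  Rintegral mu2 (odisc : set plane) (jac u v) = S 1 - S 0.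
Proof.
move=> k0 su sv lu lv bd cq cp cS D q01 p01.
have L := radial_limit (jac_continuous su sv) (jac_bound k0 su sv lu lv).
set a := (X in X @ _ --> _) in L.
suff L' : a @ \oo --> S 1 - S 0.
  exact: (cvg_unique (@Rhausdorff R) L L').
have bound n : `|a n - (S 1 - S 0)| <= 4 * pi * k ^+ 2 * n.+1%:R^-1.
  have r01 : 0 <= (n%:R / n.+1%:R : R) < 1.
    by rewrite divr_ge0 //= ltr_pdivrMr // mul1r ltr_nat.
  have := scalar_boundary k0 su sv lv bd cq cp cS D q01 p01 r01.
  have -> : 1 - n%:R / n.+1%:R = n.+1%:R^-1 :> R.
    have h : (n.+1%:R : R) != 0 by rewrite pnatr_eq0.
    by apply: (mulIf h); rewrite mulrBl divfK // mulVf // mul1r -natr1 addrC addKr.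
  by [].
have lim0 : (4 * pi * k ^+ 2 * n.+1%:R^-1 : R) @[n --> \oo] --> (0 : R).
  by rewrite -(mulr0 (4 * pi * k ^+ 2)); apply: cvgM; [exact: cvg_cst|exact: cvg_harmonic].
apply/cvgrPdist_le => e e0; move/cvgrPdist_le : lim0 => /(_ e e0).
apply: filterS => n; rewrite sub0r normrN => h; rewrite distrC.
apply: le_trans (bound n) _; apply: le_trans h; exact: ler_norm.
Qed.

End stokes.

(** * Coordinates of phase space as linear forms *)

Section phase_coordinates.
Context {R : realType} {n : nat}.

Definition qc (i : 'I_n.+1) (w : phase R n) : R^o := w.1 ord0 i.
Definition pc (i : 'I_n.+1) (w : phase R n) : R^o := w.2 ord0 i.

Lemma qc_linear i : linear (qc i).
Proof. by move=> a u v; rewrite /qc /= !mxE. Qed.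
Lemma pc_linear i : linear (pc i).
Proof. by move=> a u v; rewrite /pc /= !mxE. Qed.

HB.instance Definition _ i :=
  GRing.isLinear.Build R (phase R n) R^o _ (qc i) (qc_linear i).
HB.instance Definition _ i :=
  GRing.isLinear.Build R (phase R n) R^o _ (pc i) (pc_linear i).

Lemma qc_continuous i : continuous (qc i).
Proof.
move=> w; apply: (@continuous_comp _ _ _ (fst : phase R n -> _) (fun v : 'rV[R]_n.+1 => v ord0 i)).
  exact: cvg_fst.
exact: coord_continuous.
Qed.
Lemma pc_continuous i : continuous (pc i).
Proof.
move=> w; apply: (@continuous_comp _ _ _ (snd : phase R n -> _) (fun v : 'rV[R]_n.+1 => v ord0 i)).
  exact: cvg_snd.
exact: coord_continuous.
Qed.

Lemma qc_norm i (w : phase R n) : `|qc i w| <= `|w|.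
Proof.
rewrite prod_normE le_max; apply/orP; left.
by rewrite [leRHS]/Num.norm /= mx_normrE; apply/bigmax_geP; right; exists (ord0, i).
Qed.
Lemma pc_norm i (w : phase R n) : `|pc i w| <= `|w|.
Proof.
rewrite prod_normE le_max; apply/orP; right.
by rewrite [leRHS]/Num.norm /= mx_normrE; apply/bigmax_geP; right; exists (ord0, i).
Qed.

End phase_coordinates.

(** * The symplectic area of a capping disc *)

Section stokes_discs.
Context {R : realType} {n : nat}.
Local Notation plane := (measurableTypeR R * measurableTypeR R)%type.
Local Notation mu := (@lebesgue_measure R).
Local Notation mu2 := (mu \x mu)%E.
Local Notation e1 := ((1, 0) : R * R).
Local Notation e2 := ((0, 1) : R * R).

Lemma iter_derive_linear (V W : normedModType R) (U : set V) (l : {linear W -> R^o})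
    (f : V -> W) (s : seq V) : open U -> continuous l -> smooth_open U f ->
  forall x, U x -> iter_derive s (fun y => l (f y) : R^o) x = l (iter_derive s f x).
Proof.
move=> oU cl sf; elim: s => [|v s IH] x Ux //=.
have [_ d] := sf s x Ux.
have [_ <-] := is_derive_lin cl (derivableP (d v)).
apply: near_eq_derive; have : \forall y \near x, U y by exact: open_nbhs_nbhs.
by apply: filterS => y; exact: IH.
Qed.

Lemma smooth_open_linear (V W : normedModType R) (U : set V) (l : {linear W -> R^o})
    (f : V -> W) : open U -> continuous l -> smooth_open U f ->
  smooth_open U (fun y => l (f y) : R^o).
Proof.
move=> oU cl sf s x Ux; have E := iter_derive_linear s oU cl sf.
have nU : \forall y \near x, U y by exact: open_nbhs_nbhs.
have [c d] := sf s x Ux; split=> [|v].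
  rewrite /prop_for /continuous_at E //.
  apply: cvg_trans (_ : (fun y => l (iter_derive s f y)) @ x --> _); last first.
    exact: (@continuous_comp _ _ _ (iter_derive s f) l x c (cl _)).
  by apply: near_eq_cvg; apply: filterS nU => y Uy; rewrite E.
apply: near_eq_derivable; last first.
  by have [D _] := is_derive_lin cl (derivableP (d v)); exact: D.
by apply: filterS nU => y Uy; rewrite E.
Qed.

Lemma circle_at_1 (t : R) : circle_at 1 t = (cos (2 * pi * t), sin (2 * pi * t)).
Proof. by rewrite /circle_at !mul1r. Qed.

Lemma disc_circle_at (rho t : R) : 0 <= rho <= 1 -> disc (circle_at rho t).
Proof.
move=> /andP[r0 r1]; rewrite /disc /circle_at /= !exprMn -mulrDr cos2Dsin2 mulr1.
exact: exprn_ile1.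
Qed.

Lemma Rintegral_sum (I : Type) (r : seq I) (F : I -> R * R -> R) :
  (forall i, mu2.-integrable (odisc : set plane) (EFin \o F i)) ->
  Rintegral mu2 (odisc : set plane) (fun z => \sum_(i <- r) F i z) =
    \sum_(i <- r) Rintegral mu2 (odisc : set plane) (F i).
Proof.
move=> iF; have [//] : Rintegral mu2 (odisc : set plane) (fun z => \sum_(i <- r) F i z) =
    \sum_(i <- r) Rintegral mu2 (odisc : set plane) (F i) /\
    mu2.-integrable (odisc : set plane) (EFin \o (fun z => \sum_(i <- r) F i z)).
elim: r => [|i r [IH1 IH2]].
  split; first by under eq_Rintegral do rewrite big_nil;
    rewrite big_nil Rintegral_cst ?mul0r //; exact: odisc_measurable.
  rewrite (_ : EFin \o _ = cst 0%:E); first exact: integrable0.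
  by apply/funext => z; rewrite /= big_nil.
have E : (fun z => \sum_(j <- i :: r) F j z) = (fun z => F i z + \sum_(j <- r) F j z).
  by apply/funext => z; rewrite big_cons.
rewrite E; split.
  by rewrite RintegralD ?IH1 ?big_cons //; exact: odisc_measurable.
pose G z := \sum_(j <- r) F j z.
have := @integrableD _ _ _ mu2 (odisc : set plane) (@odisc_measurable R) _ (EFin \o G) (iF i) IH2.
by [].
Qed.

(** The pull-back of [omega0] is the sum of the Jacobians of the pairs (q_i, p_i), to each of which
    the planar formula applies. The primitives [S i] of q_i p_i' are data, so that for explicit
    loops the area is read off from a closed formula. *)
Theorem symplectic_area_boundary (x : R -> phase R n) (xb : R * R -> phase R n)
    (S : 'I_n.+1 -> R -> R) :
  {within [set t | 0 <= t <= 1], continuous x} ->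
  (forall t : R, 0 < t < 1 -> derivable x t 1) -> x 0 = x 1 ->
  capping_disc x xb ->
  (forall i, {within `[0, 1], continuous (S i)}) ->
  (forall i (t : R), 0 < t < 1 ->
    is_derive t (1 : R) (S i) (qc i (x t) * pc i ('D_1 x t))) ->
  symplectic_area xb = \sum_i (S i 1 - S i 0).
Proof.
move=> cx dx x01 [[U [g [oU DU sg gE]]] [k0 lip0] bx] cS dS.
pose k := `|k0|; have k_ge0 : 0 <= k by exact: normr_ge0.
have lip z w : disc z -> disc w -> `|xb z - xb w| <= k * `|z - w|.
  by move=> dz dw; apply: le_trans (lip0 z w dz dw) _; rewrite ler_wpM2r // ler_norm.
have odU z : odisc z -> (disc `\ ((1, 0) : R * R)) z.
  move=> oz; split; first exact: odisc_sub.
  by move=> /= zE; move: oz; rewrite zE /odisc /= expr1n expr0n addr0 ltxx.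
have gxb z : odisc z -> g z = xb z by move=> /odU h; apply: gE; rewrite inE.
have near_gxb z : odisc z -> \forall w \near z, xb w = g w.
  move=> oz; have : \forall w \near z, odisc w.
    by apply: open_nbhs_nbhs; split; [exact: open_odisc|].
  by apply: filterS => w /gxb.
have sgo : smooth_open odisc g by move=> s z oz; apply: sg; exact/DU/odU.
pose u i := (fun z => qc i (g z) : R^o); pose v i := (fun z => pc i (g z) : R^o).
have su i : smooth_open odisc (u i).
  by apply: (smooth_open_linear (open_odisc) _ sgo); exact: qc_continuous.
have sv i : smooth_open odisc (v i).
  by apply: (smooth_open_linear (open_odisc) _ sgo); exact: pc_continuous.
have lu i z w : odisc z -> odisc w -> `|u i z - u i w| <= k * `|z - w|.
  move=> oz ow; rewrite /u -(raddfB (qc i)); apply: le_trans (qc_norm _ _) _.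
  by rewrite !gxb //; apply: lip; exact: odisc_sub.
have lv i z w : odisc z -> odisc w -> `|v i z - v i w| <= k * `|z - w|.
  move=> oz ow; rewrite /v -(raddfB (pc i)); apply: le_trans (pc_norm _ _) _.
  by rewrite !gxb //; apply: lip; exact: odisc_sub.
have bx' t : 0 <= t <= 1 -> x t = xb (circle_at 1 t) by move=> h; rewrite circle_at_1 bx.
(* The loop inherits a Lipschitz constant from the disc, which bounds the derivatives of its
   coordinates. *)
have lx s t : 0 <= s <= 1 -> 0 <= t <= 1 -> `|x s - x t| <= 2 * pi * k * `|s - t|.
  move=> hs ht; rewrite !bx' //.
  have h1 : 0 <= (1 : R) <= 1 by rewrite ler01 lexx.
  apply: le_trans (lip _ _ (disc_circle_at _ h1) (disc_circle_at _ h1)) _.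
  by rewrite [2 * pi * k]mulrC -mulrA; apply: ler_wpM2l => //; exact: circle_at_lipschitz.
have JE z : odisc z -> omega0 ('D_e1 xb z) ('D_e2 xb z) = \sum_i jac (u i) (v i) z.
  move=> oz; rewrite /omega0; apply: eq_bigr => i _.
  have De e : 'D_e xb z = 'D_e g z by apply: near_eq_derive; exact: near_gxb.
  have [_ d] := sgo [::] z oz.
  have Du e : 'D_e (u i) z = qc i ('D_e g z).
    by have [_ ->] := is_derive_lin (@qc_continuous R n i) (derivableP (d e)).
  have Dv e : 'D_e (v i) z = pc i ('D_e g z).
    by have [_ ->] := is_derive_lin (@pc_continuous R n i) (derivableP (d e)).
  by rewrite /jac !De !Du !Dv /qc /pc; congr (_ - _); rewrite mulrC.
transitivity (Rintegral mu2 (odisc : set plane) (fun z => \sum_i jac (u i) (v i) z)).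
  by apply: eq_Rintegral => z /set_mem oz; exact: JE.
rewrite Rintegral_sum; last first.
  move=> i; apply: continuous_odisc_integrable (jac_bound k_ge0 (su i) (sv i) (lu i) (lv i)).
  exact: jac_continuous.
apply: eq_bigr => i _.
have I01E : [set t : R | 0 <= t <= 1] = [set` `[0, 1]].
  by apply/seteqP; split=> t /=; rewrite in_itv.
have bd (rho t : R) : 0 <= rho < 1 -> 0 <= t <= 1 ->
    `|g (circle_at rho t) - x t| <= k * (1 - rho).
  move=> rho01 t01; rewrite gxb ?bx' //; last exact: circle_at_odisc.
  have h1 : 0 <= (1 : R) <= 1 by rewrite ler01 lexx.
  have h2 : 0 <= rho <= 1 by case/andP: rho01 => -> /ltW.
  apply: le_trans (lip _ _ (disc_circle_at _ h2) (disc_circle_at _ h1)) _.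
  by apply: ler_wpM2l => //; exact: circle_at_dist.
apply: (@scalar_stokes R k (u i) (v i) (fun t => qc i (x t)) (fun t => pc i (x t))
  (S i) (fun t => qc i ('D_1 x t)) (fun t => pc i ('D_1 x t))
  k_ge0 (su i) (sv i) (lu i) (lv i)).
- move=> rho t rho01 t01; split.
    rewrite /u -(raddfB (qc i)); apply: le_trans (qc_norm _ _) _; exact: bd.
  rewrite /v -(raddfB (pc i)); apply: le_trans (pc_norm _ _) _; exact: bd.
- rewrite -I01E; move=> t; exact: (cvg_comp x (qc i) (cx t) (@qc_continuous R n i (x t))).
- rewrite -I01E; move=> t; exact: (cvg_comp x (pc i) (cx t) (@pc_continuous R n i (x t))).
- exact: cS.
- move=> t t01; split.
  + exact: (is_derive_lin (@qc_continuous R n i) (derivableP (dx t t01))).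
  + exact: (is_derive_lin (@pc_continuous R n i) (derivableP (dx t t01))).
  + exact: dS.
  + have D1 := is_derive_lin (@qc_continuous R n i) (derivableP (dx t t01)).
    apply: (@derive_lipschitz R R^o (fun t => qc i (x t)) t 1 _ _ D1).
    have : \forall h \near (0 : R), `]0, 1[%classic (h *: (1 : R) + t).
      have c : {for (0 : R), continuous (fun h : R => h *: (1 : R) + t)}.
        by apply: cvgD; [apply: cvgZl; exact: cvg_id|exact: cvg_cst].
      apply: c; rewrite scale0r add0r; apply: open_nbhs_nbhs.
      by split; [exact: interval_open|rewrite /= in_itv].
    apply: filterS => h; rewrite /= in_itv /= => /andP[h0 h1].
    rewrite -(raddfB (qc i)); apply: le_trans (qc_norm _ _) _.
    have [t0 t1] := andP t01.
    apply: le_trans (lx _ _ _ _) _; rewrite ?(ltW h0) ?(ltW h1) ?(ltW t0) ?(ltW t1) //.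
    by rewrite addrK [h *: 1]mulr1.
- by rewrite x01.
- by rewrite x01.
Qed.

End stokes_discs.

(** * Cut-off functions with controlled height and slope *)

Section cutoffs.
Context {R : realType}.

(** [h] is the height and [m] bounds the steepness, which nearly attains m away from the ends. One
    of the two can be prescribed ([cut_slope], [cut_height]), and the last two fields then control
    the other one. [cut_convex] serves the tangent argument on the second half of the slope. *)
Record cut_spec (a b d m h : R) (P dP : R -> R) : Prop := CutSpec {
  cut_smooth : smooth1 P;
  cut_derive : forall s : R, is_derive s (1 : R) P (dP s);
  cut_l : forall s, s <= a -> P s = h;
  cut_r : forall s, b <= s -> P s = 0;
  cut_ge0 : forall s, 0 <= P s;
  cut_le : forall s, P s <= h;
  cut_gt0 : forall s, s < b -> 0 < P s;
  cut_nonincr : forall s t, s <= t -> P t <= P s;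
  cut_d0 : forall s, ~~ (a < s < b) -> dP s = 0;
  cut_dlt0 : forall s, a < s < b -> dP s < 0;
  cut_dge : forall s, - m <= dP s;
  cut_dmid : forall s, a + d <= s <= b - d -> dP s <= - ((1 - d) * m);
  cut_convex : forall s t, (a + b) / 2 <= s -> s <= t -> dP s <= dP t;
  cut_h_ge : m * ((1 - d) * (b - a - 2 * d)) <= h;
  cut_h_le : h <= m * (b - a) }.

Lemma cut_dle0 a b d m h P dP s : cut_spec a b d m h P dP -> dP s <= 0.
Proof.
move=> c; have [/(cut_dlt0 c)/ltW //|/(cut_d0 c) ->] := boolP (a < s < b).
exact: lexx.
Qed.

Lemma cut_slope (a b d m : R) : 0 < d < 1 -> 2 * d < b - a -> 0 < m ->
  exists h P dP, cut_spec a b d m h P dP.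
Proof.
move=> d01 dab m0; have [S [chi Sp]] := step_exists d01 dab.
have ab : a < b by case/andP: d01 => d0 d1; lra.
have Sa : S a = 0 by rewrite (step_left Sp).
have Sb x : S x <= S b.
  have [xb|/ltW bx] := leP x b; first exact: (step_homo Sp).
  by rewrite (step_right Sp bx).
have S0 x : 0 <= S x.
  have [xa|/ltW ax] := leP x a; first by rewrite (step_left Sp xa).
  by rewrite -Sa (step_homo Sp).
pose P s := m * (S b - S s); pose dP s := - (m * chi s).
have DP (s : R) : is_derive s (1 : R) P (dP s).
  have D1 := is_deriveB (is_derive_cst (S b) s 1) (step_derive Sp s).
  have D2 := @is_deriveZ R R R^o _ m s 1 _ D1.
  by apply: (is_derive_eq D2); rewrite sub0r /dP /GRing.scale /= mulrN.
exists (m * S b), P, dP; split => //.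
- have [dd dd0 ddS] := step_smooth Sp.
  have [dc dc0 dcS] := step_chi_smooth Sp.
  apply: (@smooth1_antiderivative _ P dP) => //.
  exists (fun n s => - m * dc n s); first by move=> s; rewrite dc0 mulNr.
  by move=> n x; exact: (@is_deriveZ R R R^o _ (- m) x 1 _ (dcS n x)).
- by move=> s sa; rewrite /P (step_left Sp sa) subr0.
- by move=> s bs; rewrite /P (step_right Sp bs) subrr mulr0.
- by move=> s; rewrite /P mulr_ge0 ?subr_ge0 // ltW.
- by move=> s; rewrite /P ler_pM2l // gerBl.
- by move=> s sb; rewrite /P mulr_gt0 // subr_gt0 (step_lt Sp).
- by move=> s t st; rewrite /P ler_pM2l // lerD2l lerN2 (step_homo Sp).
- move=> s h; rewrite /dP; have -> : chi s = 0; last by rewrite mulr0 oppr0.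
  by apply/eqP; rewrite eq_le (step_chi_ge0 Sp) andbT leNgt (step_chi_gt0 Sp).
- by move=> s h; rewrite /dP oppr_lt0 mulr_gt0 // (step_chi_gt0 Sp).
- by move=> s; rewrite /dP lerN2 ler_piMr ?(step_chi_le1 Sp) // ltW.
- move=> s h; rewrite /dP lerN2 mulrC ler_pM2l //; exact: (step_chi_mid Sp).
- by move=> s t h1 h2; rewrite /dP lerN2 ler_pM2l // (step_chi_homo Sp).
- by rewrite ler_pM2l // (step_total Sp).
- rewrite ler_pM2l // -[S b]subr0 -Sa -[leRHS]mul1r.
  by apply: (derive_ge (step_derive Sp)) => [|x _]; [exact: ltW|exact: (step_chi_le1 Sp)].
Qed.

Lemma cut_height (a b d h : R) : 0 < d < 1 -> 2 * d < b - a -> 0 < h ->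
  exists m P dP, 0 < m /\ cut_spec a b d m h P dP.
Proof.
move=> d01 dab h0; have [h1 [P [dP Pp]]] := cut_slope d01 dab ltr01.
have h1p : 0 < h1.
  apply: lt_le_trans (cut_h_ge Pp); rewrite mul1r; case/andP: d01 => d0 d1.
  by apply: mulr_gt0; lra.
have k0 : 0 < h / h1 by rewrite divr_gt0.
pose k := h / h1; have kh : k * h1 = h by rewrite /k divfK // gt_eqF.
exists k, (fun s => k * P s), (fun s => k * dP s); split => //; split.
- have [dd dd0 ddS] := cut_smooth Pp.
  exists (fun n s => k * dd n s); first by move=> s; rewrite dd0.
  by move=> n x; exact: (@is_deriveZ R R R^o _ k x 1 _ (ddS n x)).
- by move=> s; exact: (@is_deriveZ R R R^o _ k s 1 _ (cut_derive Pp s)).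
- by move=> s sa; rewrite (cut_l Pp sa).
- by move=> s sb; rewrite (cut_r Pp sb) mulr0.
- by move=> s; rewrite mulr_ge0 ?(cut_ge0 Pp) // ltW.
- by move=> s; rewrite -kh ler_pM2l // (cut_le Pp).
- by move=> s sb; rewrite mulr_gt0 // (cut_gt0 Pp).
- by move=> s t st; rewrite ler_pM2l // (cut_nonincr Pp).
- by move=> s H; rewrite (cut_d0 Pp H) mulr0.
- by move=> s H; rewrite pmulr_rlt0 // (cut_dlt0 Pp).
- move=> s; have := cut_dge Pp s; rewrite -(ler_pM2l k0) mulrN mulr1 //.
- move=> s H; have := cut_dmid Pp H; rewrite mulr1 -(ler_pM2l k0) mulrN.
  by rewrite [(1 - d) * k]mulrC.
- by move=> s t H1 H2; rewrite ler_pM2l // (cut_convex Pp).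
- by rewrite -kh ler_pM2l //; have := cut_h_ge Pp; rewrite mul1r.
- by rewrite -kh ler_pM2l //; have := cut_h_le Pp; rewrite mul1r.
Qed.

End cutoffs.

(** * Curves that rotate in each coordinate plane *)

Section rotations.
Context {R : realType} {n : nat}.
Implicit Types (x : R -> phase R n) (i : 'I_n.+1).

Lemma constant_on (f : R -> R) (s t : R) : {within `[s, t], continuous f} ->
  (forall r : R, s < r < t -> is_derive r (1 : R) f 0) ->
  forall r, s <= r <= t -> f r = f s.
Proof.
move=> cf df r /andP[sr rt]; apply/eqP; rewrite -subr_eq0; apply/eqP.
have [u| |c _ ->] := @MVT_segment R f (fun=> 0) s r sr.
- by rewrite in_itv /= => /andP[su ur]; apply: df; rewrite su (lt_le_trans ur).
- apply: continuous_subspaceW cf => u /=; rewrite !in_itv /= => /andP[-> ur].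
  exact: le_trans rt.
- by rewrite mul0r.
Qed.

(** The rotation is about (a, 0) in the first plane and about the origin in the others; a nonzero
    [a] occurs only for the displacing Hamiltonian. *)
Definition ctr (a : R) (i : 'I_n.+1) : R := if i == ord0 then a else 0.
Definition sqdist (a : R) (i : 'I_n.+1) (y : phase R n) : R :=
  (qc i y - ctr a i) ^+ 2 + pc i y ^+ 2.

Definition rotation (a : R) (w : 'I_n.+1 -> R -> R) (s t : R) x : Prop :=
  {within `[s, t], continuous x} /\
  forall i (r : R), s < r < t ->
    is_derive r (1 : R) (fun r => qc i (x r) : R) (- (w i r * pc i (x r))) /\
    is_derive r (1 : R) (fun r => pc i (x r) : R) (w i r * (qc i (x r) - ctr a i)).

Lemma trajectory_rotation (H : tham R n) (T : R) x a (w : 'I_n.+1 -> R -> R) (s t : R) :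
  trajectory H T x -> 0 <= s -> t <= T ->
  (forall r, s < r < t -> forall v : phase R n,
    'D_v (fun y : phase R n => H (r, y) : R^o) (x r) =
    \sum_i w i r * ((qc i (x r) - ctr a i) * qc i v + pc i (x r) * pc i v)) ->
  rotation a w s t x.
Proof.
move=> [cx ex] s0 tT D; split.
  apply: continuous_subspaceW cx => r /=; rewrite in_itv /= => /andP[sr rt].
  by rewrite (le_trans s0) // (le_trans rt).
move=> i r srt; have rT : 0 < r < T.
  by case/andP: srt => sr rt; rewrite (le_lt_trans s0) // (lt_le_trans rt).
have [dx eq] := ex r rT.
pose Qv : phase R n := (delta_mx ord0 i, 0); pose Pv : phase R n := (0, delta_mx ord0 i).
have qQ j : qc j Qv = (j == i)%:R by rewrite /qc /= mxE.
have pQ j : pc j Qv = 0 by rewrite /pc /= mxE.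
have qP j : qc j Pv = 0 by rewrite /qc /= mxE.
have pP j : pc j Pv = (j == i)%:R by rewrite /pc /= mxE.
have oE (X Y : phase R n) : omega0 X Y = \sum_j (qc j X * pc j Y - pc j X * qc j Y) by [].
have Dq := is_derive_lin (@qc_continuous R n i) (derivableP dx).
have Dp := is_derive_lin (@pc_continuous R n i) (derivableP dx).
have sumE (f : 'I_n.+1 -> R) : \sum_j f j * (j == i)%:R = f i.
  rewrite (bigD1 i) //= eqxx mulr1 big1 ?addr0 // => j /negbTE ->.
  by rewrite mulr0.
have E1 : qc i ('D_1 x r) = - (w i r * pc i (x r)).
  have := eq Pv; rewrite D // oE.
  under eq_bigr do rewrite pP qP mulr0 subr0.
  rewrite sumE => ->; congr (- _); rewrite -(sumE (fun j => w j r * pc j (x r))).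
  by apply: eq_bigr => j _; rewrite qP pP mulr0 add0r mulrA.
have E2 : pc i ('D_1 x r) = w i r * (qc i (x r) - ctr a i).
  have := eq Qv; rewrite D // oE.
  under eq_bigr do rewrite pQ qQ mulr0 sub0r.
  rewrite sumrN sumE => /oppr_inj ->.
  rewrite -(sumE (fun j => w j r * (qc j (x r) - ctr a j))).
  by apply: eq_bigr => j _; rewrite qQ pQ mulr0 addr0 mulrA.
by split; [exact: (is_derive_eq Dq E1)|exact: (is_derive_eq Dp E2)].
Qed.

Lemma rotation_within a w s t x : rotation a w s t x -> forall i,
  {within `[s, t], continuous (fun r => qc i (x r) : R)} /\
  {within `[s, t], continuous (fun r => pc i (x r) : R)}.
Proof.
move=> [cx _] i; split=> r.
  exact: (cvg_comp x (qc i) (cx r) (@qc_continuous R n i (x r))).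
exact: (cvg_comp x (pc i) (cx r) (@pc_continuous R n i (x r))).
Qed.

Lemma rotation_sqdist a w s t x : rotation a w s t x -> forall i r, s <= r <= t ->
  sqdist a i (x r) = sqdist a i (x s).
Proof.
move=> Rx i; have [cq cp] := rotation_within Rx i.
have E : (fun r => sqdist a i (x r)) = (fun r => (qc i (x r) - ctr a i) *
    (qc i (x r) - ctr a i) + (pc i (x r) : R) * pc i (x r)).
  by apply/funext => r; rewrite /sqdist !expr2.
apply: (@constant_on (fun r => sqdist a i (x r))); rewrite E.
  have cqa : {within `[s, t], continuous (fun r => qc i (x r) - ctr a i : R)}.
    by move=> r; apply: cvgB; [exact: cq|exact: cvg_cst].
  by move=> r; apply: cvgD; apply: cvgM; (exact: cqa || exact: cp).
move=> r srt; have [Dq Dp] := Rx.2 i r srt.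
have Dqa := is_deriveB Dq (is_derive_cst (ctr a i : R) r 1).
have D1 := @is_deriveM _ _ _ _ r 1 _ _ Dqa Dqa; have D2 := @is_deriveM _ _ _ _ r 1 _ _ Dp Dp.
apply: (is_derive_eq (is_deriveD D1 D2)).
by rewrite ?fctE /GRing.scale /= /cst; ring.
Qed.

(** The point turned back by the angle k_i (C(r) - C(s)) has derivative zero, hence stays where the
    curve was at time s. *)
Lemma rotation_solve a (k : 'I_n.+1 -> R) (C c : R -> R) s t x :
  rotation a (fun i r => k i * c r) s t x ->
  (forall r : R, is_derive r (1 : R) C (c r)) ->
  forall i r, s <= r <= t -> let th := k i * (C r - C s) in
  qc i (x r) - ctr a i = cos th * (qc i (x s) - ctr a i) - sin th * pc i (x s) /\
  pc i (x r) = sin th * (qc i (x s) - ctr a i) + cos th * pc i (x s).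
Proof.
move=> Rx DC i r0 srt0 th; have [cq cp] := rotation_within Rx i.
pose ph r := k i * (C r - C s).
have Dph (r : R) : is_derive r (1 : R) ph (k i * c r).
  have := @is_deriveZ R R R^o _ (k i) r 1 _ (is_deriveB (DC r) (is_derive_cst (C s) r 1)).
  by rewrite subr0.
have Dcos (r : R) : is_derive r (1 : R) (fun r => cos (ph r)) (- sin (ph r) * (k i * c r)).
  exact: is_derive_comp1.
have Dsin (r : R) : is_derive r (1 : R) (fun r => sin (ph r)) (cos (ph r) * (k i * c r)).
  exact: is_derive_comp1.
have cc : {within `[s, t], continuous (fun r => cos (ph r))}.
  apply: continuous_subspaceT => r; have [d _] := Dcos r.
  by apply/differentiable_continuous/derivable1_diffP.
have cs : {within `[s, t], continuous (fun r => sin (ph r))}.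
  apply: continuous_subspaceT => r; have [d _] := Dsin r.
  by apply/differentiable_continuous/derivable1_diffP.
have cqa : {within `[s, t], continuous (fun r => qc i (x r) - ctr a i : R)}.
  by move=> r; apply: cvgB; [exact: cq|exact: cvg_cst].
have ph0 : ph s = 0 by rewrite /ph subrr mulr0.
have E1 : cos th * (qc i (x r0) - ctr a i) + sin th * pc i (x r0) =
    qc i (x s) - ctr a i.
  have := @constant_on (fun r => cos (ph r) * (qc i (x r) - ctr a i) + sin (ph r) * pc i (x r)) s t.
  rewrite ph0 cos0 sin0 mul1r mul0r addr0 => H; apply: H; last exact: srt0.
    by move=> r; apply: cvgD; apply: cvgM; [exact: cc|exact: cqa|exact: cs|exact: cp].
  move=> r srt; have [Dq Dp] := Rx.2 i r srt.
  have Dqa := is_deriveB Dq (is_derive_cst (ctr a i : R) r 1).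
  have := is_deriveD (@is_deriveM _ _ _ _ r 1 _ _ (Dcos r) Dqa)
    (@is_deriveM _ _ _ _ r 1 _ _ (Dsin r) Dp).
  by move=> H; apply: (is_derive_eq H); rewrite ?fctE /GRing.scale /= /cst; ring.
have E2 : - sin th * (qc i (x r0) - ctr a i) + cos th * pc i (x r0) = pc i (x s).
  have := @constant_on (fun r => cos (ph r) * pc i (x r) - sin (ph r) * (qc i (x r) - ctr a i)) s t.
  rewrite ph0 cos0 sin0 mul1r mul0r subr0 => H.
  rewrite addrC mulNr; apply: H; last exact: srt0.
    by move=> r; apply: cvgB; apply: cvgM; [exact: cc|exact: cp|exact: cs|exact: cqa].
  move=> r srt; have [Dq Dp] := Rx.2 i r srt.
  have Dqa := is_deriveB Dq (is_derive_cst (ctr a i : R) r 1).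
  have := is_deriveB (@is_deriveM _ _ _ _ r 1 _ _ (Dcos r) Dp)
    (@is_deriveM _ _ _ _ r 1 _ _ (Dsin r) Dqa).
  by move=> H; apply: (is_derive_eq H); rewrite ?fctE /GRing.scale /= /cst; ring.
have cs2 := cos2Dsin2 th.
rewrite -E1 -E2; split.
  by rewrite -[LHS]mul1r -cs2; ring.
by rewrite -[LHS]mul1r -cs2; ring.
Qed.

Lemma rotation_area a (k : 'I_n.+1 -> R) (C c : R -> R) x xb :
  rotation a (fun i r => k i * c r) 0 1 x ->
  (forall r : R, 0 < r < 1 -> derivable x r 1) ->
  (forall r : R, is_derive r (1 : R) C (c r)) -> x 0 = x 1 -> capping_disc x xb ->
  symplectic_area xb = \sum_i k i * sqdist a i (x 0) / 2 * (C 1 - C 0).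
Proof.
move=> Rx dx DC x01 cap.
(* A primitive of q p': with a the centre, q p' = a p' + ((q - a) p)' / 2 + ((q - a) p' - q' p) / 2,
   and for a rotation the last term is k c / 2 times the squared distance to the centre, which is
   conserved. *)
pose S i r := ctr a i * pc i (x r) + (qc i (x r) - ctr a i) * pc i (x r) / 2
  + k i * sqdist a i (x 0) / 2 * C r.
have cx : {within [set t : R | 0 <= t <= 1], continuous x}.
  have -> : [set t : R | 0 <= t <= 1] = [set` `[0, 1]].
    by apply/seteqP; split=> t /=; rewrite in_itv.
  exact: Rx.1.
have cS i : {within `[0, 1], continuous (S i)}.
  have [cq cp] := rotation_within Rx i => r.
  apply: cvgD; first (apply: cvgD).
  + by apply: cvgM; [exact: cvg_cst|exact: cp].
  + apply: cvgM; last exact: cvg_cst.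
    by apply: cvgM; [apply: cvgB; [exact: cq|exact: cvg_cst]|exact: cp].
  + apply: cvgM; first exact: cvg_cst.
    by apply: continuous_subspaceT => u; exact: derive_continuous DC u.
have dS i (r : R) : 0 < r < 1 -> is_derive r (1 : R) (S i) (qc i (x r) * pc i ('D_1 x r)).
  move=> r01; have [Dq Dp] := Rx.2 i r r01.
  have -> : pc i ('D_1 x r) = k i * c r * (qc i (x r) - ctr a i).
    have [_ <-] := is_derive_lin (@pc_continuous R n i) (derivableP (dx r r01)).
    by have [_ ->] := Dp.
  have Dqa := is_deriveB Dq (is_derive_cst (ctr a i : R) r 1).
  have D1 := @is_deriveM _ _ _ _ r 1 _ _ (is_derive_cst (ctr a i : R) r 1) Dp.
  have D2 := @is_deriveM _ _ _ _ r 1 _ _ (@is_deriveM _ _ _ _ r 1 _ _ Dqa Dp)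
    (is_derive_cst (2^-1 : R) r 1).
  have D3 := @is_deriveM _ _ _ _ r 1 _ _
    (is_derive_cst (k i * sqdist a i (x 0) / 2 : R) r 1) (DC r).
  apply: (is_derive_eq (is_deriveD (is_deriveD D1 D2) D3)).
  have -> : sqdist a i (x 0) = sqdist a i (x r).
    by rewrite (rotation_sqdist Rx) //; case/andP: r01 => /ltW -> /ltW ->.
  by rewrite ?fctE /GRing.scale /= /cst /sqdist; field.
rewrite (symplectic_area_boundary cx dx x01 cap cS dS).
by apply: eq_bigr => i _; rewrite /S -x01; ring.
Qed.

End rotations.

(** * Hamiltonians that are functions of squared distances *)

Section toric.
Context {R : realType} {n : nat}.
Implicit Types (x : R -> phase R n) (i : 'I_n.+1) (y v : phase R n).
Local Notation mu := (@lebesgue_measure R).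

Lemma is_derive_sqdist a i y v : is_derive y v (sqdist a i : phase R n -> R^o)
  (2 * ((qc i y - ctr a i) * qc i v + pc i y * pc i v)).
Proof.
have Dq : is_derive y v (qc i) (qc i v) by exact: is_derive_linear.
have Dp : is_derive y v (pc i) (pc i v) by exact: is_derive_linear.
have Dqa := is_deriveB Dq (is_derive_cst (ctr a i : R^o) y v).
have D1 := @is_deriveM _ _ _ _ y v _ _ Dqa Dqa.
have D2 := @is_deriveM _ _ _ _ y v _ _ Dp Dp.
have -> : (sqdist a i : phase R n -> R^o) = (fun y => (qc i y - ctr a i) *
    (qc i y - ctr a i) + (pc i y : R) * pc i y).
  by apply/funext => z; rewrite /sqdist !expr2.
apply: (is_derive_eq (is_deriveD D1 D2)).
by rewrite ?fctE /GRing.scale /= /cst; ring.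
Qed.

Lemma smooth_sqdist a i : smoothT (sqdist a i : phase R n -> R^o).
Proof.
apply: smoothD; apply: smooth_exp; last exact: smooth_linear (@pc_continuous R n i).
by apply: smoothB; [exact: smooth_linear (@qc_continuous R n i)|exact: smooth_cst].
Qed.

Lemma sqdist_ge0 a i y : 0 <= sqdist a i y.
Proof. by rewrite addr_ge0 ?sqr_ge0. Qed.

(** [fr y i] is twice the derivative of [h] with respect to the squared distance in plane i, that
    is, the angular speed of the Hamiltonian flow in that plane. *)
Definition toric a (h : phase R n -> R) (fr : phase R n -> 'I_n.+1 -> R) : Prop :=
  (forall y v, is_derive y v (h : phase R n -> R^o)
    (\sum_i fr y i * ((qc i y - ctr a i) * qc i v + pc i y * pc i v))) /\
  (forall y y', (forall i, sqdist a i y = sqdist a i y') -> fr y = fr y' /\ h y = h y').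

(** A curve that rotates with variable speeds conserves the squared distances, and the frequencies
    depend only on these: they may be frozen at their value at time s. *)
Lemma toric_rotation a h fr (H : tham R n) (T s t : R) (c : R -> R) x :
  toric a h fr -> trajectory H T x -> 0 <= s -> t <= T ->
  (forall r, s < r < t -> forall y, H (r, y) = c r * h y) ->
  rotation a (fun i r => fr (x s) i * c r) s t x.
Proof.
move=> [Dh inv] tr s0 tT HE.
have Rx : rotation a (fun i r => c r * fr (x r) i) s t x.
  apply: trajectory_rotation tr s0 tT _ => r srt v.
  have -> : (fun y => H (r, y) : R^o) = (fun y => c r * h y).
    by apply/funext => y; exact: HE.
  have [_ ->] := @is_deriveZ _ _ R^o _ (c r) (x r) v _ (Dh (x r) v).
  by rewrite /GRing.scale /= mulr_sumr; apply: eq_bigr => i _; rewrite mulrA.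
split; first exact: Rx.1.
move=> i r srt; have Ei j : sqdist a j (x r) = sqdist a j (x s).
  by apply: (rotation_sqdist Rx); case/andP: srt => /ltW -> /ltW ->.
have [<- _] := inv _ _ Ei.
by have := Rx.2 i r srt; rewrite [c r * _]mulrC.
Qed.

Lemma rotation_closed a (k : 'I_n.+1 -> R) (C c : R -> R) (s t : R) x :
  s <= t -> rotation a (fun i r => k i * c r) s t x ->
  (forall r : R, is_derive r (1 : R) C (c r)) -> x s = x t ->
  forall i, sqdist a i (x s) = 0 \/ cos (k i * (C t - C s)) = 1.
Proof.
move=> st Rx DC xst i; have := rotation_solve Rx DC i (_ : s <= t <= t).
rewrite st lexx => /(_ isT) /=; rewrite -xst; set th := k i * _ => -[E1 E2].
(* The inner product of a vector with its difference to the rotated vector, which is zero for a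
   closed orbit. *)
have E : (1 - cos th) * sqdist a i (x s) = 0.
  rewrite /sqdist; set q := qc i _ - _ in E1 E2 *; set p := pc i _ in E1 E2 *.
  have -> : (1 - cos th) * (q ^+ 2 + p ^+ 2) = q * (q - (cos th * q - sin th * p)) +
     p * (p - (sin th * q + cos th * p)) by ring.
  by rewrite -E1 -E2 !subrr !mulr0 addr0.
move/eqP: E; rewrite mulf_eq0 => /orP[/eqP h|/eqP ->]; [right|by left].
by apply/eqP; rewrite eq_sym -subr_eq0 h.
Qed.

Lemma cos_eq1 (th : R) : 0 <= th -> cos th = 1 -> exists k : nat, th = 2 * pi * k%:R.
Proof.
move=> th0 c1; have pi0 := @pi_gt0 R; have p2 : 0 < 2 * pi :> R by rewrite mulr_gt0.
pose k := Num.truncn (th / (2 * pi)).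
have := truncn_itv (divr_ge0 th0 (ltW p2)); rewrite -/k => /andP[].
rewrite ler_pdivlMr // ltr_pdivrMr // => k1 k2.
exists k; pose ph := th - 2 * pi * k%:R.
have pE : (pi *+ 2) *+ k = 2 * pi * k%:R :> R by rewrite -[LHS]mulr_natr -[pi *+ 2]mulr_natl.
have E : th = ph + (pi *+ 2) *+ k by rewrite pE /ph subrK.
have cph : cos ph = 1.
  by rewrite -c1 E (periodicn (@cosD2pi R)).
have ph0 : 0 <= ph by rewrite /ph; nra.
have phlt : ph < 2 * pi by move: k2; rewrite -natr1 /ph; nra.
have s0 : sin (ph / 2) = 0.
  have h2 : ph / 2 *+ 2 = ph by rewrite mulr2n -splitr.
  have := cos_mulr2n (ph / 2); rewrite h2 cph cos2sin2 => H.
  by apply/eqP; rewrite -sqrf_eq0; apply/eqP; rewrite mulr2n in H; lra.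
have [phE|php] := eqVneq ph 0; first by rewrite E phE add0r pE.
have : 0 < sin (ph / 2).
  have phgt : 0 < ph by rewrite lt_def php.
  by apply: sin_gt0_pi; apply/andP; split; lra.
by rewrite s0 ltxx.
Qed.

Lemma cos_eq1_small (th : R) : `|th| < 2 * pi -> cos th = 1 -> th = 0.
Proof.
move=> th1; rewrite -cos_norm => /(cos_eq1 (normr_ge0 th)) [[|k]].
  by rewrite mulr0 => /normr0_eq0.
move=> E; move: th1; rewrite E -[ltRHS]mulr1 ltr_pM2l ?mulr_gt0 ?pi_gt0 //.
by rewrite ltNge ler1n.
Qed.

Lemma ftc_unit (C c : R -> R) : (forall r : R, is_derive r (1 : R) C (c r)) -> continuous c ->
  forall k, Rintegral mu I01 (fun t => c t * k) = (C 1 - C 0) * k.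
Proof.
move=> DC cc k; have -> : I01 = [set` `[0, 1]] :> set R.
  by apply/seteqP; split=> t /=; rewrite in_itv.
have D (t : R) : is_derive t (1 : R) (fun t => C t * k) (c t * k).
  have := @is_deriveM _ _ _ _ t 1 _ _ (DC t) (is_derive_cst k t 1).
  by rewrite /GRing.scale /= mulr0 add0r [k * _]mulrC.
rewrite /Rintegral (@continuous_FTC2 R (fun t => c t * k) (fun t => C t * k)) //=.
- by ring.
- by apply: continuous_subspaceT => t; apply: cvgM; [exact: cc|exact: cvg_cst].
- split; first by move=> t _; have [] := D t.
  + by apply: cvg_at_right_filter; exact: (derive_continuous D).
  + by apply: cvg_at_left_filter; exact: (derive_continuous D).
- by move=> t _; rewrite derive1E; have [_] := D t.
Qed.

(** A closed orbit turns in plane i by [fr y i] times the integral of c and sweeps out half this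
    angle times the squared distance. Since the integral is 1, c leaves no trace in the description
    of the actions. *)
Lemma toric_spectrum a h fr (H : tham R n) (C c : R -> R) (e : R) :
  toric a h fr -> (forall r : R, is_derive r (1 : R) C (c r)) -> continuous c ->
  C 1 - C 0 = 1 -> (forall t y, 0 <= t <= 1 -> H (t, y) = c t * h y) ->
  spectrum H e ->
  exists y : phase R n, (forall i, sqdist a i y = 0 \/ cos (fr y i) = 1) /\
    e = h y - \sum_i fr y i * sqdist a i y / 2.
Proof.
move=> tor DC cc C01 HE [x [xb [[tr x01 _] cap ->]]].
have Rx : rotation a (fun i r => fr (x 0) i * c r) 0 1 x.
  apply: (toric_rotation tor tr) => // r /andP[r0 r1] y.
  by apply: HE; rewrite !ltW.
exists (x 0); split.
  by move=> i; have := rotation_closed ler01 Rx DC x01 i; rewrite C01 mulr1.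
rewrite /action (rotation_area Rx _ DC x01 cap); last first.
  by move=> r r01; have [] := tr.2 r r01.
rewrite addrC; congr (_ - _); last by apply: eq_bigr => i _; rewrite C01 mulr1.
rewrite -[RHS]mul1r -C01 -(ftc_unit DC cc (h (x 0))).
apply: eq_Rintegral => t /set_mem It; rewrite HE //; congr (_ * _).
have Ei i : sqdist a i (x t) = sqdist a i (x 0) by exact: (rotation_sqdist Rx).
by have [_] := tor.2 _ _ Ei.
Qed.

(** The first plane is measured from the centre (a, 0), and all the other planes are lumped together
    in [wsq]. *)
Definition usq a y : R := sqdist a ord0 y.
Definition wsq y : R := \sum_(i | i != ord0) sqdist 0 i y.
Definition profile a (P Q : R -> R) y : R := P (usq a y) * Q (wsq y).
Definition profile_freq a (P dP Q dQ : R -> R) y i : R :=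
  if i == ord0 then 2 * dP (usq a y) * Q (wsq y) else 2 * P (usq a y) * dQ (wsq y).

Lemma sqdist_neq0 a i y : i != ord0 -> sqdist a i y = sqdist 0 i y.
Proof. by move=> /negbTE i0; rewrite /sqdist /ctr i0. Qed.

Lemma profile_toric a (P dP Q dQ : R -> R) :
  (forall s : R, is_derive s (1 : R) P (dP s)) -> (forall s : R, is_derive s (1 : R) Q (dQ s)) ->
  toric a (profile a P Q) (profile_freq a P dP Q dQ).
Proof.
move=> DP DQ; split=> [y v|y y' E]; last first.
  have Eu : usq a y = usq a y' by exact: E.
  have Ew : wsq y = wsq y'.
    by apply: eq_bigr => i i0; rewrite -(sqdist_neq0 a y i0) -(sqdist_neq0 a y' i0).
  by rewrite /profile Eu Ew; split => //; apply/funext => i; rewrite /profile_freq Eu Ew.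
have Du := is_derive_sqdist a ord0 y v.
have Dw : is_derive y v (wsq : phase R n -> R^o)
    (\sum_(i | i != ord0) 2 * ((qc i y - ctr 0 i) * qc i v + pc i y * pc i v)).
  have wE : wsq = \sum_(i < n.+1) (if i != ord0 then sqdist 0 i else cst 0) :> (phase R n -> R^o).
    apply/funext => z; rewrite fct_sumE /wsq big_mkcond /=.
    by apply: eq_bigr => i _; case: ifP.
  have DS (i : 'I_n.+1) : is_derive y v
      ((if i != ord0 then sqdist 0 i else cst 0) : phase R n -> R^o)
      (if i != ord0 then 2 * ((qc i y - ctr 0 i) * qc i v + pc i y * pc i v) else 0).
    by case: ifP => _; [exact: is_derive_sqdist|exact: is_derive_cst].
  by rewrite wE; apply: (is_derive_eq (is_derive_sum DS)); rewrite [RHS]big_mkcond.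
have D1 := @is_derive_comp1 _ _ P _ _ y v _ Du (DP _).
have D2 := @is_derive_comp1 _ _ Q _ _ y v _ Dw (DQ _).
apply: (is_derive_eq (@is_deriveM _ _ _ _ y v _ _ D1 D2)).
rewrite [RHS](bigD1 ord0) //= /profile_freq ?eqxx /GRing.scale /= addrC.
congr (_ + _); last by rewrite /usq; ring.
rewrite !mulr_sumr; apply: eq_bigr => i i0.
have -> : ctr 0 i = ctr a i :> R.
  by move/negbTE: i0; rewrite /ctr => ->.
by rewrite (negbTE i0) /usq; ring.
Qed.

Lemma profile_sum a (P dP Q dQ : R -> R) y :
  \sum_i profile_freq a P dP Q dQ y i * sqdist a i y / 2 =
  dP (usq a y) * Q (wsq y) * usq a y + P (usq a y) * dQ (wsq y) * wsq y.
Proof.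
rewrite (bigD1 ord0) //= /profile_freq ?eqxx; congr (_ + _); first by rewrite /usq; field.
rewrite {3}/wsq mulr_sumr; apply: eq_bigr => i i0.
by rewrite (negbTE i0) (sqdist_neq0 a y i0); field.
Qed.

Lemma usq_ge0 a y : 0 <= usq a y. Proof. exact: sqdist_ge0. Qed.
Lemma wsq_ge0 y : 0 <= wsq y. Proof. by apply: sumr_ge0 => i _; exact: sqdist_ge0. Qed.

Lemma smooth_wsq : smoothT (wsq : phase R n -> R^o).
Proof. by apply: smooth_sum => i; exact: smooth_sqdist. Qed.

Lemma smooth_profile a (P Q : R -> R) : smooth1 P -> smooth1 Q ->
  smoothT (profile a P Q : phase R n -> R^o).
Proof.
move=> sP sQ; apply: smoothM; apply: smooth_comp => //; first exact: smooth_sqdist.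
exact: smooth_wsq.
Qed.

End toric.

(** * Smoothness and compact supports of Hamiltonians *)

Section hamiltonians.
Context {R : realType} {n : nat}.
Implicit Types (i : 'I_n.+1) (y v : phase R n) (A K : set (phase R n)).
Local Notation mu := (@lebesgue_measure R).

Lemma Ck_fst (V1 V2 : normedModType R) (f : V1 -> R^o) k :
  Ck k f -> Ck k (fun z : V1 * V2 => f z.1).
Proof.
elim: k f => [|k IH] f [cf df].
  by split=> // z; apply: (@continuous_comp _ _ _ (fst : V1 * V2 -> V1) f);
    [exact: cvg_fst|exact: cf].
split=> [z|v].
  by apply: (@continuous_comp _ _ _ (fst : V1 * V2 -> V1) f); [exact: cvg_fst|exact: cf].
have [d1 d2] := df v.1; split=> [z|]; first exact: (d1 z.1).
exact: (IH _ d2).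
Qed.

Lemma Ck_snd (V1 V2 : normedModType R) (f : V2 -> R^o) k :
  Ck k f -> Ck k (fun z : V1 * V2 => f z.2).
Proof.
elim: k f => [|k IH] f [cf df].
  by split=> // z; apply: (@continuous_comp _ _ _ (snd : V1 * V2 -> V2) f);
    [exact: cvg_snd|exact: cf].
split=> [z|v].
  by apply: (@continuous_comp _ _ _ (snd : V1 * V2 -> V2) f); [exact: cvg_snd|exact: cf].
have [d1 d2] := df v.2; split=> [z|]; first exact: (d1 z.2).
exact: (IH _ d2).
Qed.

Lemma smooth1_Ck (c : R -> R) : smooth1 c -> smoothT (c : R^o -> R^o).
Proof. by move=> sc; apply: (@smooth_comp R R^o c id) => //; exact: smooth_id. Qed.

Lemma smooth_time (c : R -> R) : smooth1 c -> smoothT (fun z : R * phase R n => c z.1 : R^o).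
Proof. by move=> sc k; apply: (@Ck_fst R^o (phase R n) c); exact: smooth1_Ck. Qed.

Lemma smooth_space (h : phase R n -> R) : smoothT (h : phase R n -> R^o) ->
  smoothT (fun z : R * phase R n => h z.2 : R^o).
Proof. by move=> sh k; apply: (@Ck_snd R^o (phase R n) h). Qed.

Lemma compact_coordinates K (M : R) : closed K ->
  (forall y, K y -> forall i, `|qc i y| <= M /\ `|pc i y| <= M) -> compact K.
Proof.
move=> cK bK.
have cbox : compact [set v : 'rV[R]_n.+1 | forall i, `[-M, M]%classic (v ord0 i)].
  by apply: (@rV_compact R n.+1 (fun=> `[-M, M]%classic)) => i; exact: segment_compact.
apply: subclosed_compact (compact_setX cbox cbox) _ => // y Ky.
by split=> i; have [h1 h2] := bK y Ky i; rewrite /= in_itv /= -ler_norml.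
Qed.

Lemma closed_sublevel (f : phase R n -> R^o) (b : R) : smoothT f -> closed [set y | f y <= b].
Proof.
move=> sf; apply: (@closed_comp _ _ f [set x | x <= b]); last exact: closed_le.
by move=> y _; exact: smoothT_continuous.
Qed.

Lemma closed_unit_time : closed (I01 : set R).
Proof.
have -> : I01 = [set` `[0, 1]] :> set R by apply/seteqP; split=> t /=; rewrite in_itv.
exact: interval_closed.
Qed.

Lemma compact_unit_time : compact (I01 : set R).
Proof.
have -> : I01 = [set` `[0, 1]] :> set R by apply/seteqP; split=> t /=; rewrite in_itv.
exact: segment_compact.
Qed.

Lemma compact_phase_closed K : compact K -> closed K.
Proof. exact: (compact_closed (@norm_hausdorff R _)). Qed.

Lemma support_sub (H : tham R n) K : closed K ->
  (forall t y, I01 t -> ~ K y -> H (t, y) = 0) ->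
  support_in_I H `<=` I01 `*` K.
Proof.
move=> cK H0.
have cc : closed (I01 `*` K : set (R * phase R n)).
  apply: (@closedI _ (fst @^-1` I01) (snd @^-1` K)).
    by apply: closed_comp closed_unit_time => z _; exact: cvg_fst.
  by apply: closed_comp cK => z _; exact: cvg_snd.
rewrite /support_in_I [X in _ `<=` X](closure_id _).1 //; apply: closureS.
move=> [t y] /= [It /eqP h]; split=> //=.
by apply: contrapT => nK; apply: h; exact: H0.
Qed.

Lemma ham_intro A (H : tham R n) K : smooth_on [set z : R * phase R n | I01 z.1] (H : _ -> R^o) ->
  compact K -> K `<=` A° -> (forall t y, I01 t -> ~ K y -> H (t, y) = 0) -> ham A H.
Proof.
move=> sH cK KA H0; have sub := support_sub (compact_phase_closed cK) H0.
split=> //.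
  apply: subclosed_compact (compact_setX compact_unit_time cK) sub.
  exact: closed_closure.
by move=> z /sub [It Kz]; split => //; exact: KA.
Qed.

Lemma smoothT_smooth_on (H : tham R n) : smoothT (H : _ -> R^o) ->
  smooth_on [set z : R * phase R n | I01 z.1] (H : _ -> R^o).
Proof. by move=> sH; exists setT, H; split=> //; [exact: openT|exact: smoothT_open]. Qed.

Lemma smooth_openB (V : normedModType R) (U : set V) (f g : V -> R^o) : open U ->
  smooth_open U f -> smooth_open U g -> smooth_open U (fun x => f x - g x).
Proof.
move=> oU sf sg.
have E s : forall x, U x -> iter_derive s (fun x => f x - g x : R^o) x =
    iter_derive s f x - iter_derive s g x.
  elim: s => [|v s IH] x Ux //=.
  have [_ df] := sf s x Ux; have [_ dg] := sg s x Ux.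
  rewrite -(deriveB (df v) (dg v)); apply: near_eq_derive.
  have : \forall y \near x, U y by exact: open_nbhs_nbhs.
  by apply: filterS => y; exact: IH.
move=> s x Ux; have [cf df] := sf s x Ux; have [cg dg] := sg s x Ux.
have nU : \forall y \near x, U y by exact: open_nbhs_nbhs.
split=> [|v].
  rewrite /prop_for /continuous_at E //.
  have C : (iter_derive s f y - iter_derive s g y) @[y --> x] -->
      iter_derive s f x - iter_derive s g x by apply: cvgB; [exact: cf|exact: cg].
  apply: cvg_trans C.
  by apply: near_eq_cvg; apply: filterS nU => y Uy; rewrite E.
apply: near_eq_derivable; last exact: (derivableB (df v) (dg v)).
by apply: filterS nU => y Uy; rewrite E.
Qed.

Definition ham_space_support (H : tham R n) : set (phase R n) := snd @` support_in_I H.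

Lemma ham_space_support_compact A (H : tham R n) : ham A H -> compact (ham_space_support H).
Proof.
move=> [_ cH _]; apply: continuous_compact => //.
by apply: continuous_subspaceT => z; exact: cvg_snd.
Qed.

Lemma ham_space_support_sub A (H : tham R n) : ham A H -> ham_space_support H `<=` A°.
Proof. by move=> [_ _ sH] _ [z /sH [_ h] <-]. Qed.

Lemma ham_space_support0 (H : tham R n) t y : I01 t -> ~ ham_space_support H y -> H (t, y) = 0.
Proof.
move=> It h; apply: contrapT => /eqP H0; apply: h; exists (t, y) => //.
exact: subset_closure.
Qed.

Lemma hamB A (H L : tham R n) : ham A H -> ham A L -> ham A (fun z => H z - L z).
Proof.
move=> hH hL; apply: (@ham_intro _ _ (ham_space_support H `|` ham_space_support L)).
- have [[U [f [oU IU sf fE]]] _ _] := hH; have [[U' [g [oU' IU' sg gE]]] _ _] := hL.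
  exists (U `&` U'), (fun z => f z - g z); split.
  + exact: openI.
  + by move=> z Iz; split; [exact: IU|exact: IU'].
  + apply: smooth_openB; first exact: openI.
      by move=> s z [Uz _]; exact: sf.
    by move=> s z [_ Uz]; exact: sg.
  + by move=> z Iz; rewrite fE // gE.
- by apply: compactU; apply: ham_space_support_compact; [exact: hH|exact: hL].
- by move=> y [] h; [exact: (ham_space_support_sub hH)|exact: (ham_space_support_sub hL)].
- move=> t y It /not_orP [h1 h2].
  by rewrite !ham_space_support0 ?subrr.
Qed.

Lemma ham_mono A B (H : tham R n) : A `<=` B -> ham A H -> ham B H.
Proof.
by move=> AB [s c sub]; split=> // z /sub [It h]; split=> //; exact: interiorS h.
Qed.

Definition time_ham (c : R -> R) (h : phase R n -> R) : tham R n := fun z => c z.1 * h z.2.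

Lemma smooth_time_ham (c : R -> R) h : smooth1 c -> smoothT (h : phase R n -> R^o) ->
  smoothT (time_ham c h : _ -> R^o).
Proof. by move=> sc sh; apply: smoothM; [exact: smooth_time|exact: smooth_space]. Qed.

Definition profile_support (a b1 b2 : R) : set (phase R n) :=
  [set y | usq a y <= b1] `&` [set y | wsq y <= b2].

Lemma profile_support_compact a b1 b2 : compact (profile_support a b1 b2).
Proof.
have sq (x b : R) : x ^+ 2 <= b -> `|x| <= b + 1.
  by move=> h; rewrite ler_norml; apply/andP; split; nra.
apply: (@compact_coordinates _ (`|b1| + `|b2| + `|a| + 1)).
  by apply: closedI; apply: closed_sublevel; [exact: smooth_sqdist|exact: smooth_wsq].
move=> y [/= hu hw] i; have [->|i0] := eqVneq i ord0.
  have h1 : (qc ord0 y - a) ^+ 2 <= b1.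
    by apply: le_trans hu; rewrite /usq /sqdist /ctr eqxx lerDl sqr_ge0.
  have h2 : (pc ord0 y : R) ^+ 2 <= b1.
    by apply: le_trans hu; rewrite /usq /sqdist lerDr sqr_ge0.
  have B1 := ler_norm b1; have B2 := normr_ge0 b2; have B3 := normr_ge0 a.
  split; last by apply: le_trans (sq _ _ h2) _; lra.
  rewrite -(subrK a (qc ord0 y : R)); apply: le_trans (ler_normD _ _) _.
  by have := sq _ _ h1; lra.
have hi : sqdist 0 i y <= b2.
  by apply: le_trans hw; rewrite /wsq (bigD1 i) //= lerDl;
    apply: sumr_ge0 => j _; exact: sqdist_ge0.
have h1 : (qc i y : R) ^+ 2 <= b2.
  by apply: le_trans hi; rewrite /sqdist /ctr (negbTE i0) subr0 lerDl sqr_ge0.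
have h2 : (pc i y : R) ^+ 2 <= b2.
  by apply: le_trans hi; rewrite /sqdist lerDr sqr_ge0.
have B1 := ler_norm b2; have B2 := normr_ge0 b1; have B3 := normr_ge0 a.
by split; [apply: le_trans (sq _ _ h1) _|apply: le_trans (sq _ _ h2) _]; lra.
Qed.

Lemma profile_out a b1 b2 (P Q : R -> R) y : (forall s, b1 <= s -> P s = 0) ->
  (forall s, b2 <= s -> Q s = 0) -> ~ profile_support a b1 b2 y -> profile a P Q y = 0.
Proof.
move=> P0 Q0 /not_andP [] /negP; rewrite /= -ltNge => /ltW h; rewrite /profile.
  by rewrite P0 ?mul0r.
by rewrite Q0 ?mulr0.
Qed.

Lemma interior_setT_phase : (setT : set (phase R n))° = setT.
Proof. exact: interiorT. Qed.

End hamiltonians.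

(** * Explicit flows and their inverses *)

Section flows.
Context {R : realType} {n : nat}.
Implicit Types (x : R -> phase R n) (i : 'I_n.+1) (y v : phase R n).

Definition turn (a : R) (th : 'I_n.+1 -> R) y : phase R n :=
  (\row_i (ctr a i + (cos (th i) * (qc i y - ctr a i) - sin (th i) * pc i y)),
   \row_i (sin (th i) * (qc i y - ctr a i) + cos (th i) * pc i y)).

Lemma qc_turn a th y i :
  qc i (turn a th y) = ctr a i + (cos (th i) * (qc i y - ctr a i) - sin (th i) * pc i y).
Proof. by rewrite /qc /= mxE. Qed.

Lemma pc_turn a th y i :
  pc i (turn a th y) = sin (th i) * (qc i y - ctr a i) + cos (th i) * pc i y.
Proof. by rewrite /pc /= mxE. Qed.

Lemma phase_eq y y' : (forall i, qc i y = qc i y') -> (forall i, pc i y = pc i y') -> y = y'.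
Proof.
move=> hq hp; apply: injective_projections; apply/rowP => i; [exact: hq|exact: hp].
Qed.

Lemma turn_sqdist a th y i : sqdist a i (turn a th y) = sqdist a i y.
Proof.
rewrite /sqdist qc_turn pc_turn; set q := qc i y - _; set p := pc i y.
have := cos2Dsin2 (th i) => cs.
transitivity ((cos (th i) ^+ 2 + sin (th i) ^+ 2) * (q ^+ 2 + p ^+ 2)); first by ring.
by rewrite cs mul1r.
Qed.

Lemma turn_turn a th th' y : turn a th (turn a th' y) = turn a (fun i => th i + th' i) y.
Proof.
apply: phase_eq => i; rewrite !(qc_turn, pc_turn) cosD sinD; ring.
Qed.

Lemma turn0 a th y : (forall i, th i = 0) -> turn a th y = y.
Proof.
by move=> h; apply: phase_eq => i; rewrite (qc_turn, pc_turn) h cos0 sin0; ring.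
Qed.

Lemma is_derive_phase x (t : R) (dq dp : 'I_n.+1 -> R) :
  (forall i, is_derive t (1 : R) (fun s => qc i (x s) : R) (dq i)) ->
  (forall i, is_derive t (1 : R) (fun s => pc i (x s) : R) (dp i)) ->
  is_derive t (1 : R) x (\row_i dq i, \row_i dp i).
Proof.
move=> Hq Hp.
have D1 : derivable (fun s => (x s).1) t 1.
  by apply/derivable_mxP => i j; rewrite ord1; have [] := Hq j.
have D2 : derivable (fun s => (x s).2) t 1.
  by apply/derivable_mxP => i j; rewrite ord1; have [] := Hp j.
have E1 : 'D_1 (fun s => (x s).1) t = \row_i dq i.
  apply: etrans (derive_mx D1) _; apply/rowP => j; rewrite !mxE.
  by have [_] := Hq j.
have E2 : 'D_1 (fun s => (x s).2) t = \row_i dp i.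
  apply: etrans (derive_mx D2) _; apply/rowP => j; rewrite !mxE.
  by have [_] := Hp j.
have C : h^-1 *: (x (h *: 1 + t) - x t) @[h --> (0 : R)^'] -->
    ((\row_i dq i, \row_i dp i) : phase R n).
  by rewrite -E1 -E2; exact: (cvg_pair D1 D2).
by apply: DeriveDef; [exact: cvgP C|exact: (cvg_lim (@norm_hausdorff _ _) C)].
Qed.

(** Hamilton's equation at a single time, with the velocity written as an infinitesimal rotation.
    The centre may depend on t, as it does for a flow composed of rotations about two centres. *)
Definition turning_at (H : tham R n) x (t : R) : Prop := exists (a : R) (w : 'I_n.+1 -> R),
  [/\ forall i, is_derive t (1 : R) (fun s => qc i (x s) : R) (- (w i * pc i (x t))),
      forall i, is_derive t (1 : R) (fun s => pc i (x s) : R) (w i * (qc i (x t) - ctr a i)) &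
      forall v, 'D_v (fun y : phase R n => H (t, y) : R^o) (x t) =
        \sum_i w i * ((qc i (x t) - ctr a i) * qc i v + pc i (x t) * pc i v)].

Lemma turning_trajectory (H : tham R n) x T : (forall t, turning_at H x t) ->
  trajectory H T x.
Proof.
move=> Hx; split=> [|t _].
  apply: continuous_subspaceT => t; have [a [w [Dq Dp _]]] := Hx t.
  have [d _] := is_derive_phase Dq Dp.
  by apply: differentiable_continuous; apply/derivable1_diffP.
have [a [w [Dq Dp E]]] := Hx t; have [d ->] := is_derive_phase Dq Dp.
split=> // v; rewrite E -sumrN /omega0; apply: eq_bigr => i _.
by rewrite /= !mxE /qc /pc; ring.
Qed.

Lemma is_derive_turn a (k : 'I_n.+1 -> R) (C : R -> R) (t dC : R) y :
  is_derive t (1 : R) C dC -> let x s := turn a (fun i => k i * C s) y in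
  (forall i, is_derive t (1 : R) (fun s => qc i (x s) : R) (- (k i * dC * pc i (x t)))) /\
  (forall i, is_derive t (1 : R) (fun s => pc i (x s) : R) (k i * dC * (qc i (x t) - ctr a i))).
Proof.
move=> DC x.
have Dth i : is_derive t (1 : R) (fun s => k i * C s) (k i * dC).
  exact: (@is_deriveZ R R R^o _ (k i) t 1 _ DC).
have Dc i : is_derive t (1 : R) (fun s => cos (k i * C s)) (- sin (k i * C t) * (k i * dC)).
  exact: is_derive_comp1.
have Ds i : is_derive t (1 : R) (fun s => sin (k i * C s)) (cos (k i * C t) * (k i * dC)).
  exact: is_derive_comp1.
split=> i.
  have -> : (fun s => qc i (x s) : R) = (fun s => ctr a i +
      (cos (k i * C s) * (qc i y - ctr a i) - sin (k i * C s) * pc i y)).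
    by apply/funext => s; rewrite /x qc_turn.
  have D := is_deriveD (is_derive_cst (ctr a i) t 1) (is_deriveB
    (@is_deriveM _ _ _ _ t 1 _ _ (Dc i) (is_derive_cst (qc i y - ctr a i : R) t 1))
    (@is_deriveM _ _ _ _ t 1 _ _ (Ds i) (is_derive_cst (pc i y : R) t 1))).
  apply: (is_derive_eq D); rewrite /x pc_turn ?fctE /GRing.scale /= /cst; ring.
have -> : (fun s => pc i (x s) : R) = (fun s =>
    sin (k i * C s) * (qc i y - ctr a i) + cos (k i * C s) * pc i y).
  by apply/funext => s; rewrite /x pc_turn.
have D := is_deriveD
  (@is_deriveM _ _ _ _ t 1 _ _ (Ds i) (is_derive_cst (qc i y - ctr a i : R) t 1))
  (@is_deriveM _ _ _ _ t 1 _ _ (Dc i) (is_derive_cst (pc i y : R) t 1)).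
apply: (is_derive_eq D); rewrite /x qc_turn ?fctE /GRing.scale /= /cst; ring.
Qed.

Definition toric_flow (a : R) (fr : phase R n -> 'I_n.+1 -> R) (s : R) y :=
  turn a (fun i => fr y i * s) y.

Section toric_flow.
Variables (a : R) (h : phase R n -> R) (fr : phase R n -> 'I_n.+1 -> R).
Hypothesis tor : toric a h fr.

Lemma toric_flow_fr s y : fr (toric_flow a fr s y) = fr y.
Proof. by have [-> _] := tor.2 (toric_flow a fr s y) y (turn_sqdist a _ y). Qed.

Lemma toric_flow_h s y : h (toric_flow a fr s y) = h y.
Proof. by have [_ ->] := tor.2 (toric_flow a fr s y) y (turn_sqdist a _ y). Qed.

Lemma toric_flow0 y : toric_flow a fr 0 y = y.
Proof. by apply: turn0 => i; rewrite mulr0. Qed.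

Lemma toric_flowD s t y : toric_flow a fr s (toric_flow a fr t y) = toric_flow a fr (s + t) y.
Proof.
rewrite {1}/toric_flow toric_flow_fr turn_turn /toric_flow; congr (turn a _ y).
by apply/funext => i; rewrite mulrDr.
Qed.

Lemma toric_flowK s : cancel (toric_flow a fr s) (toric_flow a fr (- s)).
Proof. by move=> y; rewrite toric_flowD addNr toric_flow0. Qed.

Lemma toric_turning (H : tham R n) x (C : R -> R) (t dC : R) y :
  is_derive t (1 : R) C dC -> (\forall s \near t, x s = toric_flow a fr (C s) y) ->
  (forall y, H (t, y) = dC * h y) -> turning_at H x t.
Proof.
move=> DC Ex HE; exists a, (fun i => fr y i * dC).
have xt : x t = toric_flow a fr (C t) y by apply: (nbhs_singleton Ex).
have [Dq Dp] := @is_derive_turn a (fr y) C t dC y DC.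
split=> [i|i|v].
- rewrite xt; apply: near_eq_is_derive (Dq i).
  by apply: filterS Ex => s ->.
- rewrite xt; apply: near_eq_is_derive (Dp i).
  by apply: filterS Ex => s ->.
- have -> : (fun y => H (t, y) : R^o) = (fun y => dC * h y).
    by apply/funext => z; exact: HE.
  have [_ ->] := @is_deriveZ _ _ R^o _ dC (x t) v _ (tor.1 (x t) v).
  rewrite /GRing.scale /= mulr_sumr; apply: eq_bigr => i _.
  by rewrite xt toric_flow_fr mulrA [dC * _]mulrC.
Qed.

Lemma toric_is_inverse_flow (c C : R -> R) : (forall t : R, is_derive t (1 : R) C (c t)) ->
  C 0 = 0 -> is_inverse_flow (time_ham c h) (fun t => toric_flow a fr (- C t)).
Proof.
move=> DC C0; exists (fun t => toric_flow a fr (C t)).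
  move=> y; split; first by rewrite C0 toric_flow0.
  apply: turning_trajectory => t; apply: (toric_turning (DC t) (y := y)) => //.
  exact: filterE.
move=> t _; split; first exact: toric_flowK.
by move=> y; have := toric_flowK (- C t) y; rewrite opprK.
Qed.

End toric_flow.

(** The Hamiltonian [k] acts up to time r0 and [h] from time r1 on. Because r0 < r1, every time has
    a neighbourhood in which at most one of the two factors moves, and there the one-factor
    computation applies. *)
Lemma two_phase_is_inverse_flow (a b : R) (h k : phase R n -> R)
    (fr fk : phase R n -> 'I_n.+1 -> R) (c C d D : R -> R) (r0 r1 : R) :
  toric a h fr -> toric b k fk ->
  (forall t : R, is_derive t (1 : R) C (c t)) ->
  (forall t : R, is_derive t (1 : R) D (d t)) -> r0 < r1 ->
  (forall t, t <= r1 -> C t = 0) -> (forall t, t <= r1 -> c t = 0) ->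
  (forall t, r0 <= t -> D t = D r0) -> (forall t, r0 <= t -> d t = 0) -> 0 <= r1 -> D 0 = 0 ->
  is_inverse_flow (fun z => c z.1 * h z.2 + d z.1 * k z.2)
    (fun t y => toric_flow b fk (- D t) (toric_flow a fr (- C t) y)).
Proof.
move=> th tk DC DD r01 C0 c0 D1 d1 r1p D0.
exists (fun t y => toric_flow a fr (C t) (toric_flow b fk (D t) y)).
  move=> y; split; first by rewrite C0 // toric_flow0 D0 toric_flow0.
  apply: turning_trajectory => t; have [tr|rt] := ltP t r1.
    apply: (toric_turning tk (DD t) (y := y)).
      near=> s; have sr : s < r1 by near: s; exact: lt_nbhsl.
      by rewrite C0 ?ltW // toric_flow0.
    by move=> z /=; rewrite c0 ?ltW // mul0r add0r.
  have rt' : r0 < t by exact: lt_le_trans rt.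
  apply: (toric_turning th (DC t) (y := toric_flow b fk (D r0) y)).
    near=> s; have sr : r0 < s by near: s; exact: lt_nbhsr.
    by rewrite D1 // ltW.
  by move=> z /=; rewrite d1 ?ltW // mul0r addr0.
move=> t _; split=> y.
  by rewrite (toric_flowK th) (toric_flowK tk).
have := toric_flowK tk (- D t) (toric_flow a fr (- C t) y); rewrite opprK => ->.
by have := toric_flowK th (- C t) y; rewrite opprK.
Unshelve. all: by end_near.
Qed.

End flows.

(** * Radial Hamiltonians and the lower bound *)

Section lower_bound.
Context {R : realType} {n : nat}.
Implicit Types (i : 'I_n.+1) (y v : phase R n).

Lemma maxM_eq (f : phase R n -> R) (m : R) : (forall y, f y <= m) -> (exists y, f y = m) ->
  maxM f = m.
Proof.
move=> fm [y0 E]; apply/eqP; rewrite eq_le; apply/andP; split.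
  by apply: ge_sup; [exists m, y0|move=> _ [y _ <-]].
by apply: ub_le_sup; [exists m => _ [y _ <-]|exists y0].
Qed.

Lemma rotation_stationary a (k : 'I_n.+1 -> R) (C c : R -> R) (s t : R) (x : R -> phase R n) :
  rotation a (fun i r => k i * c r) s t x ->
  (forall r : R, is_derive r (1 : R) C (c r)) ->
  (forall i, sqdist a i (x s) = 0 \/ k i = 0) ->
  forall r, s <= r <= t -> x r = x s.
Proof.
move=> Rx DC st r srt.
have z0 y i : sqdist a i y = 0 -> qc i y = ctr a i /\ pc i y = 0.
  move/eqP; rewrite paddr_eq0 ?sqr_ge0 // !sqrf_eq0 subr_eq0 => /andP[/eqP h1 /eqP h2].
  by [].
apply: phase_eq => i; have [h|h] := st i.
- have h' := rotation_sqdist Rx i srt; rewrite h in h'.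
  by have [-> _] := z0 _ _ h; have [-> _] := z0 _ _ h'.
- have [E _] := rotation_solve Rx DC i srt.
  move: E; rewrite h mul0r cos0 sin0 mul1r mul0r subr0.
  by move/(congr1 (fun u => u + ctr a i)); rewrite !subrK.
- have h' := rotation_sqdist Rx i srt; rewrite h in h'.
  by have [_ ->] := z0 _ _ h; have [_ ->] := z0 _ _ h'.
- have [_ E] := rotation_solve Rx DC i srt.
  by move: E; rewrite h mul0r cos0 sin0 mul1r mul0r add0r.
Qed.

Definition sqnorm y : R := \sum_i sqdist 0 i y.

Lemma sqnormE y : sqnorm y = \sum_(i < n.+1) (y.1 ord0 i ^+ 2 + y.2 ord0 i ^+ 2).
Proof.
by apply: eq_bigr => i _; rewrite /sqdist /ctr; case: ifP => _; rewrite subr0.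
Qed.

Lemma smooth_sqnorm : smoothT (sqnorm : phase R n -> R^o).
Proof. by apply: smooth_sum => i; exact: smooth_sqdist. Qed.

Lemma radial_toric (P dP : R -> R) : (forall s : R, is_derive s (1 : R) P (dP s)) ->
  toric 0 (fun y => P (sqnorm y)) (fun y i => 2 * dP (sqnorm y)).
Proof.
move=> DP; split=> [y v|y y' E]; last first.
  have -> : sqnorm y = sqnorm y' by apply: eq_bigr => i _; exact: E.
  by [].
have DS : is_derive y v (sqnorm : phase R n -> R^o)
    (\sum_i 2 * ((qc i y - ctr 0 i) * qc i v + pc i y * pc i v)).
  have -> : sqnorm = \sum_(i < n.+1) sqdist 0 i :> (phase R n -> R^o).
    by apply/funext => z; rewrite fct_sumE.
  by apply: is_derive_sum => i; exact: is_derive_sqdist.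
apply: (is_derive_eq (@is_derive_comp1 _ _ P _ _ y v _ DS (DP _))).
by rewrite mulr_sumr; apply: eq_bigr => i _; ring.
Qed.

Lemma open_euclidean_ball (r : R) : open (euclidean_ball r : set (phase R n)).
Proof.
have -> : euclidean_ball r = [set y : phase R n | sqnorm y < r ^+ 2].
  by apply/seteqP; split=> y; rewrite /euclidean_ball /= sqnormE.
apply: (@open_comp _ _ (sqnorm : phase R n -> R^o) [set x | x < r ^+ 2]); last exact: open_lt.
by move=> y _; exact: (smoothT_continuous smooth_sqnorm).
Qed.

Lemma sqnorm_le_compact (b : R) : compact [set y | sqnorm y <= b].
Proof.
have sq (x c : R) : x ^+ 2 <= c -> `|x| <= c + 1.
  by move=> h; rewrite ler_norml; apply/andP; split; nra.
apply: (@compact_coordinates _ _ _ (b + 1)).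
  exact: (@closed_sublevel R n sqnorm b smooth_sqnorm).
move=> y /= hy i; have hi : y.1 ord0 i ^+ 2 + y.2 ord0 i ^+ 2 <= b.
  apply: le_trans hy; rewrite sqnormE (bigD1 i) //= lerDl.
  by apply: sumr_ge0 => j _; rewrite addr_ge0 ?sqr_ge0.
by split; apply: sq; apply: le_trans hi; rewrite ?lerDl ?lerDr sqr_ge0.
Qed.

Section radial.
Variables (r a b d m h : R) (P dP : R -> R).
Hypotheses (cut : cut_spec a b d m h P dP) (a0 : 0 < a) (br : b < r ^+ 2)
  (mpi : m < pi).
Let f y := P (sqnorm y).
Let tor := radial_toric (cut_derive cut).

Lemma sqnorm0 : sqnorm (0 : phase R n) = 0.
Proof.
by rewrite sqnormE big1 // => i _; rewrite /= mxE expr0n addr0.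
Qed.

Lemma radial_max : maxM f = h.
Proof.
apply: maxM_eq => [y|]; first exact: (cut_le cut).
by exists 0; rewrite /f sqnorm0 (cut_l cut) // ltW.
Qed.

Lemma radial_ham : ham_aut (euclidean_ball r) f.
Proof.
apply: (@ham_intro _ _ _ _ [set y | sqnorm y <= b]).
- apply: smoothT_smooth_on; apply: (@smooth_space R n f).
  by apply: smooth_comp; [exact: (cut_smooth cut)|exact: smooth_sqnorm].
- exact: sqnorm_le_compact.
- rewrite (interior_id _).1; last exact: open_euclidean_ball.
  by move=> y /= yb; rewrite /euclidean_ball /= -sqnormE (le_lt_trans yb).
- move=> t y _ /negP; rewrite /= -ltNge => /ltW yb.
  by rewrite /const_in_time /f /= (cut_r cut).
Qed.

Lemma radial_simple : simple (euclidean_ball r) f.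
Proof.
split; first exact: radial_ham.
- by move=> y; exact: (cut_ge0 cut).
- exists [set y | sqnorm y < a]; split.
  + apply: (@open_comp _ _ (sqnorm : phase R n -> R^o) [set x | x < a]); last exact: open_lt.
    by move=> y _; exact: (smoothT_continuous smooth_sqnorm).
  + by exists 0; rewrite /= sqnorm0.
  + by move=> y /= ya; rewrite radial_max /f (cut_l cut) // ltW.
have D y v : 'D_v (f : phase R n -> R^o) y =
    2 * dP (sqnorm y) * \sum_i ((qc i y - ctr 0 i) * qc i v + pc i y * pc i v).
  by have [_ ->] := tor.1 y v; rewrite mulr_sumr.
have crit y : dP (sqnorm y) = 0 -> forall v, 'D_v (f : phase R n -> R^o) y = 0.
  by move=> h0 v; rewrite D h0 mulr0 mul0r.
rewrite radial_max; apply/seteqP; split=> [_ [y /= cy <-]|e].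
  (* A critical point is tested on the direction y itself, where the derivative is 2 dP(s) s with s
     = [sqnorm y]: it vanishes only off the slope ]a, b[. *)
  have := cy y; rewrite D.
  have -> : \sum_i ((qc i y - ctr 0 i) * qc i y + pc i y * pc i y) = sqnorm y.
    by apply: eq_bigr => i _; rewrite /sqdist /ctr; case: ifP => _; rewrite !subr0 !expr2.
  have [ya _|ay] := leP (sqnorm y) a; first by right; rewrite /f (cut_l cut).
  have [yb|by_] := ltP (sqnorm y) b; last by left; rewrite /f (cut_r cut).
  have dneg : dP (sqnorm y) < 0 by apply: (cut_dlt0 cut); rewrite ay.
  by move/eqP; rewrite !mulf_eq0 (lt_eqF dneg) (gt_eqF (lt_trans a0 ay)) !orbF pnatr_eq0.
case=> ->.
(* The value 0 is critical because it is attained at a point on the boundary of the ball, outside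
   the support. *)
- have [y yE] : exists y : phase R n, sqnorm y = r ^+ 2.
    exists (\row_i (if i == ord0 then r else 0), 0); rewrite sqnormE (bigD1 ord0) //=.
    rewrite !mxE eqxx big1 ?expr0n ?addr0 // => i /negbTE i0.
    by rewrite !mxE i0 expr0n addr0.
  exists y; last by rewrite /f (cut_r cut) // yE ltW.
  by apply: crit; rewrite (cut_d0 cut) // yE (ltNge _ b) (ltW br) andbF.
- exists 0; last by rewrite /f sqnorm0 (cut_l cut) // ltW.
  by apply: crit; rewrite (cut_d0 cut) // sqnorm0 ltNge ltW.
Qed.

Lemma simple_mono (A B : set (phase R n)) g : A `<=` B -> simple A g -> simple B g.
Proof. by move=> AB [h1 h2 h3 h4]; split=> //; exact: ham_mono AB h1. Qed.

(** The angular speed is twice the slope in [sqnorm], hence smaller than 2 pi. In time T <= 1 no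
    full turn is possible, so a closed orbit off the origin has speed zero. *)
Lemma radial_admissible : HZ_admissible f.
Proof.
split; first exact: (simple_mono (@subsetT _ _) radial_simple).
move=> T x /andP[T0 T1] [tr x0T _] t t0T.
have Rx : rotation 0 (fun i (_ : R) => 2 * dP (sqnorm (x 0)) * 1) 0 T x.
  apply: (@toric_rotation _ _ _ _ _ _ T 0 T (fun=> 1) x tor tr) => // u _ y.
  by rewrite mul1r.
have Did (u : R) : is_derive u (1 : R) id (1 : R) by exact: is_derive_id.
apply: (rotation_stationary Rx Did) => // i.
have [h0|c1] := rotation_closed (ltW T0) Rx Did x0T i; [by left|right].
have dge := cut_dge cut (sqnorm (x 0)).
have dle := cut_dle0 (sqnorm (x 0)) cut.
have small : `|2 * dP (sqnorm (x 0)) * (id T - id 0)| < 2 * pi.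
  rewrite subr0 normrM (gtr0_norm T0) normrM ger0_norm // ler0_norm //.
  apply: le_lt_trans (_ : 2 * m * 1 < _); last by rewrite mulr1 ltr_pM2l.
  apply: ler_pM => //; first by rewrite mulr_ge0 // oppr_ge0.
    exact: ltW.
  by rewrite ler_pM2l // lerNl.
move/eqP: (cos_eq1_small small c1); rewrite subr0 /= mulf_eq0 (gt_eqF T0) orbF.
by move/eqP.
Qed.

End radial.

Lemma selector_lower_bound (sigma : tham R n -> R) (r e : R) :
  action_selector sigma -> 0 < r -> 0 < e ->
  exists2 f, simple (euclidean_ball r) f & pi * r ^+ 2 - e <= sigma (const_in_time f).
Proof.
move=> hs r0 e0; have pi0 := @pi_gt0 R.
have r2 : 0 < r ^+ 2 by rewrite exprn_gt0.
(* The height obtained is at least pi (1 - d)^2 (r^2 - 4 d), and [k] is its loss per unit of d to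
   first order. *)
pose k := pi * (4 + 2 * r ^+ 2); have k0 : 0 < k by rewrite mulr_gt0 //; lra.
pose d := Num.min (Num.min (r ^+ 2 / 8) (1 / 2)) (e / k).
have d0 : 0 < d by rewrite !lt_min !divr_gt0.
have [d1 d2] : d <= r ^+ 2 / 8 /\ d <= 1 / 2 by split; rewrite !ge_min lexx ?orbT.
have d3 : d * k <= e by rewrite -ler_pdivlMr // ge_min lexx orbT.
have d01 : 0 < d < 1 by rewrite d0; lra.
have dab : 2 * d < (r ^+ 2 - d) - d by lra.
have m0 : 0 < pi * (1 - d) by rewrite mulr_gt0 //; lra.
have [h [P [dP cut]]] := cut_slope d01 dab m0.
have br : r ^+ 2 - d < r ^+ 2 by lra.
have mpi : pi * (1 - d) < pi by rewrite gtr_pMr //; lra.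
exists (fun y => P (sqnorm y)); first exact: (radial_simple cut d0 br).
rewrite (sel_AS2plus hs (radial_admissible cut d0 br mpi)) (radial_max cut d0).
apply: le_trans (cut_h_ge cut).
rewrite -subr_ge0.
have -> : pi * (1 - d) * ((1 - d) * (r ^+ 2 - d - d - 2 * d)) - (pi * r ^+ 2 - e) =
  (e - d * k) + pi * (d * (8 * d) + d ^+ 2 * (r ^+ 2 - 4 * d)) by rewrite /k; ring.
by rewrite addr_ge0 ?subr_ge0 // mulr_ge0 ?(ltW pi0) // addr_ge0 // mulr_ge0 //;
  rewrite ?mulr_ge0 ?sqr_ge0 //; lra.
Qed.

End lower_bound.

(** * Bumps in time and the gap in the spectrum *)

Section upper_tools.
Context {R : realType} {n : nat}.
Implicit Types (i : 'I_n.+1) (y v : phase R n).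
Local Notation mu := (@lebesgue_measure R).

Lemma smooth1_scale (k : R) (P : R -> R) : smooth1 P -> smooth1 (fun s => k * P s).
Proof.
move=> [dd dd0 ddS]; exists (fun m s => k * dd m s); first by move=> s; rewrite dd0.
by move=> m x; exact: (@is_deriveZ R R R^o _ k x 1 _ (ddS m x)).
Qed.

Record bump_spec (a b M : R) (C c : R -> R) : Prop := BumpSpec {
  bump_smooth : smooth1 c;
  bump_derive : forall t : R, is_derive t (1 : R) C (c t);
  bump_l : forall t, t <= a -> C t = 0;
  bump_r : forall t, b <= t -> C t = 1;
  bump_dl : forall t, t <= a -> c t = 0;
  bump_dr : forall t, b <= t -> c t = 0;
  bump_ge0 : forall t, 0 <= c t;
  bump_le : forall t, c t <= M }.

Lemma bump_exists (a b : R) : a < b -> b - a <= 1 -> exists M C c, bump_spec a b M C c.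
Proof.
move=> ab ab1; have d01 : 0 < (b - a) / 4 < 1 by apply/andP; split; lra.
have dab : 2 * ((b - a) / 4) < b - a by lra.
have [S [chi Sp]] := step_exists d01 dab.
have Sa : S a = 0 by rewrite (step_left Sp).
have Sb : 0 < S b by rewrite -Sa (step_lt Sp).
have chi0 t : ~~ (a < t < b) -> chi t = 0.
  by move=> h; apply/eqP; rewrite eq_le (step_chi_ge0 Sp) andbT leNgt (step_chi_gt0 Sp).
exists (S b)^-1, (fun t => (S b)^-1 * S t), (fun t => (S b)^-1 * chi t); split.
- exact: smooth1_scale (step_chi_smooth Sp).
- by move=> t; exact: (@is_deriveZ R R R^o _ _ t 1 _ (step_derive Sp t)).
- by move=> t ta; rewrite (step_left Sp ta) mulr0.
- by move=> t tb; rewrite (step_right Sp tb) mulVf // gt_eqF.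
- by move=> t ta; rewrite chi0 ?mulr0 // ltNge ta.
- by move=> t tb; rewrite chi0 ?mulr0 // [t < b]ltNge tb andbF.
- by move=> t; rewrite mulr_ge0 ?(step_chi_ge0 Sp) // invr_ge0 ltW.
- by move=> t; rewrite ler_piMr ?(step_chi_le1 Sp) // invr_ge0 ltW.
Qed.

Lemma compact_upper (T : topologicalType) (A : set T) (f : T -> R) : compact A ->
  {within A, continuous f} -> exists M, forall a, A a -> f a <= M.
Proof.
move=> cA cf; have [->|A0] := eqVneq A set0; first by exists 0.
have [c _ H] := compact_EVT_max ((set0P A).1 A0) cA cf.
by exists (f c) => a Aa; apply: H; rewrite inE.
Qed.

Lemma compact_lt (T : topologicalType) (A : set T) (f : T -> R) (m : R) : compact A ->
  {within A, continuous f} -> (forall a, A a -> f a < m) ->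
  exists2 M, M < m & forall a, A a -> f a <= M.
Proof.
move=> cA cf fm; have [->|A0] := eqVneq A set0.
  by exists (m - 1); [rewrite gtrBl|].
have [c /set_mem Ac H] := compact_EVT_max ((set0P A).1 A0) cA cf.
by exists (f c); [exact: fm|move=> a Aa; apply: H; rewrite inE].
Qed.

Lemma ham_ext A (H K : tham R n) : ham A H ->
  (forall t y, I01 t -> K (t, y) = H (t, y)) -> ham A K.
Proof.
move=> [[U [g [oU IU sg gE]]] cH sH] E.
have SE : support_in_I K = support_in_I H.
  congr closure; apply/seteqP; split=> -[t y] /= [It h]; split=> //.
    by rewrite -E.
  by rewrite E.
split; [|by rewrite SE|by rewrite SE].
by exists U, g; split=> // -[t y] /[dup] /set_mem /= It Iz; rewrite gE // E.
Qed.

Lemma Eplus0 (L : tham R n) : (forall t y, I01 t -> L (t, y) <= 0) ->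
  (exists y, forall t, I01 t -> L (t, y) = 0) -> Eplus L = 0.
Proof.
move=> L0 [y yE]; rewrite /Eplus.
transitivity (Rintegral mu I01 (fun=> 0 : R)).
  apply: eq_Rintegral => t /set_mem It; apply: maxM_eq => [z|]; first exact: L0.
  by exists y; exact: yE.
have -> : I01 = [set` `[0, 1]] :> set R by apply/seteqP; split=> t /=; rewrite in_itv.
by rewrite Rintegral_cst ?mul0r //; exact: measurable_itv.
Qed.

Lemma constant_loop_area (x : R -> phase R n) xb : (forall t, 0 <= t <= 1 -> x t = x 0) ->
  capping_disc x xb -> symplectic_area xb = 0.
Proof.
move=> xc cap.
have near_c (t : R) : 0 < t < 1 -> \forall s \near t, x s = cst (x 0) s.
  move=> t01; have : \forall s \near t, `]0, 1[%classic s.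
    by apply: open_nbhs_nbhs; split; [exact: interval_open|rewrite /= in_itv].
  by apply: filterS => s /=; rewrite in_itv /= => /andP[/ltW s0 /ltW s1]; apply: xc; rewrite s0.
have D (t : R) : 0 < t < 1 -> is_derive t (1 : R) x 0.
  move=> t01; apply: near_eq_is_derive (is_derive_cst (x 0) t 1).
  by apply: filterS (near_c t t01) => s ->.
have cx : {within [set t : R | 0 <= t <= 1], continuous x}.
  have cc : {within [set t : R | 0 <= t <= 1], continuous (cst (x 0))}.
    by apply: continuous_subspaceT => t; exact: cvg_cst.
  by apply: (subspace_eq_continuous _ cc) => t /set_mem /= /xc.
have dx (t : R) : 0 < t < 1 -> derivable x t 1 by move=> /D [].
have x01 : x 0 = x 1 by rewrite [RHS]xc // ler01 lexx.
have cS (i : 'I_n.+1) : {within `[0, 1], continuous (cst 0 : R -> R)}.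
  by apply: continuous_subspaceT => t; exact: cvg_cst.
have dS i (t : R) : 0 < t < 1 ->
    is_derive t (1 : R) (cst 0 : R -> R) (qc i (x t) * pc i ('D_1 x t)).
  move=> t01; have [_ ->] := D t t01.
  have -> : pc i (0 : phase R n) = 0 by rewrite /pc /= mxE.
  by rewrite mulr0; exact: is_derive_cst.
rewrite (@symplectic_area_boundary R n x xb (fun _ => cst 0) cx dx x01 cap cS dS).
by rewrite big1 // => i _; rewrite subrr.
Qed.

(* A closed orbit winds k times in the first plane and l times in the others, and its
   action is F + pi (k u + l w): at least 2 pi r^2 if l > 0, at least 19/10 pi r^2 if
   k > 1, and equal to 0 or C if k = l = 0.  If k = 1 and l = 0, it is at least C al(mid)
   up to the midpoint of the slope; beyond it al is convex, so that the tangent of slope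
   - pi lies below the graph of C al, which vanishes at r^2, and e <= pi r^2. *)
Lemma spectral_gap (r rho L C d0 d1 m0 m1 : R) (al dal ga dga : R -> R) (y : phase R n) :
  0 < r -> 95 / 100 * r ^+ 2 <= rho -> 2 * r ^+ 2 <= L ->
  cut_spec rho (r ^+ 2) d0 m0 1 al dal -> cut_spec L (L + 1) d1 m1 1 ga dga ->
  0 < C -> 2 * pi * r ^+ 2 <= C -> 2 * pi * r ^+ 2 <= C * al ((rho + r ^+ 2) / 2) ->
  let fr := profile_freq 0 (fun s => C * al s) (fun s => C * dal s) ga dga in
  (forall i, sqdist 0 i y = 0 \/ cos (fr y i) = 1) ->
  let e := profile 0 (fun s => C * al s) ga y - \sum_i fr y i * sqdist 0 i y / 2 in
  e <= pi * r ^+ 2 \/ 19 / 10 * (pi * r ^+ 2) <= e.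
Proof.
move=> r0 rho_ge L_ge cal cga C0 C1 C2 fr cl e.
have pi0 := @pi_gt0 R; have r20 : 0 < r ^+ 2 by rewrite exprn_gt0.
have pr0 : 0 < pi * r ^+ 2 by rewrite mulr_gt0.
have rho0 : 0 < rho by lra.
set u := usq 0 y; set w := wsq y.
have u0 : 0 <= u by exact: usq_ge0.
have w0 : 0 <= w by exact: wsq_ge0.
have eE : e = C * al u * ga w + (- (C * dal u * ga w)) * u + (- (C * al u * dga w)) * w.
  by rewrite /e /fr profile_sum /profile -/u -/w; ring.
have alu0 := cut_ge0 cal u; have gaw0 := cut_ge0 cga w.
have A1 : 0 <= C * al u * ga w by rewrite !mulr_ge0 // ltW.
have A2 : 0 <= - (C * dal u * ga w).
  rewrite -mulNr -mulrN; apply: mulr_ge0 => //;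
    apply: mulr_ge0; [exact: ltW|by rewrite oppr_ge0; exact: cut_dle0 cal].
have A3 : 0 <= - (C * al u * dga w).
  rewrite -mulrN; apply: mulr_ge0; last by rewrite oppr_ge0; exact: cut_dle0 cga.
  by apply: mulr_ge0 => //; exact: ltW.
have quant (x : R) : 0 <= x -> cos (- (2 * x)) = 1 -> exists k : nat, x = pi * k%:R.
  move=> x0; rewrite cosN => c1; have [|k kE] := cos_eq1 _ c1; first by lra.
  by exists k; lra.
have qu : u = 0 \/ exists k : nat, - (C * dal u * ga w) = pi * k%:R.
  have [h|h] := cl ord0; [by left|right].
  apply: quant A2 _; rewrite -[RHS]h /fr /profile_freq eqxx -/u -/w; congr cos; ring.
have qw : w = 0 \/ exists k : nat, - (C * al u * dga w) = pi * k%:R.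
  have [/forallP h|] := boolP [forall i : 'I_n.+1, (i != ord0) ==> (sqdist 0 i y == 0)].
    left; rewrite /w /wsq big1 // => i i0.
    by have := h i; rewrite i0 => /eqP.
  rewrite negb_forall => /existsP [i]; rewrite negb_imply => /andP[i0 si].
  right; have [h|h] := cl i; first by rewrite h eqxx in si.
  apply: quant A3 _; rewrite -[RHS]h /fr /profile_freq (negbTE i0) -/u -/w; congr cos; ring.
have w_small : ga w = 0 \/ ga w = 1 \/ L <= w.
  have [wl|lw] := leP w L; first by right; left; rewrite (cut_l cga).
  by right; right; exact: ltW.
have [E3|[l lE]] : (- (C * al u * dga w)) * w = 0 \/
    exists l : nat, - (C * al u * dga w) = pi * l.+1%:R.
  case: qw => [->|[[|l] lE]]; [by left; rewrite mulr0|by left; rewrite lE mulr0 mul0r|].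
  by right; exists l.
  (* On the slope of [ga] the vanishing product forces [al u = 0], where every term of e vanishes.
     Off the slope [ga w] is 0 or 1. *)
  - have [galt|] := boolP (L < w < L + 1).
      have dg : dga w != 0 by rewrite lt_eqF // (cut_dlt0 cga).
      have : al u = 0 \/ w = 0.
        move/eqP: E3; rewrite mulf_eq0 oppr_eq0 !mulf_eq0 (negbTE dg) (gt_eqF C0) orbF /=.
        by move=> /orP[/eqP ->|/eqP ->]; [left|right].
      case=> [al0|w00]; last by move: galt; rewrite w00 => /andP[h _]; lra.
      left; have du : dal u = 0.
        apply: (cut_d0 cal); apply/negP => /andP[_ ur].
        by have := cut_gt0 cal ur; rewrite al0 ltxx.
      by rewrite eE al0 du !(mulr0, mul0r) oppr0 !(mul0r, addr0) ltW.
    move=> nw; have ga01 : ga w = 0 \/ ga w = 1.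
      have [wl|lw] := leP w L; first by right; rewrite (cut_l cga).
      move: nw; rewrite lw /= -leNgt => h; left; exact: (cut_r cga).
    rewrite E3 addr0 in eE; case: ga01 => gE.
      by left; rewrite eE gE !mulr0 oppr0 mul0r addr0 ltW.
    rewrite gE !mulr1 in eE qu A2 *.
    (* With [ga w = 1], the four cases are u = 0 and the winding numbers 0, 1 and at least 2 in the
       first plane. *)
    case: qu => [u00|[[|[|k]] kE]].
    + right; rewrite eE u00 mulr0 addr0 (cut_l cal) ?ltW // mulr1; lra.
    + move: kE; rewrite mulr0 => kE; rewrite kE mul0r addr0 in eE.
      have du : dal u = 0.
        by move/eqP: kE; rewrite oppr_eq0 mulf_eq0 (gt_eqF C0) /= => /eqP.
      have [ul|lu] := leP u rho.
        right; rewrite eE (cut_l cal) // mulr1; lra.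
      have ur : r ^+ 2 <= u.
        rewrite leNgt; apply/negP => ur.
        by have := cut_dlt0 cal (s := u); rewrite lu ur du ltxx => /(_ isT).
      by left; rewrite eE (cut_r cal) // mulr0 ltW.
    + rewrite mulr1 in kE; have lu : rho < u.
        rewrite ltNge; apply/negP => ul; move: kE; rewrite (cut_d0 cal); last by rewrite ltNge ul.
        by rewrite mulr0 oppr0 => h; lra.
      have ur : u < r ^+ 2.
        rewrite ltNge; apply/negP => ul; move: kE; rewrite (cut_d0 cal); last first.
          by rewrite [u < _]ltNge ul andbF.
        by rewrite mulr0 oppr0 => h; lra.
      have [um|mu_] := leP u ((rho + r ^+ 2) / 2).
        right; have := cut_nonincr cal um; rewrite -(ler_pM2l C0) => h.
        rewrite eE kE; have : 0 <= pi * u by rewrite mulr_ge0 // ltW.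
        by lra.
      left; rewrite eE kE.
      have := derive_le (cut_derive cal) (ltW ur) (m := dal u).
      rewrite (cut_r cal (lexx _)) => /(_ _) H.
      have {}H : dal u * (r ^+ 2 - u) <= 0 - al u.
        apply: H => z /andP[uz _]; apply: (cut_convex cal) => //; exact: ltW.
      have : C * al u <= C * (- (dal u * (r ^+ 2 - u))) by rewrite ler_pM2l //; lra.
      rewrite mulrN mulrA -mulNr kE; lra.
    + right; have lu : rho < u.
        rewrite ltNge; apply/negP => ul; move: kE; rewrite (cut_d0 cal); last by rewrite ltNge ul.
        rewrite mulr0 oppr0 => /esym/eqP; by rewrite mulf_eq0 pnatr_eq0 gt_eqF.
      have k2 : 2 <= k.+2%:R :> R by rewrite ler_nat.
      rewrite eE kE; have B1 : 2 * pi * u <= pi * k.+2%:R * u.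
        by apply: ler_wpM2r => //; rewrite mulrC ler_pM2l.
      (* Two windings at u > rho >= 95/100 r^2 give the threshold 19/10 pi r^2. *)
      have B2 : 2 * pi * (95 / 100 * r ^+ 2) <= 2 * pi * u.
        by rewrite ler_pM2l ?mulr_gt0 //; lra.
      have B3 : 0 <= C * al u by rewrite mulr_ge0 // ltW.
      by lra.
right; have lw : L < w.
  rewrite ltNge; apply/negP => wl; move: lE; rewrite (cut_d0 cga); last by rewrite ltNge wl.
  rewrite mulr0 oppr0 => /esym/eqP; by rewrite mulf_eq0 pnatr_eq0 gt_eqF.
have l1 : 1 <= l.+1%:R :> R by rewrite ler1n.
rewrite eE lE; have B1 : pi * w <= pi * l.+1%:R * w.
  by apply: ler_wpM2r => //; rewrite ler_pMr.
have B2 : pi * (2 * r ^+ 2) <= pi * w by rewrite ler_pM2l //; lra.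
have B3 : 0 <= (- (C * dal u * ga w)) * u by rewrite mulr_ge0.
by lra.
Qed.

End upper_tools.

(** * Displacement of the cylinder by a rotation about an outside point *)

Section displacement.
Context {R : realType} {n : nat}.
Implicit Types (i : 'I_n.+1) (y v : phase R n).

Lemma smooth1_continuous (c : R -> R) : smooth1 c -> continuous c.
Proof.
move=> [dd dd0 D]; have -> : c = dd 0%N by apply/funext => s; rewrite dd0.
exact: (derive_continuous (D 0%N)).
Qed.

Lemma cos_le0 (th : R) : pi / 2 <= th <= pi + pi / 2 -> cos th <= 0.
Proof.
move=> h; have -> : cos th = - cos (th - pi) by rewrite -{1}(subrK pi th) cosDpi.
by rewrite oppr_le0; apply: cos_ge0_pihalf; lra.
Qed.

(* The rotation about (- 3r/2, 0) moves the points of the disc of radius r by an angle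
   between pi/2 and pi, whereas the disc is seen from the centre of rotation under a
   smaller angle. *)
Lemma disc_displaced (r th q p q' p' : R) : 0 < r ->
  pi / 2 <= - th <= pi -> q ^+ 2 + p ^+ 2 < r ^+ 2 -> q' ^+ 2 + p' ^+ 2 < r ^+ 2 ->
  q' + 3 / 2 * r = cos th * (q + 3 / 2 * r) - sin th * p ->
  p' = sin th * (q + 3 / 2 * r) + cos th * p -> False.
Proof.
move=> r0 thb qp qp' E1 E2; have pi0 := @pi_gt0 R.
have ct : cos th <= 0 by rewrite -cosN; apply: cos_le0; lra.
(* As |s| + |t| <= sqrt 2 r < 3r/2, each point of the disc is seen from the centre of rotation at
   less than 45 degrees from the axis. Two such vectors have a positive inner product, against cos
   th <= 0. *)
have bound (s t : R) : s ^+ 2 + t ^+ 2 < r ^+ 2 -> `|t| < s + 3 / 2 * r.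
  move=> h; have h2 : (`|s| + `|t|) ^+ 2 < (3 / 2 * r) ^+ 2.
    have := sqr_ge0 (`|s| - `|t|); have := real_normK (num_real s); have := real_normK (num_real t).
    nra.
  have : `|s| + `|t| < 3 / 2 * r.
    by rewrite -(@ltr_pXn2r _ 2) // ?nnegrE ?addr_ge0 // mulr_ge0 // ltW.
  by have := ler_norm (- s); rewrite normrN; lra.
have B1 := bound _ _ qp; have B2 := bound _ _ qp'.
have E : (q' + 3 / 2 * r) * (q + 3 / 2 * r) + p' * p =
    cos th * ((q + 3 / 2 * r) ^+ 2 + p ^+ 2) by rewrite E1 E2; ring.
have : cos th * ((q + 3 / 2 * r) ^+ 2 + p ^+ 2) <= 0.
  by rewrite mulr_le0_ge0 // addr_ge0 ?sqr_ge0.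
rewrite leNgt => /negP; apply; rewrite -E.
have : `|p'| * `|p| < (q' + 3 / 2 * r) * (q + 3 / 2 * r) by apply: ltr_pM.
by have := ler_norm (- (p' * p)); rewrite normrN normrM; lra.
Qed.

Section spectrum.
Variables (r d m h b dg mg L M1 M2 : R) (P dP Q dQ f df g dgg C c D dd : R -> R).
Hypotheses (r0 : 0 < r) (DP : forall s : R, is_derive s (1 : R) P (dP s))
  (DQ : forall s : R, is_derive s (1 : R) Q (dQ s))
  (P0 : forall s, r ^+ 2 <= s -> P s = 0) (dP0 : forall s, r ^+ 2 <= s -> dP s = 0)
  (Q0 : forall s, L <= s -> Q s = 0) (dQ0 : forall s, L <= s -> dQ s = 0)
  (cf : cut_spec 0 (13 / 2 * r ^+ 2) d (28 / 100 * pi) h f df)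
  (dle : d <= 1 / 10) (dler : d <= r ^+ 2 / 5)
  (cg : cut_spec L b dg mg 1 g dgg) (hmg : h * mg < pi)
  (bD : bump_spec (1 / 6) (1 / 3) M1 D dd) (bC : bump_spec (2 / 3) (5 / 6) M2 C c).

Let aK : R := - (3 / 2 * r).
Let F := @profile R n 0 P Q.
Let K := @profile R n aK f g.
Let fF := @profile_freq R n 0 P dP Q dQ.
Let fK := @profile_freq R n aK f df g dgg.

(** In the first plane the speed is at most 2 * 28/100 pi. In the others it is at most 2 h mg, which
    is why the cut-off [g] has to be flat in proportion to the height h. *)
Lemma displaced_turn y i : `|fK y i| < 2 * pi.
Proof.
have pi0 := @pi_gt0 R.
rewrite /fK /profile_freq; case: ifP => _.
  have h1 := cut_dge cf (usq aK y); have h2 := cut_dle0 (usq aK y) cf.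
  have g0 := cut_ge0 cg (wsq y); have g1 := cut_le cg (wsq y).
  rewrite !normrM (ger0_norm g0) (ler0_norm h2) ger0_norm //.
  apply: le_lt_trans (_ : 2 * (28 / 100 * pi) * 1 < _); last by lra.
  by apply: ler_pM => //; [rewrite mulr_ge0 // oppr_ge0|rewrite ler_pM2l // lerNl].
have h1 := cut_dge cg (wsq y); have h2 := cut_dle0 (wsq y) cg.
have f0 := cut_ge0 cf (usq aK y); have f1 := cut_le cf (usq aK y).
rewrite !normrM (ger0_norm f0) (ler0_norm h2) ger0_norm //.
apply: le_lt_trans (_ : 2 * h * mg < _); last by rewrite -mulrA ltr_pM2l.
apply: ler_pM => //; [by rewrite mulr_ge0|by rewrite oppr_ge0|by rewrite ler_pM2l|by rewrite lerNl].
Qed.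

(** On [0, 1/2] the orbit is turned by K from y to y', and on [1/2, 1] by F from y' back to y. If y'
    lies in the region where F lives, so does y, because the second turn conserves [usq 0] and
    [wsq]; this contradicts [disc_displaced]. Otherwise F does not move y', so y = y', and the turn
    by K, of less than 2 pi, is trivial. *)
Lemma displaced_spectrum e : spectrum (fun z => c z.1 * F z.2 + dd z.1 * K z.2) e -> e <= h.
Proof.
have pi0 := @pi_gt0 R.
have torF : toric 0 F fF by exact: profile_toric.
have torK : toric aK K fK by exact: (profile_toric _ (cut_derive cf) (cut_derive cg)).
have DC := bump_derive bC; have DD := bump_derive bD.
move=> [x [xb [[tr x01 _] cap ->]]].
have R1 : rotation aK (fun i s => fK (x 0) i * dd s) 0 (1 / 2) x.
  apply: (toric_rotation torK tr) => //; first by lra.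
  move=> s /andP[s0 s1] y /=; rewrite (bump_dl bC) ?mul0r ?add0r //; lra.
have R2 : rotation 0 (fun i s => fF (x (1 / 2)) i * c s) (1 / 2) 1 x.
  apply: (toric_rotation torF tr) => //.
  move=> s /andP[s0 s1] y /=; rewrite (bump_dr bD) ?mul0r ?addr0 //; lra.
have D10 : D (1 / 2) - D 0 = 1.
  by rewrite (bump_r bD) ?(bump_l bD) ?subr0 //; lra.
set y' := x (1 / 2) in R2 *; set y := x 0 in R1 x01 *.
have half1 : 1 / 2 <= (1 : R) <= 1 by rewrite lexx andbT; lra.
have half0 : 0 <= (1 / 2 : R) <= 1 / 2 by rewrite lexx divr_ge0.
have Eu : usq 0 y = usq 0 y' by rewrite x01; exact: (rotation_sqdist R2 ord0 half1).
have Ew : wsq y = wsq y'.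
  by rewrite x01; apply: eq_bigr => i _; exact: (rotation_sqdist R2 i half1).
have [/andP[ur wL]|out] := boolP ((usq 0 y' < r ^+ 2) && (wsq y' < L)).
  exfalso; have [S1 S2] := rotation_solve R1 DD ord0 half0.
  move: S1 S2; rewrite D10 mulr1 /ctr eqxx /aK opprK -/y -/y'.
  have us z : usq 0 z = qc ord0 z ^+ 2 + pc ord0 z ^+ 2 by rewrite /usq /sqdist /ctr eqxx subr0.
  apply: disc_displaced => //; last first.
  - by rewrite -us.
  - by rewrite -us Eu.
  have -> : fK y ord0 = 2 * df (usq aK y).
    by rewrite /fK /profile_freq eqxx (cut_l cg) ?mulr1 // Ew ltW.
  have uK : usq aK y = usq 0 y + 3 * r * qc ord0 y + 9 / 4 * r ^+ 2.
    by rewrite us /usq /sqdist /ctr eqxx /aK; field.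
  have [q1 q2] : - r < qc ord0 y /\ qc ord0 y < r.
    have : `|qc ord0 y : R| < r.
      rewrite -(@ltr_pXn2r _ 2) // ?nnegrE ?ltW // real_normK ?num_real //.
      by apply: le_lt_trans ur; rewrite -Eu us lerDl sqr_ge0.
    by rewrite ltr_norml => /andP[].
  (* The distance from (- 3r/2, 0) to the disc ranges over [r/2, 5r/2]. Its square stays between
     r^2/5 and 63/10 r^2, at least d from the ends of [0, 13/2 r^2], where the slope of f is at
     least 9/10 * 28/100 pi; twice this is 504/1000 pi, more than pi/2. *)
  have uK1 : r ^+ 2 / 5 <= usq aK y.
    have : (qc ord0 y + 3 / 2 * r) ^+ 2 <= usq aK y.
      by rewrite /usq /sqdist /ctr eqxx /aK opprK lerDl sqr_ge0.
    by have : (r / 2) ^+ 2 <= (qc ord0 y + 3 / 2 * r) ^+ 2; [nra|nra].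
  have uK2 : usq aK y <= 63 / 10 * r ^+ 2 by rewrite uK Eu; nra.
  have := cut_dge cf (usq aK y).
  have : df (usq aK y) <= - ((1 - d) * (28 / 100 * pi)).
    have h5 := dler; apply: (cut_dmid cf).
    by rewrite add0r (le_trans dler uK1) (le_trans uK2) //; lra.
  have : (1 - 1 / 10) * (28 / 100 * pi) <= (1 - d) * (28 / 100 * pi).
    by rewrite ler_pM2r ?lerD2l ?lerN2 // mulr_gt0.
  by move=> h1 h2 h3; apply/andP; split; lra.
have fF0 i : fF y' i = 0.
  move: out; rewrite negb_and -!leNgt /fF /profile_freq => /orP[h1|h1].
    by rewrite P0 ?dP0 //; case: ifP; rewrite !mulr0 mul0r.
  by rewrite Q0 ?dQ0 //; case: ifP; rewrite !mulr0.
have F0 : F y' = 0.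
  move: out; rewrite negb_and -!leNgt /F /profile => /orP[h1|h1].
    by rewrite P0 ?mul0r.
  by rewrite Q0 ?mulr0.
have St2 := rotation_stationary R2 DC (fun i => or_intror (fF0 i)).
have yy' : y = y' by rewrite x01; exact: St2.
have St1 : forall s, 0 <= s <= 1 / 2 -> x s = y.
  apply: (rotation_stationary R1 DD) => i.
  have [h0|c1] := rotation_closed (proj1 (andP half0)) R1 DD yy' i; [by left|right].
  move: c1; rewrite D10 mulr1; apply: cos_eq1_small; exact: displaced_turn.
have xc (t : R) : 0 <= t <= 1 -> x t = x 0.
  move=> /andP[t0 t1]; have [th|th] := leP t (1 / 2); first by apply: St1; rewrite t0.
  by rewrite -/y yy'; apply: St2; rewrite (ltW th).
rewrite /action (constant_loop_area xc cap) oppr0 add0r.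
have -> : Rintegral lebesgue_measure I01
      (fun t => c (t, x t).1 * F (t, x t).2 + dd (t, x t).1 * K (t, x t).2) =
    Rintegral lebesgue_measure I01 (fun t => dd t * K y).
  by apply: eq_Rintegral => t /set_mem /xc -> /=; rewrite -/y {1}yy' F0 mulr0 add0r.
rewrite (ftc_unit DD (smooth1_continuous (bump_smooth bD))).
rewrite (bump_r bD) ?(bump_l bD) ?subr0 ?mul1r; [|lra..].
rewrite /K /profile -[leRHS]mulr1; apply: ler_pM;
  by [exact: (cut_ge0 cf)|exact: (cut_ge0 cg)|exact: (cut_le cf)|exact: (cut_le cg)].
Qed.

End spectrum.
End displacement.

(** * The upper bound for Hamiltonians supported in the cylinder *)

Section upper_bound.
Context {R : realType} {n : nat}.
Variable sigma : tham R n -> R.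
Hypothesis hs : action_selector sigma.
Implicit Types (i : 'I_n.+1) (y v : phase R n) (H : tham R n).

Lemma profile_ham a b1 b2 (c P Q : R -> R) : smooth1 c -> smooth1 P -> smooth1 Q ->
  (forall s, b1 <= s -> P s = 0) -> (forall s, b2 <= s -> Q s = 0) ->
  ham setT (time_ham c (profile a P Q) : tham R n).
Proof.
move=> sc sP sQ P0 Q0; apply: (@ham_intro _ _ _ _ (profile_support a b1 b2)).
- by apply: smoothT_smooth_on; apply: smooth_time_ham => //; exact: smooth_profile.
- exact: profile_support_compact.
- by rewrite interior_setT_phase.
- by move=> t y _ h; rewrite /time_ham /= (profile_out P0 Q0 h) mulr0.
Qed.

(** Supplies points outside the supports: a nonpositive Hamiltonian that vanishes there at all times
    has [Eplus] equal to 0. *)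
Lemma usq_surj (a b : R) : 0 <= b -> exists y, usq a y = b ^+ 2.
Proof.
move=> b0; exists (\row_i (if i == ord0 then a + b else 0), 0).
by rewrite /usq /sqdist /ctr /qc /pc /= !mxE eqxx expr0n addr0 addrAC subrr add0r.
Qed.

Lemma interior_cylinder (r : R) y : (cylinder r)° y -> usq 0 y < r ^+ 2.
Proof. by move=> /interior_subset; rewrite /cylinder /= /usq /sqdist /ctr eqxx subr0. Qed.

Lemma ham_bounded A H : ham A H -> exists M, forall t y, I01 t -> H (t, y) <= M.
Proof.
move=> hH; have [[U [g [oU IU sg gE]]] cH sH] := hH.
have cont : {within support_in_I H, continuous (H : _ -> R)}.
  have cg : {within support_in_I H, continuous (g : _ -> R)}.
    apply: continuous_in_subspaceT => z /set_mem /sH [Iz _].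
    by have [] := sg [::] z (IU _ Iz).
  apply: (subspace_eq_continuous _ cg) => z /set_mem /sH [Iz _].
  by apply: gE; rewrite inE.
have [M HM] := compact_upper cH cont.
exists (Num.max M 0) => t y It; rewrite le_max.
have [->|H0] := eqVneq (H (t, y)) 0; first by rewrite lexx orbT.
by rewrite HM //; exact: subset_closure.
Qed.

(** (AS5) is applied to h and H - h, which is nonpositive and vanishes at y0, so that its [Eplus] is
    0. The composition restores H: the flow conserves h, stands still on the support of H, and does
    not enter it from outside. *)
Lemma selector_le_toric A H (h : phase R n -> R) fr a : ham A H -> toric a h fr ->
  ham setT (time_ham (cst 1) h : tham R n) ->
  (forall t y, I01 t -> H (t, y) <= h y) ->
  (forall y, ham_space_support H y -> forall i, fr y i = 0) ->
  (exists2 y, ~ ham_space_support H y & h y = 0) ->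
  sigma H <= sigma (time_ham (cst 1) h).
Proof.
move=> hH tor hh Hh fr0 [y0 Sy0 hy0].
have hHT : ham setT H by exact: ham_mono (@subsetT _ _) hH.
have Did (u : R) : is_derive u (1 : R) id (1 : R) by exact: is_derive_id.
have inv := @toric_is_inverse_flow R n a h fr tor (cst 1) id Did (erefl _).
have := sel_AS5 hs hh (hamB hHT hh) inv.
rewrite (@Eplus0 R n (fun z => H z - time_ham (cst 1) h z)); first last.
- exists y0 => t It; rewrite (ham_space_support0 It Sy0) /time_ham /= hy0.
  by rewrite mulr0 subrr.
- by move=> t y It; rewrite /time_ham /= mul1r subr_le0 Hh.
rewrite addr0; apply: le_trans; rewrite le_eqVlt; apply/orP; left; apply/eqP.
have E t y : I01 t -> hash (time_ham (cst 1) h) (fun t => toric_flow a fr (- id t))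
    (fun z => H z - time_ham (cst 1) h z) (t, y) = H (t, y).
  move=> It; rewrite /hash /time_ham /= !mul1r (toric_flow_h tor) addrC subrK.
  have [f0|f0] := pselect (forall i, fr y i = 0).
    by rewrite /toric_flow turn0 // => i; rewrite f0 mul0r.
  rewrite !(ham_space_support0 It) //; first by move=> /fr0.
  by move=> /fr0; rewrite (toric_flow_fr tor).
by apply: (sel_ext hs) => //; [exact: ham_ext hHT E|move=> t y /E ->].
Qed.

Section displaced.
Variables (r d m h b dg mg L M1 M2 : R) (P dP Q dQ f df g dgg C c D dd : R -> R).
Hypotheses (r0 : 0 < r) (sP : smooth1 P) (sQ : smooth1 Q)
  (DP : forall s : R, is_derive s (1 : R) P (dP s))
  (DQ : forall s : R, is_derive s (1 : R) Q (dQ s))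
  (P0 : forall s, r ^+ 2 <= s -> P s = 0) (dP0 : forall s, r ^+ 2 <= s -> dP s = 0)
  (Q0 : forall s, L <= s -> Q s = 0) (dQ0 : forall s, L <= s -> dQ s = 0)
  (cf : cut_spec 0 (13 / 2 * r ^+ 2) d (28 / 100 * pi) h f df)
  (dle : d <= 1 / 10) (dler : d <= r ^+ 2 / 5)
  (cg : cut_spec L b dg mg 1 g dgg) (hmg : h * mg < pi)
  (bD : bump_spec (1 / 6) (1 / 3) M1 D dd) (bC : bump_spec (2 / 3) (5 / 6) M2 C c).

Let aK : R := - (3 / 2 * r).

(** c F is recovered from c F + d K by composing with - d K, whose [Eplus] is 0. The composition
    cancels d K: while d acts the flow is that of K, which conserves K, and afterwards d
    vanishes. *)
Lemma selector_displaced : sigma (time_ham c (profile 0 P Q)) <= h.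
Proof.
pose F := @profile R n 0 P Q; pose K := @profile R n aK f g.
pose G : tham R n := fun z => c z.1 * F z.2 + dd z.1 * K z.2.
have torF : toric 0 F (profile_freq 0 P dP Q dQ) by exact: profile_toric.
have torK : toric aK K (profile_freq aK f df g dgg).
  exact: (profile_toric _ (cut_derive cf) (cut_derive cg)).
have hF : ham setT (time_ham c F) by exact: profile_ham (bump_smooth bC) sP sQ P0 Q0.
have hK : ham setT (time_ham (fun t => -1 * dd t) K).
  apply: profile_ham (cut_smooth cf) (cut_smooth cg) (cut_r cf) (cut_r cg).
  exact: smooth1_scale (bump_smooth bD).
have hG : ham setT G.
  by apply: ham_ext (hamB hF hK) _ => t y _; rewrite /G /time_ham /=; ring.
have DC := bump_derive bC; have DD := bump_derive bD.
have inv : is_inverse_flow G (fun t y => toric_flow aK (profile_freq aK f df g dgg) (- D t)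
    (toric_flow 0 (profile_freq 0 P dP Q dQ) (- C t) y)).
  apply: (two_phase_is_inverse_flow torF torK DC DD (r0 := 1 / 3) (r1 := 2 / 3)).
  - lra.
  - exact: bump_l bC.
  - exact: bump_dl bC.
  - by move=> t h1; rewrite !(bump_r bD) ?lexx.
  - exact: bump_dr bD.
  - lra.
  - by rewrite (bump_l bD) //; lra.
apply: le_trans (displaced_spectrum r0 DP DQ P0 dP0 Q0 dQ0 cf dle dler cg hmg bD bC
  (sel_AS1 hs hG)).
have := sel_AS5 hs hG hK inv.
rewrite (@Eplus0 R n (time_ham (fun t => -1 * dd t) K)); first last.
(* At distance 3r from the centre the squared distance 9 r^2 exceeds 13/2 r^2, so K vanishes. *)
- have [y yE] := @usq_surj aK (3 * r) (mulr_ge0 (ler0n _ _) (ltW r0)).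
  exists y => t _; rewrite /time_ham /= /K /profile yE (cut_r cf) ?mul0r ?mulr0 //.
  by have := exprn_gt0 2 r0; nra.
- move=> t y _; rewrite /time_ham /= mulN1r mulNr oppr_le0 !mulr_ge0 //.
  + exact: bump_ge0 bD _.
  + exact: cut_ge0 cf _.
  + exact: cut_ge0 cg _.
rewrite addr0; apply: le_trans; rewrite le_eqVlt; apply/orP; left; apply/eqP.
have E t y : I01 t -> hash G (fun t y => toric_flow aK (profile_freq aK f df g dgg) (- D t)
    (toric_flow 0 (profile_freq 0 P dP Q dQ) (- C t) y)) (time_ham (fun t => -1 * dd t) K)
    (t, y) = time_ham c F (t, y).
  move=> It; rewrite /hash /time_ham /G /= (toric_flow_h torK).
  have [h1|h1] := leP t (1 / 2).
    by rewrite (bump_l bC) ?oppr0 ?toric_flow0; [ring|lra].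
  by rewrite (bump_dr bD); [ring|lra].
by apply: (sel_ext hs) => //; [exact: ham_ext hF E|move=> t y /E ->].
Qed.

End displaced.

Lemma selector_path_continuous (F : phase R n -> R) (c : R -> R) (M B : R) :
  (forall s : R, ham setT (time_ham (fun t => 1 - s + s * c t) F : tham R n)) ->
  (forall t, 0 <= c t <= M) -> (forall y, 0 <= F y <= B) ->
  continuous (fun s : R => sigma (time_ham (fun t => 1 - s + s * c t) F)).
Proof.
move=> hF cM FB s; apply/cvgrPdist_lt => e e0.
have [dl dl0 Hd] := sel_AS4 hs (hF s) e0.
have M0 : 0 <= M by case/andP: (cM 0) => h1 h2; exact: le_trans h1 h2.
have B0 : 0 <= B by case/andP: (FB 0) => h1 h2; exact: le_trans h1 h2.
pose k := (1 + M) * (B + 1); have k0 : 0 < k by apply: mulr_gt0; lra.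
have : \forall u \near s, `|s - u| < dl / k.
  exact: (@nbhsx_ballx R R s (dl / k) (divr_gt0 dl0 k0)).
apply: filterS => u su; apply: Hd; first exact: hF.
move=> t y _; rewrite /time_ham /= -mulrBl.
have -> : 1 - s + s * c t - (1 - u + u * c t) = (s - u) * (c t - 1) by ring.
rewrite !normrM; apply: le_trans (_ : dl / k * ((1 + M) * (B + 1)) <= _).
  rewrite -[leLHS]mulrA; apply: ler_pM => //; [exact: ltW|].
  have /andP[c0 c1] := cM t; have /andP[F0 F1] := FB y.
  apply: ler_pM => //.
    by rewrite ler_norml; apply/andP; split; lra.
  by rewrite ger0_norm //; lra.
by rewrite divfK ?gt_eqF.
Qed.

Lemma selector_upper_bound (r : R) H : 0 < r -> ham (cylinder r) H -> sigma H <= pi * r ^+ 2.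
Proof.
move=> r0 hH; have pi0 := @pi_gt0 R.
have r20 : 0 < r ^+ 2 by exact: exprn_gt0.
have pr0 : 0 < pi * r ^+ 2 by exact: mulr_gt0.
have cS := ham_space_support_compact hH.
have Sr y : ham_space_support H y -> usq 0 y < r ^+ 2.
  by move=> /(ham_space_support_sub hH); exact: interior_cylinder.
have cwithin (f : phase R n -> R^o) : smoothT f -> {within ham_space_support H, continuous f}.
  by move=> sf; apply: continuous_subspaceT => y; exact: smoothT_continuous.
have [rho1 rho1r Srho] := compact_lt cS (cwithin _ (smooth_sqdist 0 ord0)) Sr.
have [W SW] := compact_upper cS (cwithin _ smooth_wsq).
have [MH HMH] := ham_bounded hH.
(* F is constant on {u <= rho, w <= L}, which contains the support of H. The second arguments of the
   maxima are the lower bounds required by [spectral_gap]. *)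
pose rho := Num.max rho1 (95 / 100 * r ^+ 2); pose L := Num.max W (2 * r ^+ 2).
have rhor : rho < r ^+ 2 by rewrite gt_max rho1r; lra.
have rho_ge : 95 / 100 * r ^+ 2 <= rho by rewrite le_max lexx orbT.
have L_ge : 2 * r ^+ 2 <= L by rewrite le_max lexx orbT.
pose d0 := Num.min (1 / 2) ((r ^+ 2 - rho) / 4).
have d00 : 0 < d0 by rewrite lt_min !divr_gt0 // subr_gt0.
have [d0a d0b] : d0 <= 1 / 2 /\ d0 <= (r ^+ 2 - rho) / 4 by split; rewrite ge_min lexx ?orbT.
have d001 : 0 < d0 < 1 by rewrite d00; lra.
have d0ab : 2 * d0 < r ^+ 2 - rho by lra.
have [m0 [al [dal [_ cal]]]] := cut_height d001 d0ab ltr01.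
have d101 : 0 < (1 / 4 : R) < 1 by apply/andP; split; lra.
have d1ab : 2 * (1 / 4) < L + 1 - L by lra.
have [m1 [ga [dga [_ cga]]]] := cut_height d101 d1ab ltr01.
have almid : 0 < al ((rho + r ^+ 2) / 2) by apply: (cut_gt0 cal); lra.
(* The plateau has to dominate H, to exceed the gap itself, and to make F exceed the gap as far as
   the midpoint of its slope. *)
pose C := Num.max MH (Num.max (2 * pi * r ^+ 2) (2 * pi * r ^+ 2 / al ((rho + r ^+ 2) / 2))).
have C1 : 2 * pi * r ^+ 2 <= C by rewrite !le_max lexx orbT.
have C0 : 0 < C by apply: lt_le_trans C1; rewrite -mulrA mulr_gt0.
have C2 : 2 * pi * r ^+ 2 <= C * al ((rho + r ^+ 2) / 2).
  by rewrite -ler_pdivrMr // !le_max lexx !orbT.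
have C3 : MH <= C by rewrite le_max lexx.
have sP : smooth1 (fun s => C * al s) by exact: smooth1_scale (cut_smooth cal).
have sQ := cut_smooth cga.
have DP (s : R) : is_derive s (1 : R) (fun s => C * al s) (C * dal s).
  exact: (@is_deriveZ R R R^o _ C s 1 _ (cut_derive cal s)).
have DQ := cut_derive cga.
have P0 s : r ^+ 2 <= s -> C * al s = 0 by move=> h; rewrite (cut_r cal) ?mulr0.
have dP0 s : r ^+ 2 <= s -> C * dal s = 0.
  by move=> h; rewrite (cut_d0 cal) ?mulr0 // [s < _]ltNge h andbF.
have Q0 := cut_r cga.
have dQ0 s : L + 1 <= s -> dga s = 0.
  by move=> h; rewrite (cut_d0 cga) // [s < _]ltNge h andbF.
pose F := @profile R n 0 (fun s => C * al s) ga.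
pose fr := @profile_freq R n 0 (fun s => C * al s) (fun s => C * dal s) ga dga.
have tor : toric 0 F fr by exact: profile_toric.
have hF (c : R -> R) : smooth1 c -> ham setT (time_ham c F : tham R n).
  by move=> sc; exact: profile_ham sc sP sQ P0 Q0.
have F0 y : 0 <= F y.
  by rewrite /F /profile !mulr_ge0 ?(ltW C0) ?(cut_ge0 cal) ?(cut_ge0 cga).
have F1 y : F y <= C.
  rewrite /F /profile -[leRHS]mulr1 -mulrA ler_pM2l //.
  by apply: mulr_ile1; [exact: cut_ge0 cal _|exact: cut_ge0 cga _|
    exact: cut_le cal _|exact: cut_le cga _].
have smooth_cst1 (s : R) : smooth1 (cst s : R -> R).
  by apply: smooth1_smoothT; exact: smooth_cst.
have HF : sigma H <= sigma (time_ham (cst 1) F).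
  have Sy y : ham_space_support H y -> usq 0 y <= rho /\ wsq y <= L.
    move=> Sy; split; rewrite le_max; [by rewrite (Srho y Sy)|by rewrite (SW y Sy)].
  apply: (selector_le_toric hH tor).
  - exact: hF.
  - move=> t y It; have [/Sy [h1 h2]|Sy'] := pselect (ham_space_support H y).
      rewrite /F /profile (cut_l cal) // (cut_l cga) // !mulr1.
      exact: le_trans (HMH t y It) C3.
    by rewrite (ham_space_support0 It Sy').
  - move=> y /Sy [h1 h2] i; rewrite /fr /profile_freq; case: ifP => _.
      by rewrite (cut_d0 cal) ?mulr0 ?mul0r // ltNge h1.
    by rewrite (cut_d0 cga) ?mulr0 // ltNge h2.
  - have [y yE] := @usq_surj 0 r (ltW r0); exists y.
      by move=> /Sr; rewrite yE ltxx.
    by rewrite /F /profile yE P0 // mul0r.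
apply: le_trans HF _.
have b1 : 1 / 6 < (1 / 3 : R) by lra.
have b2 : 1 / 3 - 1 / 6 <= (1 : R) by lra.
have b3 : 2 / 3 < (5 / 6 : R) by lra.
have b4 : 5 / 6 - 2 / 3 <= (1 : R) by lra.
have [M1 [D [dd bD]]] := bump_exists b1 b2.
have [M2 [Cc [c bC]]] := bump_exists b3 b4.
have scs (s : R) : smooth1 (fun t => 1 - s + s * c t).
  have -> : (fun t => 1 - s + s * c t) = (fun t => 1 - s - (- s) * c t).
    by apply/funext => t; ring.
  apply: smooth1_smoothT; apply: smoothB; first exact: smooth_cst.
  by apply: smooth1_Ck; exact: smooth1_scale (bump_smooth bC).
(* The weights 1 - s + s c(t) lead from the constant 1 to c and have integral 1 for every s. *)
pose phi (s : R) := sigma (time_ham (fun t => 1 - s + s * c t) F).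
have cphi : continuous phi.
  apply: (@selector_path_continuous F c M2 C) => [s|t|y].
  - exact: hF.
  - by rewrite (bump_ge0 bC) (bump_le bC).
  - by rewrite F0 F1.
have gap s : phi s <= pi * r ^+ 2 \/ 19 / 10 * (pi * r ^+ 2) <= phi s.
  have DCs (t : R) : is_derive t (1 : R) (fun t => (1 - s) * t + s * Cc t) (1 - s + s * c t).
    have D1 := @is_deriveZ R R R^o _ (1 - s) t 1 _ (is_derive_id t 1).
    have D2 := @is_deriveZ R R R^o _ s t 1 _ (bump_derive bC t).
    by apply: (is_derive_eq (is_deriveD D1 D2)); rewrite /GRing.scale /= mulr1.
  have [|||y [cl E]] := toric_spectrum tor DCs _ _ _ (sel_AS1 hs (hF _ (scs s))).
  - exact: smooth1_continuous.
  - by rewrite (bump_r bC) ?(bump_l bC); [ring|lra..].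
  - by [].
  rewrite /phi E; exact: (spectral_gap r0 rho_ge L_ge cal cga C0 C1 C2 cl).
have phi1 : phi 1 <= 182 / 100 * (pi * r ^+ 2).
  pose d := Num.min (1 / 10) (r ^+ 2 / 5).
  have d_gt0 : 0 < d by rewrite lt_min !divr_gt0.
  have [da db] : d <= 1 / 10 /\ d <= r ^+ 2 / 5 by split; rewrite ge_min lexx ?orbT.
  have dd01 : 0 < d < 1 by rewrite d_gt0; lra.
  have dab : 2 * d < 13 / 2 * r ^+ 2 - 0 by lra.
  have mp : 0 < 28 / 100 * pi :> R by rewrite mulr_gt0.
  have [h [f [df cf]]] := cut_slope dd01 dab mp.
  have h0 : 0 < h.
    by rewrite -(cut_l cf (lexx 0)); apply: (cut_gt0 cf); rewrite mulr_gt0.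
  have hE : h = h / pi * pi by rewrite divfK // gt_eqF.
  have W0 : 0 < h / pi by rewrite divr_gt0.
  have e01 : 0 < (1 / 2 : R) < 1 by apply/andP; split; lra.
  (* The width 2 + 4 w with w = h / pi makes [g] flat enough: [cut_h_ge] with d = 1/2 reads mg (1/2
     + 2 w) <= 1, so that mg w < 1/2 and h mg < pi. *)
  have eab : 2 * (1 / 2) < L + 1 + (2 + 4 * (h / pi)) - (L + 1) by lra.
  have [mg [g [dgg [mg0 cg]]]] := cut_height e01 eab ltr01.
  have hmg : h * mg < pi.
    have := cut_h_ge cg; have := hE; move: (h / pi) => w -> h1.
    rewrite -[ltRHS]mul1r mulrAC ltr_pM2r //; lra.
  have hle := cut_h_le cf.
  apply: le_trans (_ : h <= _); last by lra.
  have -> : phi 1 = sigma (time_ham c F).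
    by congr sigma; apply/funext => z; rewrite /time_ham; ring.
  exact: (selector_displaced r0 sP sQ DP DQ P0 dP0 Q0 dQ0 cf da db cg hmg bD bC).
have -> : sigma (time_ham (cst 1) F) = phi 0.
  by congr sigma; apply/funext => z; rewrite /time_ham /=; ring.
have [//|g0] := gap 0; exfalso.
(* 185/100 lies between 182/100, which bounds [phi 1], and 19/10, the upper end of the gap. A path
   from above the gap would have to take this forbidden value. *)
have [||s _ sE] := @IVT R phi 0 1 (185 / 100 * (pi * r ^+ 2)) ler01 _ _.
- by apply: continuous_subspaceT.
- by apply/andP; split; [rewrite ge_min|rewrite le_max]; apply/orP; [right|left]; lra.
by have := gap s; rewrite sE => -[]; lra.
Qed.

End upper_bound.

(** * Comparison of the four capacities *)

Lemma upper_capacity_mono {R : realType} {n : nat} (sigma : tham R n -> R)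
  (A B : set (phase R n)) : A `<=` B -> (upper_capacity sigma A <= upper_capacity sigma B)%E.
Proof.
by move=> AB; apply: le_ereal_sup => _ [H hH <-]; exists H => //; exact: ham_mono AB hH.
Qed.

Lemma lower_capacity_mono {R : realType} {n : nat} (sigma : tham R n -> R)
  (A B : set (phase R n)) : A `<=` B -> (lower_capacity sigma A <= lower_capacity sigma B)%E.
Proof.
by move=> AB; apply: le_ereal_sup => _ [f hf <-]; exists f => //; exact: simple_mono AB hf.
Qed.

Lemma lower_le_upper_capacity {R : realType} {n : nat} (sigma : tham R n -> R)
  (A : set (phase R n)) : (lower_capacity sigma A <= upper_capacity sigma A)%E.
Proof. by apply: le_ereal_sup => _ [f [hf _ _ _] <-]; exists (const_in_time f). Qed.

Lemma euclidean_ball_cylinder {R : realType} {n : nat} (r : R) :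
  (euclidean_ball r : set (phase R n)) `<=` cylinder r.
Proof.
move=> y; apply: le_lt_trans; rewrite (bigD1 ord0) //= lerDl.
by apply: sumr_ge0 => i _; rewrite addr_ge0 ?sqr_ge0.
Qed.

Theorem corollary1p8 (R : realType) (n : nat) (sigma : tham R n -> R)
  (hsigma : action_selector sigma) (r : R) (hr : 0 < r) :
  (lower_capacity sigma (euclidean_ball r) = lower_capacity sigma (cylinder r) /\
   lower_capacity sigma (cylinder r) = (pi * r ^+ 2)%:E) /\
  (upper_capacity sigma (euclidean_ball r) = upper_capacity sigma (cylinder r) /\
   upper_capacity sigma (cylinder r) = (pi * r ^+ 2)%:E).
Proof.
have lo : ((pi * r ^+ 2)%:E <= lower_capacity sigma (euclidean_ball r))%E.
  apply/lee_addgt0Pr => e e0; have [f sf fe] := selector_lower_bound hsigma hr e0.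
  apply: (@le_trans _ _ (sigma (const_in_time f) + e)%:E); first by rewrite lee_fin -lerBlDr.
  by rewrite EFinD leeD2r //; apply: ereal_sup_ubound; exists f.
have up : (upper_capacity sigma (cylinder r) <= (pi * r ^+ 2)%:E)%E.
  by apply: ge_ereal_sup => _ [H hH <-]; rewrite lee_fin;
    exact: (selector_upper_bound hsigma hr hH).
(* The least of the four capacities is the lower one of the ball and the greatest is the upper one
   of the cylinder, so the bounds [lo] and [up] fix all of them. *)
have BZ := @euclidean_ball_cylinder R n r.
have l1 := lower_capacity_mono sigma BZ; have l2 := upper_capacity_mono sigma BZ.
have l3 := lower_le_upper_capacity sigma (euclidean_ball r).
have l4 := lower_le_upper_capacity sigma (cylinder r).
have squeeze (x y : \bar R) : (x <= y -> y <= x -> x = y)%E.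
  by move=> xy yx; apply/eqP; rewrite eq_le xy.
have lZ : lower_capacity sigma (cylinder r) = (pi * r ^+ 2)%:E.
  by apply: squeeze; [exact: le_trans l4 up|exact: le_trans lo l1].
have uZ : upper_capacity sigma (cylinder r) = (pi * r ^+ 2)%:E.
  by apply: squeeze => //; rewrite -lZ.
split; split=> //; apply: squeeze => //; rewrite ?lZ ?uZ //.
exact: le_trans lo l3.
Qed.
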